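(* In the Feynman–Kac particle setting described in the context, for any $n,d\ge1$, any collection of bounded measurable functions $f_n^1,\dots,f_n^d:F_n\to\mathbb{R}$ and any sequence $(\nu^i)_{1\le i\le d}\in\{\gamma,\eta\}^d$, the random products $\prod_{i=1}^d\mathcal{W}_n^{\nu^i,N}(f_n^i)$ converge in law, as $N\to\infty$, to the Gaussian products $\prod_{i=1}^d\mathcal{W}_n^{\nu^i}(f_n^i)$. In addition, $$\lim_{N\to\infty}\mathbb{E}\Big[\prod_{i=1}^d\mathcal{W}_n^{\nu^i,N}(f_n^i)\Big]=\mathbb{E}\Big[\prod_{i=1}^d\mathcal{W}_n^{\nu^i}(f_n^i)\Big].$$
   Context: Markov chain. $(X_n)_{n\ge0}$ is a (nonhomogeneous) Markov chain with $X_n$ taking values in a measurable space $(E_n,\mathcal{E}_n)$, Markov transition kernels $K_n(x_{n-1},dx_n)$ from $E_{n-1}$ to $E_n$, and deterministic initial value $X_0=x_0$. $F_n=E_0\times\cdots\times E_n$ and $Y_n=(X_0,\dots,X_n)\in F_n$ is the historical process, with Markov transitions $M_n(y_{n-1},dy_n)$ (keep the path $y_{n-1}$ and append a point drawn from $K_n$ started at its last coordinate). $\mathcal{B}_b(F_n)$ is the space of bounded measurable real functions on $F_n$. Potentials. $G_n:F_n\to(0,\infty)$, $n\ge1$, are measurable with $\sup_{(y,y')\in F_n^2}G_n(y)/G_n(y')<\infty$ for each $n$. Feynman–Kac measures. For $f_n\in\mathcal{B}_b(F_n)$, $n\ge1$: $\gamma_n(f_n)=\mathbb{E}[f_n(Y_n)\prod_{1\le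 k<n}G_k(Y_k)]$ and $\eta_n(f_n)=\gamma_n(f_n)/\gamma_n(1)$ (empty products equal $1$). For $n\ge2$ and a probability measure $\mu$ on $F_{n-1}$, $\Phi_n(\mu)(dy_n)=\int_{F_{n-1}}\mu(dy_{n-1})G_{n-1}(y_{n-1})M_n(y_{n-1},dy_n)/\mu(G_{n-1})$; one has $\eta_1=M_1(x_0,\cdot)$ and $\eta_n=\Phi_n(\eta_{n-1})$. The Feynman–Kac semigroup is $Q_{p,n}(f_n)(y_p)=\mathbb{E}[f_n(Y_n)\prod_{p\le k<n}G_k(Y_k)\mid Y_p=y_p]$ for $1\le p<n$ and $Q_{n,n}=\mathrm{Id}$. Particle system. For each $N\ge1$, $\xi_n=(\xi_n^i)_{1\le i\le N}$, $n\ge1$, is a Markov chain with $\xi_n\in F_n^N$: $\xi_1^1,\dots,\xi_1^N$ are i.i.d. with law $\eta_1$, and for $n\ge2$, conditionally on $\xi_1,\dots,\xi_{n-1}$, the $\xi_n^1,\dots,\xi_n^N$ are i.i.d. with law $\Phi_n(\eta_{n-1}^N)$, where $\eta_n^N=\frac1N\sum_{i=1}^N\delta_{\xi_n^i}$. Set $\gamma_n^N(f_n)=\eta_n^N(f_n)\prod_{1\le p<n}\eta_p^N(G_p)$. Random fields. For $f_n\in\mathcal{B}_b(F_n)$, $\mathcal{W}_n^{\gamma,N}(f_n)=\sqrt N\,[\gamma_n^N(f_n)-\gamma_n(f_n)]$ and $\mathcal{W}_n^{\eta,N}(f_n)=\sqrt N\,[\eta_n^N(f_n)-\eta_n(f_n)]$.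 Let $\mathcal{W}_1,\dots,\mathcal{W}_n$ be independent centered Gaussian random fields, $\mathcal{W}_p$ being indexed by $\mathcal{B}_b(F_p)$, with covariance $\mathbb{E}[\mathcal{W}_p(f_p)\mathcal{W}_p(g_p)]=\eta_p([f_p-\eta_p(f_p)][g_p-\eta_p(g_p)])$. The limiting Gaussian fields, both built from the same $(\mathcal{W}_p)_{1\le p\le n}$, are $\mathcal{W}_n^{\gamma}(f_n)=\sum_{p=1}^n\gamma_p(1)\,\mathcal{W}_p(Q_{p,n}f_n)$ and $\mathcal{W}_n^{\eta}(f_n)=\mathcal{W}_n^{\gamma}\big(\tfrac{1}{\gamma_n(1)}(f_n-\eta_n(f_n))\big)$. *)

(* Defs.v *)
From HB Require Import structures.
From mathcomp Require Import all_boot all_order all_algebra.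
From mathcomp Require Import all_classical all_reals all_analysis.

Set Implicit Arguments.
Unset Strict Implicit.
Unset Printing Implicit Defensive.

Import Order.TTheory GRing.Theory Num.Theory.
Import numFieldNormedType.Exports.

Local Open Scope classical_set_scope.
Local Open Scope ring_scope.

(* The path space F_n = E_0 x ... x E_n, associated to the left, so that
   F_(n+1) = F_n x E_(n+1) holds by conversion. *)
Fixpoint path_display (dE : nat -> measure_display) (n : nat) :
    measure_display :=
  if n is m.+1 then measure_prod_display (path_display dE m, dE m.+1)
  else dE 0%N.

Fixpoint path_space (dE : nat -> measure_display)
    (E : forall n, measurableType (dE n)) (n : nat) :
    measurableType (path_display dE n) :=
  if n is m.+1 then (path_space E m * E m.+1)%type : measurableType _
  else E 0%N.

Definition last_coord (dE : nat -> measure_display)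
    {E : forall n, measurableType (dE n)} (n : nat) : path_space E n -> E n :=
  match n with 0%N => fun y => y | _.+1 => fun y => y.2 end.

Arguments last_coord {dE E} n y.

Definition bounded_measurable {R : realType} {d : measure_display}
    {T : measurableType d} (f : T -> R) : Prop :=
  measurable_fun [set: T] f /\ bounded_fun f.

Section empirical_measure.
Context {R : realType} {d : measure_display} {T : measurableType d}.
Context {N : nat} (x : 'I_N -> T).
Local Open Scope ereal_scope.

Definition empirical (A : set T) : \bar R :=
  (N%:R^-1)%:E * \sum_(i < N) \d_(x i) A.

Let empirical0 : empirical set0 = 0.
Proof. by rewrite /empirical big1 ?mule0// => i _; rewrite measure0. Qed.

Let empirical_ge0 A : 0 <= empirical A.
Proof.
by rewrite /empirical mule_ge0 ?lee_fin ?invr_ge0// sume_ge0.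
Qed.

Let empirical_sigma_additive : semi_sigma_additive empirical.
Proof.
move=> A mA tA mbA.
have -> : empirical (\bigcup_n A n) = \sum_(0 <= k <oo) empirical (A k).
  rewrite /empirical nneseriesZl; last by move=> k _; exact: sume_ge0.
  congr (_ * _); rewrite nneseries_sum//.
  by apply: eq_bigr => i _; exact: measure_semi_bigcup.
by apply: is_cvg_nneseries => k _ _; exact: empirical_ge0.
Qed.

HB.instance Definition _ := isMeasure.Build _ _ _ empirical
  empirical0 empirical_ge0 empirical_sigma_additive.

End empirical_measure.

Definition cvg_in_law {R : realType} {dT : nat -> measure_display}
    {T : forall N, measurableType (dT N)} (P : forall N, probability (T N) R)
    (Z : forall N, T N -> R)
    {dS : measure_display} {S : measurableType dS} (P' : probability S R)
    (Z' : S -> R) : Prop :=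
  forall h : R -> R, continuous h -> bounded_fun h ->
    ('E_(P N)[h \o Z N] @[N --> \oo] --> 'E_P'[h \o Z'])%E.

(* normal_prob 0 0 is the uniform law on [0, 1], hence the case distinction. *)
Definition centered_gaussian_rv {R : realType} {d : measure_display}
    {T : measurableType d} (P : probability T R) (Z : T -> R) : Prop :=
  measurable_fun [set: T] Z /\
  exists s : R, 0 <= s /\ forall A : set R, measurable A ->
    P (Z @^-1` A) = if s == 0 then \d_(0 : R) A else normal_prob 0 s A.

Unset Implicit Arguments.

Section feynman_kac.
Context {R : realType} {dE : nat -> measure_display}.
Context {E : forall n, measurableType (dE n)}.
Local Notation F := (path_space E).

(* Transitions are indexed by their source: K n is the kernel from E_n to
   E_(n+1), usually written K_(n+1); likewise for [hist_transition] (M_(n+1))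
   and [Phi] (Phi_(n+1)) below. *)
Variable K : forall n, R.-pker E n ~> E n.+1.
Variable x0 : E 0%N.

Definition hist_transition n (y : F n) : set (F n.+1) -> \bar R :=
  pushforward (K n (last_coord n y)) (fun x : E n.+1 => (y, x) : F n.+1).

Context {dO : measure_display} {Omega : measurableType dO}.
Context {P : probability Omega R} (X : forall n, {RV P >-> E n}).

Fixpoint hist n (w : Omega) : F n :=
  if n is m.+1 then (hist m w, X m.+1 w) else X 0%N w.

Definition is_markov_chain : Prop :=
  (forall w, X 0%N w = x0) /\
  forall n (A : set (F n)) (B : set (E n.+1)), measurable A -> measurable B ->
    P (hist n @^-1` A `&` X n.+1 @^-1` B)
    = (\int[P]_(w in hist n @^-1` A) K n (X n w) B)%E.

(* Only G n for n >= 1 matters. *)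
Variable G : forall n, F n -> R.

Definition is_potential : Prop :=
  forall n, (0 < n)%N ->
    [/\ measurable_fun [set: F n] (G n),
        forall y, 0 < G n y &
        exists c : R, forall y y' : F n, G n y / G n y' <= c].

Definition gamma n (f : F n -> R) : R :=
  fine 'E_P[fun w => (f (hist n w) * \prod_(1 <= k < n) G k (hist k w))%R]%E.

Definition eta n (f : F n -> R) : R := gamma n f / gamma n (cst 1).

Definition Phi n (mu : {measure set (F n) -> \bar R}) (A : set (F n.+1)) :
    \bar R :=
  ((fine (\int[mu]_y (G n y)%:E))^-1%:E *
   \int[mu]_y ((G n y)%:E * hist_transition n y A))%E.

(* Q p n f is a bounded measurable version of the conditional expectation
   y |-> E[f(Y_n) \prod_(p <= k < n) G_k(Y_k) | Y_p = y]. Such a version is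
   determined up to eta_p-null sets; the one obtained by integrating the
   transition kernels is an instance. *)
Definition is_fk_semigroup (Q : forall p n, (F n -> R) -> F p -> R) : Prop :=
  forall n (f : F n -> R), bounded_measurable f ->
    Q n n f = f /\
    forall p, (0 < p < n)%N ->
      bounded_measurable (Q p n f) /\
      forall A : set (F p), measurable A ->
        (\int[P]_(w in hist p @^-1` A) (Q p n f (hist p w))%:E
         = \int[P]_(w in hist p @^-1` A)
             (f (hist n w) * \prod_(p <= k < n) G k (hist k w))%R%:E)%E.

Section particles.
Context {N : nat} {dT : measure_display} {T : measurableType dT}.
Context {PN : probability T R}.
(* xi n i is the i-th particle at time n; only times n >= 1 matter. *)
Variable xi : forall n, 'I_N -> {RV PN >-> F n}.

Definition emp n (w : T) : {measure set (F n) -> \bar R} :=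
  empirical (fun i => xi n i w).

Definition particle_sigma_algebra n : set (set T) :=
  <<s [set B | exists k i (A : set (F k)),
        [/\ (0 < k <= n)%N, measurable A & B = xi k i @^-1` A]] >>.

Definition is_particle_system : Prop :=
  (forall A : 'I_N -> set (F 1%N), (forall i, measurable (A i)) ->
    PN (\bigcap_i (xi 1%N i @^-1` A i))
    = (\prod_(i < N) (eta 1%N (\1_(A i)))%:E)%E) /\
  (forall n, (0 < n)%N ->
    forall B, particle_sigma_algebra n B ->
    forall A : 'I_N -> set (F n.+1), (forall i, measurable (A i)) ->
    PN (B `&` \bigcap_i (xi n.+1 i @^-1` A i))
    = (\int[PN]_(w in B) \prod_(i < N) Phi n (emp n w) (A i))%E).

Definition etaN n (f : F n -> R) (w : T) : R :=
  fine (\int[emp n w]_y (f y)%:E)%E.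

Definition gammaN n (f : F n -> R) (w : T) : R :=
  etaN n f w * \prod_(1 <= p < n) etaN p (G p) w.

Definition WgammaN n (f : F n -> R) (w : T) : R :=
  Num.sqrt N%:R * (gammaN n f w - gamma n f).

Definition WetaN n (f : F n -> R) (w : T) : R :=
  Num.sqrt N%:R * (etaN n f w - eta n f).

End particles.

Section gaussian_fields.
Context {dS : measure_display} {S : measurableType dS}.
Variable PS : probability S R.
(* The field W p is only meaningful on bounded measurable functions. *)
Variable W : forall p, (F p -> R) -> S -> R.

Definition is_centered_gaussian_field p : Prop :=
  forall (m : nat) (f : 'I_m -> F p -> R) (c : 'I_m -> R),
    (forall j, bounded_measurable (f j)) ->
    centered_gaussian_rv PS (fun w => \sum_(j < m) c j * W p (f j) w).

Definition has_fk_covariance p : Prop :=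
  forall f g : F p -> R, bounded_measurable f -> bounded_measurable g ->
    'E_PS[fun w => (W p f w * W p g w)%R]%E
    = (eta p (fun y => (f y - eta p f) * (g y - eta p g)))%:E.

Definition field_sigma_algebra p : set (set S) :=
  <<s [set B | exists (f : F p -> R) (A : set R),
        [/\ bounded_measurable f, measurable A & B = W p f @^-1` A]] >>.

(* Each B p may be the whole space, so the product rule over the full range
   1..n contains the rule over its subsets. *)
Definition independent_fields n : Prop :=
  forall B : nat -> set S,
    (forall p, (0 < p <= n)%N -> field_sigma_algebra p (B p)) ->
    PS (\bigcap_(p in [set p | (0 < p <= n)%N]) B p)
    = (\prod_(1 <= p < n.+1) PS (B p))%E.

Definition is_fk_gaussian_family n : Prop :=
  (forall p, (0 < p <= n)%N ->
     is_centered_gaussian_field p /\ has_fk_covariance p) /\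
  independent_fields n.

Variable Q : forall p n, (F n -> R) -> F p -> R.

Definition Wgamma n (f : F n -> R) (w : S) : R :=
  \sum_(1 <= p < n.+1) gamma p (cst 1) * W p (Q p n f) w.

Definition Weta n (f : F n -> R) (w : S) : R :=
  Wgamma n (fun y => (gamma n (cst 1))^-1 * (f y - eta n f)) w.

End gaussian_fields.

End feynman_kac.

Inductive fk_kind := GammaKind | EtaKind.

(* Main.v *)
Require Import Defs.
From HB Require Import structures.
From mathcomp Require Import all_boot all_order all_algebra.
From mathcomp Require Import all_classical all_reals all_analysis measurable_realfun.
From mathcomp Require Import ring lra zify.

Set Implicit Arguments.
Unset Strict Implicit.
Unset Printing Implicit Defensive.

Import Order.TTheory GRing.Theory Num.Theory.
Import numFieldNormedType.Exports.

Local Open Scope classical_set_scope.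
Local Open Scope ring_scope.

(* The particle measure differs from the Feynman-Kac measure by a telescoping
   sum of local errors: [WgammaN n f] is the sum over [p <= n] of
   [gammaN_p 1 * sqrt N * (etaN_p (g_p) - Phi_p (etaN_(p-1)) (g_p))] with
   [g_p = Q_(p,n) f], while [WetaN n f] is [gamma_n 1 / gammaN_n 1] times
   [WgammaN] at the centered function [(f - eta_n f) / gamma_n 1].  Given the
   past, the particles at time [p] are independent, so a conditional Lindeberg
   argument and a law of large numbers in L1 show that the local errors are
   asymptotically independent Gaussian variables, jointly in the functions, and
   a conditional exponential moment bounds all their moments uniformly in [N].
   The products converge by the continuous mapping theorem, obtained from joint
   characteristic functions [E cos (th + <t, V>)] by trigonometric
   approximation, and their expectations by uniform integrability.  The phase
   [th] makes real cosines carry the information of complex exponentials. *)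

(** The semigroup [Q] is given only up to null sets of [eta p], so a pointwise telescoping cannot be
    run with it. The particle side uses a version [g] built from the kernels, whose backward
    recursion holds everywhere; the Gaussian side sees [Q] only through integrals against [eta p],
    where [Q] and [g] agree. The limit field [W p] is not assumed linear in its argument: linear
    combinations stay outside [W p], and only their variance is compared with that of a combined
    function. The spaces carrying the particles vary with [N], so almost sure convergence has no
    meaning and every limit is one of real expectations. The conditional variances are random; their
    L1 convergence to constants is what decouples the time steps. Hypotheses are stated on events
    and used on functions: the passage is made by [bounded_functional_eq], two sup-norm continuous
    linear functionals that agree on indicators being equal. Integrability of the Gaussian product
    is not computed: it comes out of the particle moments by Fatou's lemma. *)

Local Notation bm := bounded_measurable.
Local Notation Ex P f := (Rintegral P [set: _] f).

(** * Bounded measurable functions *)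

Section bm_calculus.
Context {R : realType} {d : measure_display} {T : measurableType d}.
Implicit Types (f g : T -> R).

Lemma bounded_measurableP f : bm f <->
  measurable_fun setT f /\ exists M, forall x, `|f x| <= M.
Proof.
split=> -[mf].
  move=> /pinfty_ex_gt0[M _ fM]; split=> //; exists M => x; exact: fM.
move=> [M fM]; split => //.
exists M; split; first exact: num_real.
by move=> y My x _; apply: le_trans (fM x) _; exact: ltW.
Qed.

Lemma bm_meas f : bm f -> measurable_fun setT f.
Proof. by case. Qed.

Lemma bm_bound f : bm f ->
  exists M, 0 < M /\ forall x, `|f x| <= M.
Proof.
move=> /bounded_measurableP[_ [M fM]]; exists (`|M| + 1); split.
  by rewrite ltr_wpDl.
by move=> x; rewrite (le_trans (fM x))// (le_trans (ler_norm M))// lerDl.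
Qed.

Lemma bm_intro f M : measurable_fun setT f -> (forall x, `|f x| <= M) ->
  bm f.
Proof. by move=> mf fM; apply/bounded_measurableP; split => //; exists M. Qed.

Lemma bm_cst (c : R) : bm (fun _ : T => c).
Proof. by apply: (@bm_intro _ `|c|). Qed.

Lemma bm_add f g : bm f -> bm g ->
  bm (fun x => f x + g x).
Proof.
move=> hf hg; have [M [_ fM]] := bm_bound hf; have [M' [_ gM]] := bm_bound hg.
apply: (@bm_intro _ (M + M')).
  by apply: measurable_funD; exact: bm_meas.
by move=> x; rewrite (le_trans (ler_normD _ _))// lerD.
Qed.

Lemma bm_mul f g : bm f -> bm g ->
  bm (fun x => f x * g x).
Proof.
move=> hf hg; have [M [_ fM]] := bm_bound hf; have [M' [_ gM]] := bm_bound hg.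
apply: (@bm_intro _ (M * M')).
  by apply: measurable_funM; exact: bm_meas.
by move=> x; rewrite normrM ler_pM.
Qed.

Lemma bm_scale c f : bm f ->
  bm (fun x => c * f x).
Proof. by apply: bm_mul; exact: bm_cst. Qed.

Lemma bm_opp f : bm f -> bm (fun x => - f x).
Proof.
move=> hf; rewrite (_ : (fun x => - f x) = (fun x => -1 * f x)).
  exact: bm_scale.
by apply/funext => x; rewrite mulN1r.
Qed.

Lemma bm_sub f g : bm f -> bm g ->
  bm (fun x => f x - g x).
Proof. by move=> hf hg; apply: bm_add => //; exact: bm_opp. Qed.

Lemma bm_sum I (r : seq I) (p : pred I) (F : I -> T -> R) :
  (forall i, p i -> bm (F i)) ->
  bm (fun x => \sum_(i <- r | p i) F i x).
Proof.
move=> hF; elim: r => [|i r IH].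
  by under eq_fun do rewrite big_nil; exact: bm_cst.
under eq_fun do rewrite big_cons.
by case: (p i) (hF i) => // /(_ isT) hFi; exact: bm_add.
Qed.

Lemma bm_prod I (r : seq I) (p : pred I) (F : I -> T -> R) :
  (forall i, p i -> bm (F i)) ->
  bm (fun x => \prod_(i <- r | p i) F i x).
Proof.
move=> hF; elim: r => [|i r IH].
  by under eq_fun do rewrite big_nil; exact: bm_cst.
under eq_fun do rewrite big_cons.
by case: (p i) (hF i) => // /(_ isT) hFi; exact: bm_mul.
Qed.

Lemma bm_exp n f : bm f -> bm (fun x => f x ^+ n).
Proof.
move=> hf; elim: n => [|n IH].
  by under eq_fun do rewrite expr0; exact: bm_cst.
by under eq_fun do rewrite exprS; exact: bm_mul.
Qed.

Lemma bm_normr f : bm f -> bm (fun x => `|f x|).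
Proof.
move=> hf; have [M [_ fM]] := bm_bound hf.
apply: (@bm_intro _ M); last by move=> x; rewrite normr_id.
by apply: measurableT_comp => //; exact: bm_meas.
Qed.

Lemma bm_indic A : measurable A -> bm (\1_A : T -> R).
Proof.
move=> mA; apply: (@bm_intro _ 1); first exact: measurable_indic.
by move=> x; rewrite indicE; case: (_ \in _); rewrite ?normr1 ?normr0.
Qed.

Lemma bm_comp_bounded (u : R -> R) f M : measurable_fun setT u ->
  (forall x, `|u x| <= M) -> measurable_fun setT f ->
  bm (fun x => u (f x)).
Proof.
by move=> mu uM mf; apply: (@bm_intro _ M) => //; exact: measurableT_comp.
Qed.

Lemma bm_cos f : measurable_fun setT f -> bm (fun x => cos (f x)).
Proof.
apply: (@bm_comp_bounded cos _ 1) => //.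
  by apply: continuous_measurable_fun; exact: continuous_cos.
by move=> x; rewrite ler_norml cos_geN1 cos_le1.
Qed.

Lemma bm_sin f : measurable_fun setT f -> bm (fun x => sin (f x)).
Proof.
apply: (@bm_comp_bounded sin _ 1) => //.
  by apply: continuous_measurable_fun; exact: continuous_sin.
by move=> x; rewrite ler_norml sin_geN1 sin_le1.
Qed.

Lemma bm_expR f : bm f ->
  bm (fun x => expR (f x)).
Proof.
move=> hf; have [M [_ fM]] := bm_bound hf.
apply: (@bm_intro _ (expR M)).
  by apply: measurableT_comp => //; exact: bm_meas.
move=> x; rewrite ger0_norm ?expR_ge0// ler_expR.
by rewrite (le_trans (ler_norm _)).
Qed.

Lemma bm_inv f c : bm f -> 0 < c -> (forall x, c <= f x) ->
  bm (fun x => (f x)^-1).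
Proof.
move=> hf c0 cf; apply: (@bm_intro _ c^-1).
  (* Written as [expR (- ln (f x))], the inverse is measurable by composition; [c <= f x] keeps the
     argument of [ln] positive. *)
  rewrite (_ : (fun x => _) = (fun x => expR (- ln (f x)))).
    apply: measurableT_comp => //; apply: measurableT_comp => //.
    by apply: measurableT_comp => //; exact: bm_meas.
  by apply/funext => x; rewrite expRN lnK// posrE (lt_le_trans c0).
move=> x; have f0 : 0 < f x by apply: lt_le_trans (cf x).
by rewrite ger0_norm ?invr_ge0 ?(ltW f0)// lef_pV2 ?posrE.
Qed.

End bm_calculus.

Lemma bm_pre {R : realType} {d} {T : measurableType d} {d'}
    {T' : measurableType d'} (h : T' -> T) (f : T -> R) :
  measurable_fun setT h -> bm f ->
  bm (fun x => f (h x)).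
Proof.
move=> mh hf; have [M [_ fM]] := bm_bound hf.
apply: (@bm_intro _ _ _ _ M) => //; apply: measurableT_comp => //.
exact: bm_meas.
Qed.

#[local] Hint Resolve bm_cst : core.

(** * Expectations of bounded measurable functions *)

Section expectation.
Context {R : realType} {d : measure_display} {T : measurableType d}.
Variable P : probability T R.
Implicit Types f g : T -> R.

Lemma bm_integrable f : bm f -> P.-integrable setT (EFin \o f).
Proof.
case=> mf bf; apply: measurable_bounded_integrable => //.
by rewrite /= probability_setT ltry.
Qed.

Lemma Ex_EFin f : bm f ->
  (\int[P]_x (f x)%:E)%E = (Ex P f)%:E.
Proof.
move=> hf; rewrite /Rintegral fineK//.
by apply: integrable_fin_num => //; exact: bm_integrable.
Qed.

Lemma expectation_Ex f : bm f -> 'E_P[f]%E = (Ex P f)%:E.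
Proof. by move=> hf; rewrite -Ex_EFin// unlock. Qed.

Lemma Ex_cst c : Ex P (fun=> c) = c.
Proof. by rewrite Rintegral_cst//= probability_setT mulr1. Qed.

Lemma ExD f g : bm f -> bm g ->
  Ex P (fun x => f x + g x) = Ex P f + Ex P g.
Proof. by move=> hf hg; rewrite RintegralD//; exact: bm_integrable. Qed.

Lemma ExB f g : bm f -> bm g ->
  Ex P (fun x => f x - g x) = Ex P f - Ex P g.
Proof. by move=> hf hg; rewrite RintegralB//; exact: bm_integrable. Qed.

Lemma ExZ c f : bm f -> Ex P (fun x => c * f x) = c * Ex P f.
Proof. by move=> hf; rewrite RintegralZl//; exact: bm_integrable. Qed.

Lemma Ex_sum I (r : seq I) (F : I -> T -> R) :
  (forall i, bm (F i)) ->
  Ex P (fun x => \sum_(i <- r) F i x) = \sum_(i <- r) Ex P (F i).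
Proof.
move=> hF; elim: r => [|i r IH].
  by rewrite big_nil; under eq_fun do rewrite big_nil; rewrite Ex_cst.
rewrite big_cons -IH -ExD//; last exact: bm_sum.
by congr (Ex P _); apply/funext => x; rewrite big_cons.
Qed.

Lemma Ex_indic A : measurable A -> Ex P (\1_A) = fine (P A).
Proof. by move=> mA; rewrite /Rintegral integral_indic// setIT. Qed.

Lemma Ex_ge0 f : (forall x, 0 <= f x) -> 0 <= Ex P f.
Proof. by move=> f0; apply: Rintegral_ge0. Qed.

Lemma Ex_le f g : bm f -> bm g ->
  (forall x, f x <= g x) -> Ex P f <= Ex P g.
Proof. by move=> hf hg fg; apply: le_Rintegral => //; exact: bm_integrable. Qed.

Lemma Ex_norm f : bm f -> `|Ex P f| <= Ex P (fun x => `|f x|).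
Proof. by move=> hf; apply: le_normr_Rintegral => //; exact: bm_integrable. Qed.

Lemma Ex_norm_le f g : bm f -> bm g ->
  (forall x, `|f x| <= g x) -> `|Ex P f| <= Ex P g.
Proof.
move=> hf hg fg; apply: (le_trans (Ex_norm hf)).
by apply: Ex_le => //; exact: bm_normr.
Qed.

Lemma Ex_bound f M : bm f -> (forall x, `|f x| <= M) ->
  `|Ex P f| <= M.
Proof.
by move=> hf fM; rewrite -[leRHS](Ex_cst M); apply: Ex_norm_le.
Qed.

Lemma Ex_pre d' (T' : measurableType d') (X : T -> T') A :
  measurable_fun setT X -> measurable A ->
  Ex P (fun w => \1_A (X w)) = fine (P (X @^-1` A)).
Proof.
move=> mX mA; rewrite -Ex_indic//.
by rewrite -[X in measurable X]setTI; apply: mX.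
Qed.

End expectation.

(** * Functionals determined by their values on indicators *)

Section bounded_functional.
Context {R : realType} {d : measure_display} {T : measurableType d}.
Implicit Types f g : T -> R.

(** For [0 <= y] this is the minimum of [K] and the integer part of [y], written as a sum of
    indicators of upper level sets. *)
Let layer_count K (y : R) : R := \sum_(k < K) (if k.+1%:R <= y then 1 else 0).

Let layer_countP K y : 0 <= y ->
  (K%:R <= y -> layer_count K y = K%:R) /\
  (y <= K%:R -> y - 1 <= layer_count K y <= y).
Proof.
move=> y0; elim: K => [|K [IH1 IH2]].
  by rewrite /layer_count big_ord0; split => // y1; apply/andP; split; lra.
rewrite /layer_count big_ord_recr/= -/(layer_count K y).
have SK : K.+1%:R = K%:R + 1 :> R by rewrite -natr1.
rewrite SK; case: ifPn => [Ky|]; last rewrite -ltNge => yK.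
  rewrite IH1; last by lra.
  by split=> // yK; apply/andP; split; lra.
split; first by lra.
move=> _; rewrite addr0; have [Ky|yK'] := leP K%:R y.
  by rewrite IH1//; apply/andP; split; lra.
by apply: IH2; exact: ltW.
Qed.

(** Rounding [(f + M) / e] down to an integer approximates [f] uniformly within [e] by [- M] plus
    [e] times a finite sum of indicators of level sets, so indicators, linear combinations and
    uniform limits reach every bounded measurable function. *)
Lemma bounded_measurable_ind (Pr : (T -> R) -> Prop) :
  (forall A, measurable A -> Pr (\1_A)) ->
  (forall a f g, bm f -> bm g ->
    Pr f -> Pr g -> Pr (fun x => a * f x + g x)) ->
  (forall f, bm f ->
    (forall e, 0 < e -> exists g, [/\ bm g, Pr g &
       forall x, `|f x - g x| <= e]) -> Pr f) ->
  forall f, bm f -> Pr f.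
Proof.
move=> Pind Plin Plim f hf; apply: Plim => // e e0.
have [M [M0 fM]] := bm_bound hf.
pose B k := [set x | (k.+1%:R : R) <= (f x + M) / e].
have mB k : measurable (B k).
  rewrite /B -[X in measurable X]setTI.
  apply: measurable_fun_le => //.
  by apply: measurable_funM => //; apply: measurable_funD => //; exact: bm_meas.
have P0 : Pr (fun=> 0) /\ bm (fun _ : T => 0 : R).
  split => //; have := Pind set0 measurable0.
  by congr Pr; apply/funext => x; rewrite indicE in_set0.
(* [f + M] lies in [[0, 2 * M]], so with this many levels the count never saturates. *)
pose K := (Num.truncn (2 * M / e)).+1.
have hK : 2 * M / e <= K%:R by rewrite ltW// truncnS_gt.
have PK n : Pr (fun x => - M + \sum_(k < n) e * \1_(B k) x) /\
    bm (fun x => - M + \sum_(k < n) e * \1_(B k) x).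
  elim: n => [|n [IH1 IH2]].
    have -> : (fun x => - M + \sum_(k < 0) e * \1_(B k) x) =
        (fun x : T => - M * \1_setT x + 0).
      by apply/funext => x; rewrite big_ord0 indicE in_setT mulr1.
    split; last by apply: bm_add => //; apply: bm_scale; exact: bm_indic.
    apply: Plin; [exact: bm_indic|by apply P0|exact: Pind|by apply P0].
  have -> : (fun x => - M + \sum_(k < n.+1) e * \1_(B k) x) =
      (fun x : T => e * \1_(B n) x + (- M + \sum_(k < n) e * \1_(B k) x)).
    by apply/funext => x; rewrite big_ord_recr/= addrCA addrC; ring.
  split; first by apply: Plin => //; [exact: bm_indic|exact: Pind].
  by apply: bm_add => //; apply: bm_scale; exact: bm_indic.
exists (fun x => - M + \sum_(k < K) e * \1_(B k) x).
split; [exact: (PK K).2|exact: (PK K).1|move=> x].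
rewrite -mulr_sumr.
have -> : \sum_(i < K) \1_(B i) x = layer_count K ((f x + M) / e) :> R.
  rewrite /layer_count; apply: eq_bigr => i _; rewrite indicE.
  by case: ifPn => [h|/negP h]; [rewrite mem_set|rewrite memNset].
have fxM : 0 <= (f x + M) / e.
  by rewrite divr_ge0 ?(ltW e0)//; move: (fM x); rewrite ler_norml; lra.
have [_ /(_ _)/andP[|h1 h2]] := layer_countP K fxM.
  rewrite (le_trans _ hK)// ler_pM2r ?invr_gt0//.
  by move: (fM x); rewrite ler_norml; lra.
set l := layer_count _ _ in h1 h2 *.
have : e * ((f x + M) / e) = f x + M by rewrite mulrC divfK// gt_eqF.
move: (ler_wpM2l (ltW e0) h1) (ler_wpM2l (ltW e0) h2).
rewrite mulrBr mulr1 => a1 a2 eE; rewrite eE in a1 a2.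
by rewrite ler_norml; apply/andP; split; lra.
Qed.

(** Continuity is for the sup norm and no sign is required, so integration against a signed bounded
    density qualifies. *)
Definition bounded_functional (L : (T -> R) -> R) :=
  (forall a f g, bm f -> bm g ->
     L (fun x => a * f x + g x) = a * L f + L g) /\
  exists C, 0 <= C /\ forall f e, bm f ->
     (forall x, `|f x| <= e) -> `|L f| <= C * e.

(** The functions on which [L1] and [L2] agree are stable under linear combinations and uniform
    limits, so [bounded_measurable_ind] applies. Laws known on events are transferred to bounded
    functions in this way. *)
Lemma bounded_functional_eq L1 L2 : bounded_functional L1 ->
  bounded_functional L2 ->
  (forall A, measurable A -> L1 (\1_A) = L2 (\1_A)) ->
  forall f, bm f -> L1 f = L2 f.
Proof.
move=> [lin1 [C1 [C10 b1]]] [lin2 [C2 [C20 b2]]] L12.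
apply: bounded_measurable_ind => //.
  by move=> a f g hf hg f12 g12; rewrite lin1// lin2// f12 g12.
move=> f hf fap; apply/eqP; rewrite -subr_eq0 -normr_le0.
apply/ler_addgt0Pl => e e0; rewrite addr0.
(* Adding [1] keeps the divisor positive when both constants vanish. *)
have C0 : 0 < C1 + C2 + 1 by lra.
have [g [hg gE fg]] := fap (e / (C1 + C2 + 1)) (divr_gt0 e0 C0).
have hfg : bm (fun x => -1 * g x + f x).
  by apply: bm_add => //; exact: bm_scale.
have fg' x : `|-1 * g x + f x| <= e / (C1 + C2 + 1) by rewrite mulN1r addrC.
have := b1 _ _ hfg fg'; have := b2 _ _ hfg fg'.
rewrite lin1// lin2// gE.
have -> : L1 f - L2 f = (-1 * L2 g + L1 f) - (-1 * L2 g + L2 f) by ring.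
move=> h2 h1; rewrite (le_trans (ler_normB _ _))// (le_trans (lerD h1 h2))//.
rewrite -mulrDl mulrA ler_pdivrMr// mulrC ler_pM2l//; lra.
Qed.

End bounded_functional.

Lemma bounded_functional_Ex {R : realType} {d} {T : measurableType d}
    {d'} {T' : measurableType d'} (P : probability T R) (Psi : T -> R)
    (X : T -> T') : bm Psi -> measurable_fun setT X ->
  bounded_functional (fun u : T' -> R => Ex P (fun w => Psi w * u (X w))).
Proof.
move=> hPsi mX; split.
  move=> a f g hf hg; have hfX := bm_pre mX hf; have hgX := bm_pre mX hg.
  rewrite -ExZ; last exact: bm_mul.
  rewrite -ExD; [|by apply: bm_scale; exact: bm_mul|exact: bm_mul].
  by congr Rintegral; apply/funext => w; ring.
have [M [M0 hM]] := bm_bound hPsi; exists M; split; first exact: ltW.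
move=> f e hf fe; apply: Ex_bound.
  by apply: bm_mul => //; exact: bm_pre.
by move=> x; rewrite normrM ler_pM.
Qed.

Definition upd (I : eqType) A (u : I -> A) (k : I) (v : A) i :=
  if i == k then v else u i.

(** One slot is freed at a time: the induction on [m] allows arbitrary functions in the slots below
    [m] and indicators in the others, and each step is [bounded_functional_eq] in the slot being
    freed. *)
Lemma multilinear_ext {R : realType} {d} {T : measurableType d} (N : nat)
    (L1 L2 : ('I_N -> T -> R) -> R) :
  (forall k u, (forall i, bm (u i)) ->
    bounded_functional (fun v => L1 (upd u k v))) ->
  (forall k u, (forall i, bm (u i)) ->
    bounded_functional (fun v => L2 (upd u k v))) ->
  (forall A : 'I_N -> set T, (forall i, measurable (A i)) ->
    L1 (fun i => \1_(A i)) = L2 (fun i => \1_(A i))) ->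
  forall u, (forall i, bm (u i)) -> L1 u = L2 u.
Proof.
move=> b1 b2 L12.
have main m u : (forall i, bm (u i)) ->
    (forall i : 'I_N, (m <= i)%N -> exists2 A, measurable A & u i = \1_A) ->
    L1 u = L2 u.
  elim: m u => [|m IH] u hu hi.
    have [A AE] := choice (fun i => let: ex_intro2 A a b := hi i (leq0n _) in
      ex_intro (fun A => measurable A /\ u i = \1_A) A (conj a b)).
    rewrite (_ : u = fun i => \1_(A i)); last by apply/funext => i; case: (AE i).
    by apply: L12 => i; case: (AE i).
  have [mN|Nm] := ltnP m N; last first.
    by apply: IH => // i mi; have := ltn_ord i; rewrite ltnNge (leq_trans Nm mi).
  pose k := Ordinal mN.
  have updk : upd u k (u k) = u.
    by apply/funext => i; rewrite /upd; case: eqP => [->|].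
  rewrite -updk.
  apply: (bounded_functional_eq (b1 k u hu) (b2 k u hu)) => // A mA.
  apply: IH => i; rewrite /upd; case: eqP => [ik|/eqP ik]//.
  - exact: bm_indic.
  - by exists A.
  - by move=> mi; apply: hi; rewrite ltn_neqAle mi andbT eq_sym.
by move=> u hu; apply: (main N) => // i; rewrite leqNgt ltn_ord.
Qed.

(** * Convergence in law of products *)

Section trigonometric_inequalities.
Context {R : realType}.
Implicit Types x y : R.

(** The mean value theorem on both sides of [0]. Since [M] may depend on the distance to [0], a
    bound on the derivative can be fed back in to raise the order, which yields Taylor estimates. *)
Lemma le_MVT (f df : R -> R) (M : R -> R) x :
  (forall z : R, is_derive z 1 f (df z)) ->
  (forall z, `|z| <= `|x| -> `|df z| <= M `|z|) ->
  (forall a b, 0 <= a -> a <= b -> M a <= M b) ->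
  `|f x - f 0| <= M `|x| * `|x|.
Proof.
move=> fdf dfM Mhomo.
have cf A : {within A, continuous f}.
  apply: continuous_subspaceT => z.
  apply: differentiable_continuous; apply/derivable1_diffP.
  by have [] := fdf z.
have [x0|x0] := leP 0 x.
  have [c cx ->] := MVT_segment x0 (fun z _ => fdf z) (cf _).
  rewrite subr0 normrM ler_wpM2r//.
  have cx' : `|c| <= `|x|.
    by move: cx; rewrite in_itv/= => /andP[c0 cx]; rewrite !ger0_norm.
  by rewrite (le_trans (dfM _ cx'))// Mhomo.
have [c cx E] := MVT_segment (ltW x0) (fun z _ => fdf z) (cf _).
rewrite distrC E sub0r normrM normrN ler_wpM2r//.
have cx' : `|c| <= `|x|.
  by move: cx; rewrite in_itv/= => /andP[xc c0]; rewrite !ler0_norm ?lerN2// ltW.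
by rewrite (le_trans (dfM _ cx'))// Mhomo.
Qed.

Lemma norm_cos_le1 x : `|cos x| <= 1.
Proof. by rewrite ler_norml cos_geN1 cos_le1. Qed.

Lemma norm_sin_le1 x : `|sin x| <= 1.
Proof. by rewrite ler_norml sin_geN1 sin_le1. Qed.

Lemma norm_sin_le x : `|sin x| <= `|x|.
Proof.
have := @le_MVT sin cos (fun=> 1) x _ _ _.
by rewrite sin0 subr0 mul1r; apply=> // z; rewrite norm_cos_le1.
Qed.

Lemma cos_double x : cos x = 1 - 2 * sin (x / 2) ^+ 2.
Proof.
rewrite [in LHS](_ : x = (x / 2) *+ 2); last by rewrite -mulr_natr divfK.
by rewrite cos_mulr2n cos2sin2; ring.
Qed.

Lemma cos_dist_1 x : `|cos x - 1| <= `|x| ^+ 2 / 2.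
Proof.
rewrite cos_double addrAC subrr sub0r normrN normrM (ger0_norm (_ : 0 <= 2))//.
rewrite normrX.
have := norm_sin_le (x / 2); rewrite normrM (ger0_norm (_ : 0 <= 2^-1))//.
move: (normr_ge0 x) (normr_ge0 (sin (x / 2))); set a := `|x|; set b := `|sin _|.
by move=> a0 b0 ba; nra.
Qed.

Lemma sin_taylor x : `|sin x - x| <= `|x| ^+ 3 / 2.
Proof.
have := @le_MVT (fun y => sin y - y) (fun y => cos y - 1) (fun a => a ^+ 2 / 2) x.
rewrite sin0 subr0 subr0 => h.
rewrite exprSr -mulrAC; apply: h => [z _|a b a0 ab].
- exact: cos_dist_1.
- by rewrite ler_wpM2r// lerXn2r ?nnegrE// (le_trans a0).
Qed.

(** By the half-angle formula the left side factors as a difference of squares, so the cubic bound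
    on [sin] is multiplied by a linear one. *)
Lemma cos_taylor x : `|cos x - 1 + x ^+ 2 / 2| <= `|x| ^+ 4 / 8.
Proof.
have -> : cos x - 1 + x ^+ 2 / 2 =
    - 2 * (sin (x / 2) - x / 2) * (sin (x / 2) + x / 2).
  by rewrite cos_double; field.
rewrite !normrM normrN (ger0_norm (_ : 0 <= 2))//.
have h1 := sin_taylor (x / 2).
have h2 : `|sin (x / 2) + x / 2| <= `|x|.
  rewrite (le_trans (ler_normD _ _))//.
  have := norm_sin_le (x / 2); rewrite normrM (ger0_norm (_ : 0 <= 2^-1))//; lra.
have E : `|x / 2| ^+ 3 / 2 = `|x| ^+ 3 / 16.
  by rewrite normrM (ger0_norm (_ : 0 <= 2^-1))//; field.
rewrite {}E in h1.
have := ler_pM (normr_ge0 _) (normr_ge0 _) h1 h2.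
move=> h; rewrite -mulrA (le_trans (ler_wpM2l _ h))//.
by rewrite le_eqVlt; apply/orP; left; apply/eqP; field.
Qed.

Lemma cos_lip x y : `|cos x - cos y| <= `|x - y|.
Proof.
rewrite (_ : x = y + (x - y)); last by rewrite addrC subrK.
set h := x - y; rewrite [X in _ <= `|X|](_ : _ = h); last by rewrite addrC addKr.
have := @le_MVT (fun z => cos (y + z)) (fun z => - sin (y + z)) (fun=> 1) h.
rewrite addr0 mul1r; apply=> // z; last by rewrite normrN norm_sin_le1.
have -> : - sin (y + z) = - sin (y + z) *: (0 + 1 : R).
  by rewrite add0r; exact: (esym (mulr1 _)).
by apply: (@is_derive1_comp _ cos (fun z => y + z)).
Qed.

End trigonometric_inequalities.

(** Compactness of the segment makes the local moduli of continuity uniform; [y] may leave the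
    segment, so later uses have to locate one point only. *)
Lemma segment_unif_continuous {R : realType} (h : R -> R) (a b e : R) :
  continuous h -> 0 < e ->
  exists2 dl, 0 < dl & forall x y, a <= x <= b -> `|x - y| < dl ->
    `|h x - h y| <= e.
Proof.
move=> ch e0.
have /compact_near_coveringP := @segment_compact R a b.
move=> /(_ R 0^'+ (fun dl x => forall y, `|x - y| < dl -> `|h x - h y| <= e) _).
have e20 : 0 < e / 2 by rewrite divr_gt0.
case=> [x _|dl /= dl0 H].
  have /cvgrPdist_lt/(_ _ e20) [rho /= rho0 hrho] := ch x.
  exists (ball x (rho / 2), [set dl | dl < rho / 2]) => /=.
    split; first by apply: nbhsx_ballx; rewrite divr_gt0.
    by apply: nbhs_right_lt; rewrite divr_gt0.
  move=> [z dl] /= [xz dlr] y zy.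
  have h1 : `|h x - h z| < e / 2.
    by apply: hrho => /=; apply: lt_le_trans xz _; rewrite ler_pdivrMr// ler_pMr//; lra.
  have h2 : `|h x - h y| < e / 2.
    apply: hrho => /=; rewrite (_ : x - y = (x - z) + (z - y)); last by ring.
    rewrite (le_lt_trans (ler_normD _ _))//.
    by rewrite (lt_trans (ltrD xz zy))// -ltrBrDl (lt_le_trans dlr)//; lra.
  rewrite (_ : h z - h y = (h z - h x) + (h x - h y)); last by ring.
  rewrite (le_trans (ler_normD _ _))// (distrC (h z)).
  by rewrite (le_trans (ltW (ltrD h1 h2)))// -splitr.
exists (dl / 2); first by rewrite divr_gt0.
move=> x y xab xy; apply: (H (dl / 2) _ _ x _ y) => //=.
- by rewrite sub0r normrN gtr0_norm ?divr_gt0// ltr_pdivrMr// ltr_pMr//; lra.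
- by rewrite divr_gt0.
Qed.

(** * Bernstein's approximation theorem *)

Section bernstein.
Context {R : realType}.

(* The Bernstein operator in recursive form: [bern n phi x] is the expectation
   of [phi] at the number of successes in [n] trials of probability [x]. *)
Fixpoint bern n (phi : nat -> R) (x : R) : R :=
  if n is m.+1 then
    x * bern m (fun k => phi k.+1) x + (1 - x) * bern m phi x
  else phi 0%N.

Lemma bern_cst n (c x : R) : bern n (fun=> c) x = c.
Proof. by elim: n => //= n ->; ring. Qed.

Lemma bern_lin n (a : R) phi psi x :
  bern n (fun k => a * phi k + psi k) x = a * bern n phi x + bern n psi x.
Proof. by elim: n phi psi => //= n IH phi psi; rewrite !IH; ring. Qed.

Lemma bern_le n phi psi x : 0 <= x <= 1 ->
  (forall k, (k <= n)%N -> phi k <= psi k) -> bern n phi x <= bern n psi x.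
Proof.
move=> /andP[x0 x1]; elim: n phi psi => [|n IH] phi psi h /=; first exact: h.
apply: lerD; apply: ler_wpM2l => //; rewrite ?subr_ge0//.
  by apply: IH => k kn; exact: h.
by apply: IH => k kn; apply: h; rewrite ltnW.
Qed.

(** With [c = 0] this is the binomial variance. The shift [c] makes the induction close: a success
    turns [c] into [1 + c - x], a failure into [c - x]. *)
Lemma bern_var n (c x : R) :
  bern n (fun k => (k%:R + c - n%:R * x) ^+ 2) x = c ^+ 2 + n%:R * x * (1 - x).
Proof.
elim: n c => [|n IH] c /=; first by rewrite !mul0r; ring.
have -> : (fun k => (k.+1%:R + c - n.+1%:R * x) ^+ 2) =
    (fun k => (k%:R + (1 + c - x) - n%:R * x) ^+ 2) :> (nat -> R).
  by apply/funext => k; rewrite -!natr1; ring.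
have -> : (fun k => (k%:R + c - n.+1%:R * x) ^+ 2) =
    (fun k => (k%:R + (c - x) - n%:R * x) ^+ 2) :> (nat -> R).
  by apply/funext => k; rewrite -natr1; ring.
by rewrite !IH -natr1; ring.
Qed.

(** Bernstein's proof: uniform continuity handles [k / n] close to [x], and the Chebyshev inequality
    with the binomial variance handles the rest. *)
Lemma bern_approx (h : R -> R) (H e : R) : continuous h -> (forall x, `|h x| <= H) ->
  0 < e -> exists n, forall x, 0 <= x <= 1 ->
    `|bern n (fun k => h (k%:R / n%:R)) x - h x| <= e.
Proof.
move=> ch hH e0.
have e20 : 0 < e / 2 by rewrite divr_gt0.
have [dl dl0 hdl] := segment_unif_continuous 0 1 ch e20.
have H0 : 0 <= H by rewrite (le_trans _ (hH 0)).
(* When [k / n] is at distance at least [dl] from [x], the crude difference [2 * H] is at most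
   [C * (k / n - x) ^ 2]. *)
pose C := 2 * H / dl ^+ 2.
have C0 : 0 <= C by apply: divr_ge0; [exact: mulr_ge0|exact: sqr_ge0].
pose n := (Num.truncn (C / (e / 2))).+1; exists n => x x01.
have n0 : 0 < n%:R :> R by rewrite ltr0n.
have nC : C / n%:R <= e / 2.
  by rewrite ler_pdivrMr// mulrC -ler_pdivrMr// ltW// truncnS_gt.
have key k : `|h (k%:R / n%:R) - h x| <=
    C / n%:R ^+ 2 * (k%:R + 0 - n%:R * x) ^+ 2 + e / 2.
  have E : C / n%:R ^+ 2 * (k%:R + 0 - n%:R * x) ^+ 2 = C * (k%:R / n%:R - x) ^+ 2.
    by field; rewrite gt_eqF.
  rewrite {}E; have [xk|xk] := ltP `|x - k%:R / n%:R| dl.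
    rewrite distrC (le_trans (hdl _ _ x01 xk))// lerDr.
    by rewrite mulr_ge0// sqr_ge0.
  rewrite (le_trans (ler_normB _ _))// (le_trans (lerD (hH _) (hH _)))//.
  rewrite (_ : H + H = 2 * H); last by ring.
  rewrite ler_wpDr// ?(ltW e20)// /C.
  rewrite -[leLHS]mulr1 -[leRHS]mulrA ler_wpM2l ?mulr_ge0//.
  rewrite mulrC ler_pdivlMr ?exprn_gt0// mul1r -[leRHS]real_normK ?num_real//.
  by rewrite lerXn2r ?nnegrE ?(ltW dl0)// distrC.
have E : bern n (fun k => C / n%:R ^+ 2 * (k%:R + 0 - n%:R * x) ^+ 2 + e / 2) x
    <= e.
  rewrite bern_lin bern_cst bern_var expr0n/= add0r.
  rewrite [X in _ <= X]splitr.
  rewrite lerD2r (le_trans _ nC)//.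
  have -> : C / n%:R ^+ 2 * (n%:R * x * (1 - x)) = C / n%:R * (x * (1 - x)).
    by field; rewrite gt_eqF.
  rewrite ler_piMr ?divr_ge0//; nra.
have -> : bern n (fun k => h (k%:R / n%:R)) x - h x =
    bern n (fun k => 1 * h (k%:R / n%:R) + - h x) x.
  by rewrite bern_lin bern_cst mul1r.
rewrite ler_norml; apply/andP; split; last first.
  rewrite (le_trans _ E)//; apply: bern_le => // k _; rewrite mul1r.
  exact: le_trans (ler_norm _) (key k).
rewrite lerNl (le_trans _ E)// -[leLHS]addr0 -mulN1r.
rewrite -[X in _ + X <= _](bern_cst n 0 x) -bern_lin.
apply: bern_le => // k _; rewrite [leLHS]addr0 mulN1r mul1r.
apply: le_trans (ler_norm _) _; rewrite normrN; exact: key.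
Qed.

End bernstein.

(** * Trigonometric approximation of functions of a product *)

Section trigonometric_polynomials.
Context {R : realType} {d : nat}.
Implicit Types (f g : ('I_d -> R) -> R) (v : 'I_d -> R).

(** Finite sums of phased cosines. They form an algebra containing the constants, so polynomials in
    them stay in the class. *)
Inductive trig_poly : (('I_d -> R) -> R) -> Prop :=
| trig_cos (c th : R) (t : 'I_d -> R) :
    trig_poly (fun v => c * cos (th + \sum_i t i * v i))
| trig_add f g : trig_poly f -> trig_poly g ->
    trig_poly (fun v => f v + g v).

Lemma trig_poly_ext f g : f =1 g -> trig_poly f -> trig_poly g.
Proof. by move=> /funext ->. Qed.

Lemma trig_poly_cst c : trig_poly (fun=> c).
Proof.
apply: (trig_poly_ext _ (trig_cos c 0 (fun=> 0))) => v.
by rewrite big1 ?addr0 ?cos0 ?mulr1// => i _; rewrite mul0r.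
Qed.

(** The product-to-sum formula for two phased cosines, extended by bilinearity. *)
Lemma trig_poly_mul f g : trig_poly f -> trig_poly g ->
  trig_poly (fun v => f v * g v).
Proof.
move=> hf hg; elim: hf => [c th t|f1 f2 _ IH1 _ IH2]; last first.
  by apply: (trig_poly_ext _ (trig_add IH1 IH2)) => v; rewrite mulrDl.
elim: hg => [c' th' t'|g1 g2 _ IH1 _ IH2]; last first.
  by apply: (trig_poly_ext _ (trig_add IH1 IH2)) => v; rewrite mulrDr.
apply: (trig_poly_ext _ (trig_add
  (trig_cos (c * c' / 2) (th + th') (fun i => t i + t' i))
  (trig_cos (c * c' / 2) (th - th') (fun i => t i - t' i)))) => v.
have -> : th + th' + \sum_i (t i + t' i) * v i =
    (th + \sum_i t i * v i) + (th' + \sum_i t' i * v i).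
  by rewrite addrACA -big_split/=; congr (_ + _); apply: eq_bigr => i _; ring.
have -> : th - th' + \sum_i (t i - t' i) * v i =
    (th + \sum_i t i * v i) - (th' + \sum_i t' i * v i).
  rewrite opprD addrACA -sumrN -big_split/=; congr (_ + _).
  by apply: eq_bigr => i _; ring.
by rewrite cosD cosB; field.
Qed.

Lemma trig_poly_scale c f : trig_poly f -> trig_poly (fun v => c * f v).
Proof. by apply: trig_poly_mul; exact: trig_poly_cst. Qed.

Lemma trig_poly_sin i (a : R) : trig_poly (fun v => sin (a * v i)).
Proof.
apply: (trig_poly_ext _ (trig_cos 1 (- (pi / 2)) (fun j => if j == i then a else 0))).
move=> v; rewrite mul1r (bigD1 i)//= eqxx big1; last first.
  by move=> j /negPf->; rewrite mul0r.
by rewrite addr0 addrC cosBpihalf.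
Qed.

Lemma trig_poly_prod (r : seq 'I_d) (F : 'I_d -> ('I_d -> R) -> R) :
  (forall i, trig_poly (F i)) -> trig_poly (fun v => \prod_(i <- r) F i v).
Proof.
move=> hF; elim: r => [|i r IH].
  by apply: (trig_poly_ext _ (trig_poly_cst 1)) => v; rewrite big_nil.
by apply: (trig_poly_ext _ (trig_poly_mul (hF i) IH)) => v; rewrite big_cons.
Qed.

(** The recursive form of [bern] shows this by sums and products alone. *)
Lemma trig_poly_bern n phi f : trig_poly f ->
  trig_poly (fun v => bern n phi (f v)).
Proof.
move=> hf; elim: n phi => [|n IH] phi /=; first exact: trig_poly_cst.
apply: trig_add; apply: trig_poly_mul => //.
apply: trig_add; first exact: trig_poly_cst.
by apply: (trig_poly_ext _ (trig_poly_scale (-1) hf)) => v; rewrite mulN1r.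
Qed.

Lemma norm_prod_le (I : Type) (r : seq I) (a : I -> R) (A : R) :
  0 <= A -> (forall i, `|a i| <= A) -> `|\prod_(i <- r) a i| <= A ^+ size r.
Proof.
move=> A0 aA; elim: r => [|i r IH]; first by rewrite big_nil normr1 expr0.
by rewrite big_cons normrM exprS ler_pM.
Qed.

(** Factors are exchanged one at a time; [1 <= A] lets every partial product be bounded by the full
    power of [A]. *)
Lemma norm_prod_sub_le (I : Type) (r : seq I) (a b : I -> R) (A eta : R) :
  1 <= A -> (forall i, `|a i| <= A) -> (forall i, `|b i| <= A) ->
  (forall i, `|a i - b i| <= eta) ->
  `|\prod_(i <- r) a i - \prod_(i <- r) b i| <= (size r)%:R * A ^+ size r * eta.
Proof.
move=> A1 aA bA abe; have A0 : 0 <= A by rewrite (le_trans _ A1).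
elim: r => [|i r IH]; first by rewrite !big_nil subrr normr0 !mul0r.
rewrite !big_cons.
have -> : a i * \prod_(j <- r) a j - b i * \prod_(j <- r) b j =
   a i * (\prod_(j <- r) a j - \prod_(j <- r) b j) +
   (a i - b i) * \prod_(j <- r) b j by ring.
rewrite (le_trans (ler_normD _ _))// !normrM.
have h1 := ler_pM (normr_ge0 _) (normr_ge0 _) (aA i) IH.
have h2 := ler_pM (normr_ge0 _) (normr_ge0 _) (abe i) (norm_prod_le r A0 bA).
rewrite (le_trans (lerD h1 h2))//= -natr1 exprS.
have e0 : 0 <= eta by rewrite (le_trans _ (abe i)).
have h3 : A ^+ size r <= A * A ^+ size r.
  by rewrite ler_peMl// exprn_ge0.
have := ler_wpM2r e0 h3; set Ar := A ^+ size r; set s := (size r)%:R.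
by move=> h; rewrite !mulrDl mul1r; lra.
Qed.

(* [L * sin (v / L)] is bounded by [L] and close to [v] on compact sets. *)
Lemma prod_trig_approx (h : R -> R) (H e A : R) : continuous h ->
  (forall x, `|h x| <= H) -> 0 < e -> 1 <= A ->
  exists2 phi, trig_poly phi & forall v,
    `|h (\prod_i v i) - phi v| <= e + 2 * H * \sum_i \1_[set x | A < `|x|] (v i).
Proof.
move=> ch hH e0 A1.
have A0 : 0 < A by rewrite (lt_le_trans _ A1).
have H0 : 0 <= H by rewrite (le_trans _ (hH 0)).
have e20 : 0 < e / 2 by rewrite divr_gt0.
have [dl dl0 hdl] := segment_unif_continuous (- A ^+ d) (A ^+ d) ch e20.
(* When every [|v i|] is at most [A], each factor moves by at most [A ^ 3 / L], hence the product by
   at most [d * A ^ d * A ^ 3 / L]; this [L] makes that smaller than [dl]. *)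
pose L : R := 1 + d%:R * A ^+ d * A ^+ 3 / dl.
have c0 : 0 <= d%:R * A ^+ d * A ^+ 3 :> R.
  by apply: mulr_ge0; [apply: mulr_ge0 => //|]; apply: exprn_ge0; exact: ltW.
have L1 : 1 <= L by rewrite lerDl divr_ge0// ltW.
have L0 : 0 < L by rewrite (lt_le_trans _ L1).
have Ld0 : 0 < L ^+ d by rewrite exprn_gt0.
(* [h] is carried from [[- L ^ d, L ^ d]] to [[0, 1]], where the Bernstein operator approximates. *)
pose h' (x : R) := h (L ^+ d * (2 * x - 1)).
have ch' : continuous h'.
  move=> x; apply: (@continuous_comp _ _ _ (fun x : R => L ^+ d * (2 * x - 1)) h).
    apply: cvgM; first exact: cvg_cst.
    by apply: cvgB; [apply: cvgM; [exact: cvg_cst|exact: cvg_id]|exact: cvg_cst].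
  exact: ch.
have [n hn] := bern_approx ch' (fun x => hH _) e20.
pose X (v : 'I_d -> R) := 2^-1 + 2^-1 * \prod_i sin (L^-1 * v i).
exists (fun v => bern n (fun k => h' (k%:R / n%:R)) (X v)).
  apply: trig_poly_bern; apply: trig_add; first exact: trig_poly_cst.
  by apply: trig_poly_scale; apply: trig_poly_prod => i; exact: trig_poly_sin.
move=> v.
have P1 : `|\prod_i sin (L^-1 * v i)| <= 1.
  rewrite (le_trans (norm_prod_le _ ler01 _))// ?expr1n// => i.
  exact: norm_sin_le1.
have X01 : 0 <= X v <= 1.
  by move: P1; rewrite ler_norml /X => /andP[? ?]; apply/andP; split; lra.
have hX : h' (X v) = h (\prod_i (L * sin (L^-1 * v i))).
  rewrite /h' big_split/= prodr_const card_ord; congr (h (_ * _)).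
  by rewrite /X; field.
have h1 := hn _ X01; rewrite hX distrC in h1.
rewrite (_ : h (\prod_i v i) - _ = (h (\prod_i v i) -
  h (\prod_i (L * sin (L^-1 * v i)))) + (h (\prod_i (L * sin (L^-1 * v i))) -
  bern n (fun k => h' (k%:R / n%:R)) (X v))); last by ring.
rewrite (le_trans (ler_normD _ _))//.
suff : `|h (\prod_i v i) - h (\prod_i (L * sin (L^-1 * v i)))| <=
    e / 2 + 2 * H * \sum_i \1_[set x | A < `|x|] (v i) by move: h1; lra.
have ind0 i : 0 <= \1_[set x | A < `|x|] (v i) :> R by [].
have [vA|] := pselect (forall i, `|v i| <= A); last first.
  (* One coordinate beyond [A] already contributes an indicator that pays for the trivial bound
     [2 * H]. *)
  move=> /existsNP[i /negP]; rewrite -ltNge => Avi.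
  rewrite (le_trans (ler_normB _ _))// (le_trans (lerD (hH _) (hH _)))//.
  rewrite ler_wpDl ?(ltW e20)// (bigD1 i)//= indicE mem_set//=.
  rewrite (_ : H + H = 2 * H * 1); last by ring.
  by rewrite ler_wpM2l ?mulr_ge0// lerDl sumr_ge0.
rewrite ler_wpDr ?mulr_ge0 ?sumr_ge0//.
have sL i : `|L * sin (L^-1 * v i)| <= A.
  rewrite normrM (gtr0_norm L0) (le_trans (ler_wpM2l (ltW L0) (norm_sin_le _)))//.
  by rewrite normrM gtr0_norm ?invr_gt0// mulVKf ?gt_eqF.
have sd i : `|v i - L * sin (L^-1 * v i)| <= A ^+ 3 / L.
  rewrite (_ : v i - _ = - (L * (sin (L^-1 * v i) - L^-1 * v i))); last first.
    by field; rewrite gt_eqF.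
  rewrite normrN normrM (gtr0_norm L0).
  rewrite (le_trans (ler_wpM2l (ltW L0) (sin_taylor _)))//.
  rewrite normrM gtr0_norm ?invr_gt0//.
  rewrite (_ : L * _ = `|v i| ^+ 3 / L * (L^-1 / 2)); last by field; rewrite gt_eqF.
  have h3 : `|v i| ^+ 3 <= A ^+ 3 by rewrite lerXn2r ?nnegrE// ltW.
  have iL1 : L^-1 <= 1 by rewrite invf_le1.
  have iL0 : 0 < L^-1 by rewrite invr_gt0.
  rewrite -[leRHS]mulr1; apply: ler_pM.
  - by rewrite divr_ge0 ?exprn_ge0// ltW.
  - by lra.
  - by rewrite ler_wpM2r// ltW.
  - by lra.
have sz : size (index_enum 'I_d) = d.
  by rewrite -sum1_size sum1_card card_ord.
apply: hdl.
  by rewrite -ler_norml -[X in A ^+ X]sz; apply: norm_prod_le => //; exact: ltW.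
rewrite (le_lt_trans (norm_prod_sub_le _ A1 vA sL sd))// sz.
rewrite mulrA ltr_pdivrMr// -ltr_pdivrMl// mulrC /L.
by rewrite ltrDr.
Qed.

End trigonometric_polynomials.

Lemma sin_quadratic {R : realType} (y : R) : `|sin y - y| <= y ^+ 2.
Proof.
have [y2|y2] := leP `|y| 2.
  rewrite (le_trans (sin_taylor y))// -[leRHS]real_normK ?num_real//.
  by move: (normr_ge0 y) y2; set a := `|y| => a0 a2; nra.
rewrite (le_trans (ler_normB _ _))// (le_trans (lerD (norm_sin_le y) (lexx _)))//.
rewrite -[leRHS]real_normK ?num_real//.
by move: y2; set a := `|y| => a2; nra.
Qed.

(** * Continuity theorem for products and convergence of moments *)

Section continuity_theorem.
Context {R : realType} {dT : nat -> measure_display}.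
Context {T : forall k, measurableType (dT k)} {P : forall k, probability (T k) R}.
Context {dS : measure_display} {S : measurableType dS} {PS : probability S R}.

Section product.
Context {d : nat} (V : forall k, 'I_d -> T k -> R) (U : 'I_d -> S -> R).
Arguments V : clear implicits.
Hypothesis mV : forall k i, measurable_fun setT (V k i).
Hypothesis mU : forall i, measurable_fun setT (U i).
Hypothesis cvg_cos : forall (th : R) (t : 'I_d -> R),
  Ex (P k) (fun w => cos (th + \sum_i t i * V k i w)) @[k --> \oo] -->
  Ex PS (fun w => cos (th + \sum_i t i * U i w)).
Hypothesis tight : forall e : R, 0 < e -> exists A : R,
  (forall k i, Ex (P k) (fun w => \1_[set x | A < `|x|] (V k i w)) <= e) /\
  (forall i, Ex PS (fun w => \1_[set x | A < `|x|] (U i w)) <= e).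

Let measurable_trig_arg {d'} {T' : measurableType d'} (th : R) (t : 'I_d -> R)
    (Z : 'I_d -> T' -> R) : (forall i, measurable_fun setT (Z i)) ->
  measurable_fun setT (fun w => th + \sum_i t i * Z i w).
Proof.
move=> mZ; apply: measurable_funD => //; apply: measurable_sum => i.
exact: measurable_funM.
Qed.

Let bm_trig {d'} {T' : measurableType d'} (Z : 'I_d -> T' -> R) phi :
  (forall i, measurable_fun setT (Z i)) -> trig_poly phi ->
  bm (fun w => phi (Z ^~ w)).
Proof.
move=> mZ; elim=> [c th t|f g _ IH1 _ IH2]; last exact: bm_add.
by apply: bm_scale; apply: bm_cos; exact: measurable_trig_arg.
Qed.

Lemma cvg_trig_poly phi : trig_poly phi ->
  Ex (P k) (fun w => phi (V k ^~ w)) @[k --> \oo] -->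
  Ex PS (fun w => phi (U ^~ w)).
Proof.
elim=> [c th t|f g hf IH1 hg IH2].
  rewrite ExZ; last by apply: bm_cos; exact: measurable_trig_arg.
  under eq_cvg => k.
    rewrite ExZ; last by apply: bm_cos; exact: measurable_trig_arg.
    over.
  by apply: cvgM => //; exact: cvg_cst.
rewrite ExD; [|exact: bm_trig..].
under eq_cvg => k.
  rewrite ExD; [|exact: bm_trig..].
  over.
exact: cvgD.
Qed.

Let bm_tail {d'} {T' : measurableType d'} (Z : T' -> R) (A : R) :
  measurable_fun setT Z ->
  bm (fun w => \1_[set x : R | A < `|x|] (Z w) : R).
Proof.
move=> mZ; apply: bm_pre => //; apply: bm_indic.
rewrite (_ : [set x | _] = ~` ([set: R] `&` [set x : R | `|x| <= A])).
  by apply: measurableC; apply: measurable_fun_le.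
rewrite setTI; apply/seteqP; split=> x /=; first by rewrite ltNge => /negP.
by move=> /negP; rewrite -ltNge.
Qed.

(** A test function of the product is a trigonometric polynomial of the vector up to a uniform error
    and a tail term; tightness makes the tail small uniformly in [k], and the polynomial part
    converges. *)
Lemma cvg_prod_law (h : R -> R) : continuous h -> bounded_fun h ->
  Ex (P k) (fun w => h (\prod_i V k i w)) @[k --> \oo] -->
  Ex PS (fun w => h (\prod_i U i w)).
Proof.
move=> ch bh.
have hh : bm h.
  by split => //; exact: continuous_measurable_fun.
have [H [H0 hH]] := bm_bound hh.
apply/cvgrPdist_le => /= e e0.
(* Tail budget: [d] coordinates, each weighted by [2 * H], cost at most [e / 8] in total; [d + 1]
   covers [d = 0]. *)
have D0 : 0 < 16 * H * (d%:R + 1) by rewrite !mulr_gt0// ltr_wpDl.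
have [A0 [tV tU]] := tight (divr_gt0 e0 D0).
pose A := Num.max 1 A0.
have A1 : 1 <= A by rewrite le_max lexx.
have e80 : 0 < e / 8 by rewrite divr_gt0.
have [phi tphi hphi] := prod_trig_approx (d := d) ch hH e80 A1.
have leA x : \1_[set x : R | A < `|x|] x <= \1_[set x : R | A0 < `|x|] x :> R.
  rewrite !indicE; have [/set_mem /= Ax|//] := boolP (x \in _).
  by rewrite mem_set//= (le_lt_trans _ Ax)// le_max lexx orbT.
have bound d' (T' : measurableType d') (Q : probability T' R) Z :
    (forall i, measurable_fun setT (Z i)) ->
    (forall i, Ex Q (fun w => \1_[set x : R | A0 < `|x|] (Z i w)) <=
       e / (16 * H * (d%:R + 1))) ->
    `|Ex Q (fun w => h (\prod_(i < d) Z i w)) - Ex Q (fun w => phi (Z ^~ w))| <=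
    e / 4.
  move=> mZ tZ.
  have mh : bm (fun w => h (\prod_(i < d) Z i w)).
    by apply: bm_pre => //; exact: measurable_prod.
  have mphi := bm_trig mZ tphi.
  have msum : bm (fun w => 2 * H *
      \sum_(i < d) \1_[set x : R | A < `|x|] (Z i w)).
    by apply: bm_scale; apply: bm_sum => i _; exact: bm_tail.
  rewrite -ExB//.
  rewrite (le_trans (Ex_norm_le _ _ _ (fun w => hphi (Z ^~ w))))//.
  - exact: bm_sub.
  - exact: bm_add.
  rewrite ExD// Ex_cst ExZ; last by apply: bm_sum => i _; exact: bm_tail.
  rewrite Ex_sum; last by move=> i; exact: bm_tail.
  have : \sum_(i < d) Ex Q (fun w => \1_[set x : R | A < `|x|] (Z i w)) <=
      \sum_(i < d) e / (16 * H * (d%:R + 1)).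
    apply: ler_sum => i _; rewrite (le_trans _ (tZ i))//.
    by apply: Ex_le => //; exact: bm_tail.
  rewrite sumr_const card_ord -mulr_natl => hs.
  have H20 : 0 <= 2 * H by rewrite mulr_ge0// ltW.
  rewrite (le_trans (lerD (lexx _) (ler_wpM2l H20 hs)))//.
  rewrite (_ : 2 * H * _ = e / 8 * (d%:R / (d%:R + 1))); last first.
    by field; rewrite !gt_eqF// ltr_wpDl.
  have : d%:R / (d%:R + 1) <= 1 :> R.
    by rewrite ler_pdivrMr ?ltr_wpDl// mul1r lerDl.
  by move=> h1; have := ler_wpM2l (ltW e80) h1; lra.
have /cvgrPdist_le/(_ _ e80) := cvg_trig_poly tphi.
apply: filterS => k hk.
have h1 := bound _ _ (P k) (V k) (@mV k) (tV k).
have h2 := bound _ _ PS U (@mU) tU.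
set a := Ex PS _ in h2 *; set b := Ex PS _ in h2 hk.
set a' := Ex _ _ in h1 *; set b' := Ex _ _ in h1 hk.
rewrite (_ : a - a' = (a - b) + (b - b') - (a' - b')); last by ring.
rewrite (le_trans (ler_normB _ _))// (le_trans (lerD (ler_normD _ _) h1))//.
by lra.
Qed.

End product.

Section moment.
Context (X : forall k, T k -> R) (Y : S -> R) (C : R).
Arguments X : clear implicits.
Hypothesis hX : forall k, bm (X k).
Hypothesis mY : measurable_fun setT Y.
Hypothesis cvg_law : forall h : R -> R, continuous h -> bounded_fun h ->
  Ex (P k) (fun w => h (X k w)) @[k --> \oo] --> Ex PS (fun w => h (Y w)).
Hypothesis moment2 : forall k, Ex (P k) (fun w => X k w ^+ 2) <= C.

(** A continuous truncation: bounded by [m], at most [|x|] in absolute value and within [x ^ 2 / m]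
    of [x], so [cvg_law] applies to it and second moments control its error. *)
Let clip (m x : R) := m * sin (x / m).

Let clip_dist (m x : R) : 0 < m -> `|x - clip m x| <= x ^+ 2 / m.
Proof.
move=> m0; rewrite distrC.
rewrite (_ : clip m x - x = m * (sin (x / m) - x / m)); last first.
  by rewrite /clip; field; rewrite gt_eqF.
rewrite normrM gtr0_norm// (le_trans (ler_wpM2l (ltW m0) (sin_quadratic _)))//.
by rewrite le_eqVlt; apply/orP; left; apply/eqP; field; rewrite gt_eqF.
Qed.

Let clip_le (m x : R) : 0 < m -> `|clip m x| <= `|x|.
Proof.
move=> m0; rewrite /clip normrM gtr0_norm//.
rewrite (le_trans (ler_wpM2l (ltW m0) (norm_sin_le _)))//.
by rewrite -{1}(gtr0_norm m0) -normrM mulrC divfK// gt_eqF.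
Qed.

Let continuous_clip m : continuous (clip m).
Proof.
move=> x; apply: cvgM; first exact: cvg_cst.
apply: (@continuous_comp _ _ _ (fun x : R => x / m) sin).
  by apply: cvgM; [exact: cvg_id|exact: cvg_cst].
exact: continuous_sin.
Qed.

Let clip_bound (m x : R) : 0 < m -> `|clip m x| <= m.
Proof.
by move=> m0; rewrite normrM gtr0_norm// ler_piMr ?(ltW m0)// norm_sin_le1.
Qed.

Let bm_clip (m : R) : 0 < m -> bm (clip m).
Proof.
move=> m0; apply: (@bm_intro _ _ _ _ m) => [|x]; last exact: clip_bound.
exact: continuous_measurable_fun.
Qed.

Let bm_clipY (m : R) : 0 < m -> bm (fun w => clip m (Y w)).
Proof. by move=> m0; apply: bm_pre => //; exact: bm_clip. Qed.

(** The bound holds for each [k] because truncation lowers squares, and it survives the limit in law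
    because the truncated square is bounded and continuous. *)
Let clip2_le (m : R) : 0 < m -> Ex PS (fun w => clip m (Y w) ^+ 2) <= C.
Proof.
move=> m0.
have c2 : continuous (fun x => clip m x ^+ 2).
  move=> x; apply: (@continuous_comp _ _ _ (clip m) (fun x : R => x ^+ 2)).
    exact: continuous_clip.
  exact: exprn_continuous.
have [_ b2] : bm (fun x => clip m x ^+ 2).
  by apply: bm_exp; exact: bm_clip.
have hc := cvg_law c2 b2.
rewrite -(cvg_lim _ hc)//; apply: limr_le; first by apply/cvg_ex; eexists; exact: hc.
apply: nearW => k; rewrite (le_trans _ (moment2 k))//; apply: Ex_le.
- by apply: bm_exp; apply: bm_pre; [exact: bm_meas|exact: bm_clip].
- exact: bm_exp.
- move=> w; rewrite -real_normK ?num_real// -[leRHS]real_normK ?num_real//.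
  by rewrite lerXn2r ?nnegrE// clip_le.
Qed.

(** Fatou's lemma as the truncation level grows; integrability of [Y] is derived from it. *)
Lemma second_moment_limit : (\int[PS]_w (Y w ^+ 2)%:E <= C%:E)%E.
Proof.
pose g n w := (clip n.+1%:R (Y w) ^+ 2)%:E.
have gY w : g n w @[n --> \oo] --> (Y w ^+ 2)%:E.
  apply: cvg_EFin; first exact: nearW.
  suff : clip n.+1%:R (Y w) @[n --> \oo] --> Y w.
    move=> h; apply: (@cvg_comp _ _ _ (fun n => clip n.+1%:R (Y w)) (fun x : R => x ^+ 2)).
      exact: h.
    exact: exprn_continuous.
  apply/cvgrPdist_le => /= e e0.
  near=> n.
  rewrite (le_trans (clip_dist _ _))// ler_pdivrMr// mulrC -ler_pdivrMr//.
  rewrite (@le_trans _ _ n%:R)// ?ler_nat//.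
  near: n; exact: nbhs_infty_ger.
have -> : (\int[PS]_w (Y w ^+ 2)%:E = \int[PS]_w limn_einf (g ^~ w))%E.
  by apply: eq_integral => w _; rewrite (cvg_limn_einf_sup (gY w)).1.
apply: le_trans (fatou _ _ _ _) _ => //.
- move=> n; apply/measurable_EFinP; apply: bm_meas; apply: bm_exp.
  exact: bm_clipY.
- by move=> n w _; rewrite lee_fin sqr_ge0.
- rewrite limn_einf_lim; apply: lime_le; first exact: is_cvg_einfs.
  apply: nearW => n; apply: le_trans (ereal_inf_lbound _) _.
    by exists n => /=.
  rewrite (Ex_EFin PS (f := fun w => clip n.+1%:R (Y w) ^+ 2)).
    by rewrite lee_fin; exact: clip2_le.
  by apply: bm_exp; exact: bm_clipY.
Unshelve. all: by end_near. Qed.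

Let integrable_sqr : PS.-integrable setT (EFin \o (fun w => Y w ^+ 2)).
Proof.
apply/integrableP; split.
  by apply/measurable_EFinP; exact: measurable_funX.
under eq_integral => w _ do rewrite /= ger0_norm ?sqr_ge0//.
by rewrite (le_lt_trans second_moment_limit)// ltry.
Qed.

Lemma integrable_limit : PS.-integrable setT (EFin \o Y).
Proof.
have i1 : PS.-integrable setT (EFin \o (fun w => 1 + Y w ^+ 2)).
  have := @integrableD _ _ _ PS setT measurableT _ _
    (bm_integrable PS (bm_cst (1 : R))) integrable_sqr.
  by congr (_.-integrable _ _); apply/funext.
apply: le_integrable i1 => //; first exact/measurable_EFinP.
move=> w _; rewrite /= lee_fin [leRHS]ger0_norm ?addr_ge0 ?sqr_ge0//.
rewrite -real_normK ?num_real//.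
by move: (normr_ge0 (Y w)); set a := `|_|; nra.
Qed.

Let dist_clip (m : R) : 0 < m -> `|Ex PS Y - Ex PS (fun w => clip m (Y w))| <= C / m.
Proof.
move=> m0; rewrite -RintegralB//; [|exact: integrable_limit|exact: bm_integrable (bm_clipY m0)].
have i3 : PS.-integrable setT (EFin \o (fun w => Y w - clip m (Y w))).
  have := @integrableB _ _ _ PS setT measurableT _ _
    integrable_limit (bm_integrable PS (bm_clipY m0)).
  by congr (_.-integrable _ _); apply/funext.
apply: le_trans (le_normr_Rintegral _ i3) _ => //.
have E2 : Ex PS (fun w => m^-1 * Y w ^+ 2) <= C / m.
  rewrite RintegralZl// mulrC ler_wpM2r ?invr_ge0 ?(ltW m0)//.
  rewrite -lee_fin /Rintegral fineK; first exact: second_moment_limit.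
  exact: integrable_fin_num.
apply: le_trans E2; apply: le_Rintegral => //.
- exact: (integrable_norm i3).
- have := @integrableZl _ _ _ PS setT measurableT m^-1 _ integrable_sqr.
  by congr (_.-integrable _ _); apply/funext.
- by move=> w _; rewrite mulrC; exact: clip_dist.
Qed.

(** Truncating at level [m] costs at most [C / m] on each side, uniformly in [k], and the truncated
    expectations converge by [cvg_law]. *)
Lemma cvg_moment : Ex (P k) (X k) @[k --> \oo] --> Ex PS Y.
Proof.
apply/cvgrPdist_le => /= e e0.
have C0 : 0 <= C by rewrite (le_trans _ (moment2 0%N))// Ex_ge0// => w; exact: sqr_ge0.
(* Chosen so that [C / m <= e / 4]; adding [1] keeps it positive if [C = 0]. *)
pose m := 4 * C / e + 1.
have m0 : 0 < m by rewrite ltr_wpDl// divr_ge0 ?mulr_ge0// ltW.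
have Cm : C / m <= e / 4.
  rewrite ler_pdivrMr// /m mulrDr mulr1.
  rewrite (_ : e / 4 * (4 * C / e) = C); last by field; rewrite gt_eqF.
  by rewrite lerDl divr_ge0// ltW.
have e20 : 0 < e / 2 by rewrite divr_gt0.
have cb : bounded_fun (clip m) by case: (bm_clip m0).
have /cvgrPdist_le/(_ _ e20) := cvg_law (@continuous_clip m) cb.
apply: filterS => k hk.
have h1 := dist_clip m0.
have h2 : `|Ex (P k) (X k) - Ex (P k) (fun w => clip m (X k w))| <= C / m.
  have bX : bm (fun w => clip m (X k w)).
    by apply: bm_pre; [exact: bm_meas|exact: bm_clip].
  rewrite -ExB//; apply: le_trans (Ex_norm_le _ _ _ (fun w => clip_dist (X k w) m0)) _.
  - exact: bm_sub.
  - under eq_fun do rewrite mulrC.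
    by apply: bm_scale; exact: bm_exp.
  under eq_fun do rewrite mulrC.
  rewrite ExZ; last exact: bm_exp.
  by rewrite mulrC ler_wpM2r ?invr_ge0 ?(ltW m0).
set a := Ex PS _ in h1 *; set b := Ex PS _ in h1 hk.
set a' := Ex _ _ in h2 *; set b' := Ex _ _ in h2 hk.
rewrite (_ : a - a' = (a - b) + (b - b') - (a' - b')); last by ring.
rewrite (le_trans (ler_normB _ _))// (le_trans (lerD (ler_normD _ _) h2))//.
by lra.
Qed.

End moment.
End continuity_theorem.

(** * Gaussian variables *)

Section gaussian_characteristic_function.
Context {R : realType}.
Variables (s : R) (s_gt0 : 0 < s).
Local Notation mu := (@lebesgue_measure R).
Local Notation p := (normal_pdf 0 s).

Let s_neq0 : s != 0. Proof. by rewrite gt_eqF. Qed.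

Let pE x : p x = normal_peak s * expR (- x ^+ 2 / (s ^+ 2 *+ 2)).
Proof. by rewrite normal_pdfE// /normal_fun subr0. Qed.

Let p_ge0 x : 0 <= p x. Proof. exact: normal_pdf_ge0. Qed.

Let normal_integrable u : bm u ->
  mu.-integrable setT (EFin \o (fun x => u x * p x)).
Proof.
move=> hu; have [M [M0 hM]] := bm_bound hu.
have := @integrableZl _ _ _ mu setT measurableT M _ (integrable_normal_pdf 0 s).
apply: le_integrable => //.
  apply/measurable_EFinP; apply: measurable_funM; first exact: bm_meas.
  exact: measurable_normal_pdf.
move=> x _ /=; rewrite lee_fin normrM [leRHS]normrM.
by rewrite ler_wpM2r// (gtr0_norm M0).
Qed.

(** Both sides are bounded functionals, and on indicators the equality is the definition of
    [normal_prob] by its density. *)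
Lemma Ex_normal_prob u : bm u ->
  Ex (normal_prob 0 s) u = Ex mu (fun x => u x * p x).
Proof.
move: u; apply: bounded_functional_eq.
- split; first by move=> a f g hf hg; rewrite ExD ?ExZ//; exact: bm_scale.
  by exists 1; split=> // f e hf fe; rewrite mul1r; exact: Ex_bound.
- split.
    move=> a f g hf hg; rewrite -RintegralZl//; last exact: normal_integrable.
    rewrite -RintegralD//; last exact: normal_integrable.
      by congr Rintegral; apply/funext => x; ring.
    rewrite (_ : (fun x => _) = (fun x => a * f x * p x)).
      by apply: normal_integrable; exact: bm_scale.
    by apply/funext => x; rewrite mulrA.
  exists 1; split=> // f e hf fe; rewrite mul1r.
  have [|e0] := leP 0 e; last first.
    by have := le_lt_trans (le_trans (normr_ge0 _) (fe 0)) e0; rewrite ltxx.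
  move=> e0; apply: le_trans (le_normr_Rintegral _ (normal_integrable hf)) _ => //.
  have ip := integrable_normal_pdf 0 s.
  have -> : e = Ex mu (fun x => e * p x).
    by rewrite RintegralZl// /Rintegral integral_normal_pdf mulr1.
  apply: le_Rintegral => //.
  - exact: integrable_norm (normal_integrable hf).
  - exact: (@integrableZl _ _ _ mu setT measurableT e _ ip).
  - by move=> x _; rewrite normrM (ger0_norm (p_ge0 x)) ler_wpM2r.
- move=> A mA; rewrite Ex_indic// /normal_prob /Rintegral; congr fine.
  rewrite [LHS]integral_mkcond; apply: eq_integral => x _.
  by rewrite /patch indicE; case: (x \in A); rewrite ?mul1r ?mul0r.
Qed.

(* Comparison with the density of standard deviation [2 * s] makes [x * p x]
   integrable. *)
Let tail_le x : `|x| * p x <= 2 * s * normal_pdf 0 (2 * s) x.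
Proof.
have s20 : 2 * s != 0 by rewrite mulf_neq0.
have pk : normal_peak s = 2 * normal_peak (2 * s).
  rewrite /normal_peak [in RHS](_ : (2 * s) ^+ 2 * pi *+ 2 =
    2 ^+ 2 * (s ^+ 2 * pi *+ 2)); last by ring.
  by rewrite sqrtrM ?exprn_ge0// sqrtr_sqr ger0_norm// invfM mulrA divff// mul1r.
rewrite pE normal_pdfE// /normal_fun subr0 pk.
rewrite (_ : `|x| * _ = 2 * normal_peak (2 * s) *
  (`|x| * expR (- x ^+ 2 / (s ^+ 2 *+ 2)))); last by ring.
rewrite (_ : 2 * s * _ = 2 * normal_peak (2 * s) *
  (s * expR (- x ^+ 2 / ((2 * s) ^+ 2 *+ 2)))); last by ring.
rewrite ler_wpM2l ?mulr_ge0 ?normal_peak_ge0//.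
(* The exponent is split so that the wider density keeps one quarter of it; the rest,
   [3 / 8 * (|x| / s) ^ 2], absorbs the factor [|x| / s]. *)
have -> : - x ^+ 2 / (s ^+ 2 *+ 2) =
    - (3 / 8 * (`|x| / s) ^+ 2) + - x ^+ 2 / ((2 * s) ^+ 2 *+ 2).
  by rewrite expr_div_n real_normK ?num_real//; field.
rewrite expRD mulrA ler_wpM2r ?expR_ge0//.
rewrite expRN ler_pdivrMr ?expR_gt0// mulrC -ler_pdivrMr//.
apply: le_trans (expR_ge1Dx _).
set y := `|x| / s; rewrite -subr_ge0.
rewrite (_ : _ - _ = 3 / 8 * (y - 4 / 3) ^+ 2 + 1 / 3); last by field.
by rewrite addr_ge0// mulr_ge0// sqr_ge0.
Qed.

(** Functions of at most linear growth are dominated, through [tail_le], by a combination of two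
    normal densities. *)
Let tail_integrable (a b : R) (u : R -> R) : measurable_fun setT u ->
  (forall x, `|u x| <= a + b * `|x|) -> 0 <= a -> 0 <= b ->
  mu.-integrable setT (EFin \o (fun x => u x * p x)).
Proof.
move=> mu' hu a0 b0.
have i1 := @integrableZl _ _ _ mu setT measurableT a _ (integrable_normal_pdf 0 s).
have i2 := @integrableZl _ _ _ mu setT measurableT (b * (2 * s)) _
  (integrable_normal_pdf 0 (2 * s)).
have := @integrableD _ _ _ mu setT measurableT _ _ i1 i2.
apply: le_integrable => //.
  apply/measurable_EFinP; apply: measurable_funM => //.
  exact: measurable_normal_pdf.
move=> x _ /=; rewrite lee_fin normrM (ger0_norm (p_ge0 x)).
rewrite [leRHS]ger0_norm; last first.
  by rewrite addr_ge0// mulr_ge0// ?mulr_ge0// ?normal_pdf_ge0// ltW.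
rewrite (le_trans (ler_wpM2r (p_ge0 x) (hu x)))// mulrDl lerD2l.
by rewrite -!mulrA ler_wpM2l// mulrA tail_le.
Qed.

Let is_derive_p (x : R) : is_derive x 1 (p : R -> R) (- (x / s ^+ 2) * p x).
Proof.
have -> : p = (fun x => normal_peak s * expR (- x ^+ 2 / (s ^+ 2 *+ 2))).
  by apply/funext => y; rewrite pE.
have h1 : is_derive x 1 (fun y : R => - y ^+ 2 / (s ^+ 2 *+ 2)) (- (x / s ^+ 2)).
  by apply: is_derive_eq; rewrite /GRing.scale/=; field.
have h2 := @is_derive1_comp _ expR (fun y : R => - y ^+ 2 / (s ^+ 2 *+ 2)) x _ _
    (is_derive_expR _) h1.
have h3 := is_deriveZ (normal_peak s) h2.
apply: is_derive_eq; rewrite /GRing.scale/=; ring.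
Qed.

Let cvg_p : p n%:R @[n --> \oo] --> (0 : R).
Proof.
apply/cvgrPdist_le => /= e e0.
have c0 : 0 <= normal_peak s * (s ^+ 2 *+ 2) / e.
  rewrite divr_ge0 ?(ltW e0)// mulr_ge0 ?normal_peak_ge0// mulrn_wge0//.
  by rewrite sqr_ge0.
near=> n.
rewrite sub0r normrN ger0_norm// pE.
have n1 : 1 <= n%:R :> R by near: n; exact: nbhs_infty_ger.
have nc : normal_peak s * (s ^+ 2 *+ 2) / e <= n%:R.
  by near: n; exact: nbhs_infty_ger.
have s20 : 0 < s ^+ 2 *+ 2 by rewrite pmulrn_lgt0// exprn_gt0.
rewrite mulNr expRN.
have n0 : 0 < n%:R :> R by rewrite (lt_le_trans _ n1).
have h : n%:R ^+ 2 / (s ^+ 2 *+ 2) <= expR (n%:R ^+ 2 / (s ^+ 2 *+ 2)).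
  by apply: le_trans (expR_ge1Dx _); rewrite lerDr.
have h0 : 0 < n%:R ^+ 2 / (s ^+ 2 *+ 2) by rewrite divr_gt0// exprn_gt0.
have := h; rewrite -lef_pV2 ?posrE ?expR_gt0// => h'.
rewrite (le_trans (ler_wpM2l (normal_peak_ge0 s) h'))//.
rewrite invf_div mulrA ler_pdivrMr ?exprn_gt0// [leRHS]mulrC -ler_pdivrMr//.
by rewrite (le_trans nc)// expr2 ler_peMl// ltW.
Unshelve. all: by end_near. Qed.

(** Stein's identity: the integrand is the derivative of [s ^ 2 * sin (th + t * x) * p x], which
    vanishes at both ends of the line. *)
Lemma stein_sin (th t : R) :
  Ex mu (fun x => (t * s ^+ 2 * cos (th + t * x) - x * sin (th + t * x)) * p x) = 0.
Proof.
pose f x := (t * s ^+ 2 * cos (th + t * x) - x * sin (th + t * x)) * p x.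
pose F x := s ^+ 2 * (sin (th + t * x) * p x).
have mf0 : measurable_fun setT (fun x : R => t * s ^+ 2 * cos (th + t * x) - x * sin (th + t * x)).
  apply: measurable_funB; apply: measurable_funM => //.
    by apply: bm_meas; apply: bm_cos; apply: measurable_funD => //; exact: measurable_funM.
  by apply: bm_meas; apply: bm_sin; apply: measurable_funD => //; exact: measurable_funM.
have fi : mu.-integrable setT (EFin \o f).
  apply: (@tail_integrable (`|t| * s ^+ 2) 1) => //; last first.
    by rewrite mulr_ge0// sqr_ge0.
  move=> x; rewrite (le_trans (ler_normB _ _))// lerD//.
    rewrite 2!normrM (ger0_norm (sqr_ge0 s)) ler_piMr ?norm_cos_le1//.
    by rewrite mulr_ge0// sqr_ge0.
  by rewrite normrM mul1r ler_piMr// norm_sin_le1.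
have dF (x : R) : is_derive x 1 (F : R -> R) (f x).
  have h1 : is_derive x 1 (fun y : R => th + t * y) t.
    by apply: is_derive_eq; rewrite /GRing.scale/=; ring.
  have h2 := @is_derive1_comp _ sin (fun y : R => th + t * y) x _ _ (is_derive_sin _) h1.
  have h3 := is_deriveM h2 (is_derive_p x).
  have h4 := is_deriveZ (s ^+ 2) h3.
  apply: is_derive_eq; rewrite /f /GRing.scale/=; field.
  exact: s_neq0.
have cF : continuous F.
  move=> x; apply: differentiable_continuous; apply/derivable1_diffP.
  by have [] := dF x.
have cf : continuous f.
  move=> x; apply: cvgM; last exact: continuous_normal_pdf.
  have ct : {for x, continuous (fun x : R => th + t * x)}.
    apply: cvgD; first exact: cvg_cst.
    by apply: cvgM; [exact: cvg_cst|exact: cvg_id].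
  apply: cvgB; apply: cvgM; [exact: cvg_cst| |exact: cvg_id|].
    by apply: (@continuous_comp _ _ _ (fun x : R => th + t * x) cos) => //; exact: continuous_cos.
  by apply: (@continuous_comp _ _ _ (fun x : R => th + t * x) sin) => //; exact: continuous_sin.
(* Endpoints at [n.+1] keep the interval nondegenerate for every [n]. *)
have FTC (n : nat) : (\int[mu]_(x in `[(- n.+1%:R)%R, n.+1%:R]) (f x)%:E =
    (F n.+1%:R - F (- n.+1%:R))%:E)%E.
  rewrite EFinB; apply: continuous_FTC2.
  - by rewrite (@lt_trans _ _ 0)// ?oppr_lt0.
  - exact: continuous_subspaceT.
  - split.
    + by move=> x _; have [] := dF x.
    + by apply: cvg_at_right_filter; exact: cF.
    + by apply: cvg_at_left_filter; exact: cF.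
  - by move=> x _; rewrite derive1E; have [_] := dF x.
pose g (n : nat) x := (f \_ `[(- n.+1%:R)%R, n.+1%:R]) x.
(* Dominated convergence passes from the growing intervals to the whole line, [|f|] being
   integrable. *)
have cg : (\int[mu]_x (g n x)%:E)%E @[n --> \oo] --> (\int[mu]_x (f x)%:E)%E.
  apply: (@dominated_cvg _ _ _ mu setT measurableT _ _
    (fun x => `|f x|%:E)) => //.
  - move=> n; apply/measurable_EFinP.
    apply/(measurable_restrictT _ _).1 => //.
    by apply: measurable_funTS; apply/measurable_EFinP; case/integrableP : fi.
  - move=> x _; apply: cvg_EFin; first exact: nearW.
    apply: cvg_near_cst; near=> n; rewrite /g /= /patch mem_set//= in_itv/=.
    rewrite -ler_norml (@le_trans _ _ n%:R)// ?ler_nat//.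
    by near: n; exact: nbhs_infty_ger.
  - exact: integrable_norm fi.
  - move=> n x _; rewrite /g /patch lee_fin; case: ifP => // _.
    by rewrite normr0.
have cF0 : (F n.+1%:R - F (- n.+1%:R))%:E @[n --> \oo] --> (0%:E : \bar R).
  apply: cvg_EFin; first exact: nearW.
  have pN x : p (- x) = p x by rewrite !pE sqrrN.
  (* The sign [sg] treats both ends at once, [p] being even. *)
  have H (sg : bool) : F ((-1) ^+ sg * n.+1%:R) @[n --> \oo] --> (0 : R).
    apply/cvgrPdist_le => /= e e0; under eq_near do rewrite sub0r normrN.
    have s20 : 0 < s ^+ 2 by rewrite exprn_gt0.
    have /cvgr0_norm_le/(_ (e / s ^+ 2)) := cvg_p.
    rewrite divr_gt0// => /(_ isT) /= [N _ hN]; exists N => // n /= Nn.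
    have := hN n.+1 (leqW Nn); rewrite /= (ger0_norm (p_ge0 _)) => hp.
    rewrite /F normrM (gtr0_norm s20) mulrC -ler_pdivlMr// normrM.
    rewrite (ger0_norm (p_ge0 _)).
    have -> : p ((-1) ^+ sg * n.+1%:R) = p n.+1%:R.
      by case: sg; rewrite ?expr0 ?mul1r// expr1 mulN1r pN.
    by rewrite (le_trans _ hp)// ler_piMl// norm_sin_le1.
  suff : F n.+1%:R - F (- n.+1%:R) @[n --> \oo] --> (0 - 0 : R) by rewrite subr0.
  apply: cvgB.
    by have := H false; under eq_cvg do rewrite expr0 mul1r.
  by have := H true; under eq_cvg do rewrite expr1 mulN1r.
have E : (fun n => \int[mu]_x (g n x)%:E)%E = (fun n : nat => (F n.+1%:R - F (- n.+1%:R))%:E).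
  apply/funext => n; rewrite -FTC [RHS]integral_mkcond.
  by apply: eq_integral => x _; rewrite /g restrict_EFin.
rewrite E in cg.
by rewrite /Rintegral (cvg_unique _ cg cF0).
Unshelve. all: by end_near. Qed.

(** By differentiation under the integral and Stein's identity, [phi] has derivative
    [- s ^ 2 * r * phi r], so [phi r * expR (s ^ 2 / 2 * r ^ 2)] is constant and is evaluated at
    [r = 0]. *)
Lemma normal_char_fun (th t : R) :
  Ex (normal_prob 0 s) (fun x => cos (th + t * x)) = cos th * expR (- (s ^+ 2 * t ^+ 2 / 2)).
Proof.
have mlin (r : R) : measurable_fun setT (fun x : R => th + r * x).
  by apply: measurable_funD => //; exact: measurable_funM.
rewrite Ex_normal_prob; last by apply: bm_cos; exact: mlin.
pose f (r x : R) := cos (th + r * x) * p x.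
pose phi (r : R) := Ex mu (f r).
have df (r x : R) : is_derive r 1 (fun y : R => f y x) (- (x * sin (th + r * x)) * p x).
  have h1 : is_derive r 1 (fun y : R => th + y * x) x.
    by apply: is_derive_eq; rewrite /GRing.scale/=; ring.
  have h2 := @is_derive1_comp _ cos (fun y : R => th + y * x) r _ _ (is_derive_cos _) h1.
  have h3 := is_deriveM h2 (is_derive_cst (p x) r 1).
  apply: is_derive_eq; rewrite /GRing.scale/=; ring.
have dphi (r : R) : is_derive r 1 (phi : R -> R) (- (s ^+ 2 * r) * phi r).
  have a1 : `]r - 1, r + 1[%classic r by rewrite /= in_itv/=; apply/andP; split; lra.
  have a2 x : `]r - 1, r + 1[%classic x -> mu.-integrable setT (EFin \o f x).
    by move=> _; apply: normal_integrable; exact: (bm_cos (mlin _)).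
  have a3 x y : `]r - 1, r + 1[%classic x -> setT y -> derivable (f^~ y) x 1.
    by move=> _ _; have [] := df x y.
  have a4 y : 0 <= `|y| * p y by rewrite mulr_ge0.
  have a5 : mu.-integrable setT (EFin \o (fun y => `|y| * p y)).
    apply: (@tail_integrable 0 1) => // x.
    by rewrite normr_id add0r mul1r.
  have a6 x y : `]r - 1, r + 1[%classic x -> setT y -> `|partial1of2 f x y| <= `|y| * p y.
    move=> _ _; rewrite partial1of2E; have [_ ->] := df x y.
    rewrite normrM (ger0_norm (p_ge0 y)) ler_wpM2r// normrN normrM.
    by rewrite ler_piMr// norm_sin_le1.
  apply: DeriveDef.
    exact: (derivable_under_integral measurableT a1 a2 a3 a4 a5 a6).
  rewrite -derive1E.
  rewrite (differentiation_under_integral measurableT a1 a2 a3 a4 a5 a6).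
  have i1 : mu.-integrable setT (EFin \o (fun x => x * sin (th + r * x) * p x)).
    apply: (@tail_integrable 0 1) => // [|x].
      by apply: measurable_funM => //; apply: bm_meas; exact: (bm_sin (mlin _)).
    by rewrite add0r mul1r normrM ler_piMr// norm_sin_le1.
  have i2 : mu.-integrable setT (EFin \o (fun x => r * s ^+ 2 * cos (th + r * x) * p x)).
    apply: normal_integrable; apply: bm_scale; exact: (bm_cos (mlin _)).
  have -> : Ex mu (fun y => partial1of2 f r y) = Ex mu (fun x => -1 * (x * sin (th + r * x) * p x)).
    congr Rintegral; apply/funext => x; rewrite partial1of2E; have [_ ->] := df r x.
    by ring.
  rewrite RintegralZl//.
  have := stein_sin th r.
  rewrite (_ : (fun x => _) = (fun x => r * s ^+ 2 * cos (th + r * x) * p x -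
    x * sin (th + r * x) * p x)); last by apply/funext => x; rewrite mulrBl.
  rewrite RintegralB// => /eqP; rewrite subr_eq0 => /eqP <-.
  rewrite (_ : (fun x => _) = (fun x => r * s ^+ 2 * f r x)); last first.
    by apply/funext => x; rewrite /f mulrA.
  rewrite RintegralZl//; first by rewrite -/(phi r); ring.
  by apply: normal_integrable; exact: (bm_cos (mlin _)).
pose psi (r : R) := phi r * expR (s ^+ 2 / 2 * r ^+ 2).
have dpsi (r : R) : is_derive r 1 (psi : R -> R) 0.
  have h1 : is_derive r 1 (fun y : R => s ^+ 2 / 2 * y ^+ 2) (s ^+ 2 * r).
    by apply: is_derive_eq; rewrite /GRing.scale/=; field.
  have h2 := @is_derive1_comp _ expR (fun y : R => s ^+ 2 / 2 * y ^+ 2) r _ _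
    (is_derive_expR _) h1.
  have h3 := is_deriveM (dphi r) h2.
  apply: is_derive_eq; rewrite /GRing.scale/=; ring.
have := is_derive_0_is_cst t 0 dpsi.
rewrite /psi /phi.
rewrite [in X in _ = X](_ : f 0 = fun x => cos th * p x); last first.
  by apply/funext => x; rewrite /f mul0r addr0.
rewrite [in X in _ = X]RintegralZl//; last exact: integrable_normal_pdf.
rewrite {2}/Rintegral integral_normal_pdf /= expr0n/= mulr0 expR0 !mulr1 => h.
have e0 : expR (s ^+ 2 / 2 * t ^+ 2) != 0 by rewrite gt_eqF// expR_gt0.
apply: (mulIf e0); rewrite h -[RHS]mulrA -expRD.
by rewrite (_ : _ + _ = 0) ?expR0 ?mulr1//; field.
Qed.

End gaussian_characteristic_function.

(** The upper bound rests on [1 / (1 + x) <= 1 - x + x ^ 2], which holds since the right side times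
    [1 + x] is [1 + x ^ 3]. *)
Lemma expRN_taylor {R : realType} (x : R) : 0 <= x -> 1 - x <= expR (- x) <= 1 - x + x ^+ 2.
Proof.
move=> x0; apply/andP; split; first by apply: le_trans (expR_ge1Dx _).
rewrite expRN -[leLHS]mul1r ler_pdivrMr ?expR_gt0//.
have h1 : 0 <= 1 - x + x ^+ 2 by nra.
by apply: le_trans (ler_wpM2l h1 (expR_ge1Dx x)); nra.
Qed.

(** * Gaussian variables with a given variance *)

Section gaussian_random_variable.
Context {R : realType} {d} {T : measurableType d} (P : probability T R).
Variables (U : T -> R) (v : R).
Hypothesis gU : centered_gaussian_rv P U.
Hypothesis vU : ('E_P[fun w => (U w * U w)%R] = v%:E)%E.

Let mU : measurable_fun setT U. Proof. by case: gU. Qed.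

(** The definition gives the law of [U] on Borel sets; [bounded_functional_eq] extends it to the
    cosine. The degenerate value [s = 0], a Dirac mass at [0], is evaluated separately. *)
Let char_fun_std : exists s : R, forall th t : R,
  Ex P (fun w => cos (th + t * U w)) = cos th * expR (- (s ^+ 2 * t ^+ 2 / 2)).
Proof.
case: gU => _ [s [s0 lawU]]; exists s => th t.
have mlin : measurable_fun setT (fun x : R => th + t * x).
  by apply: measurable_funD => //; exact: measurable_funM.
have mu1 : measurable_fun setT (fun w => U w) by [].
have L1 := bounded_functional_Ex P (bm_cst (1 : R)) mU.
have lawE (L : (R -> R) -> R) : bounded_functional L ->
    (forall A, measurable A -> L \1_A = fine (P (U @^-1` A))) ->
    Ex P (fun w => cos (th + t * U w)) = L (fun x => cos (th + t * x)).
  move=> hL LE; have := bounded_functional_eq L1 hL _ (bm_cos mlin).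
  rewrite (_ : (fun w => _) = (fun w => cos (th + t * U w))); last first.
    by apply/funext => w; rewrite mul1r.
  apply=> A mA; rewrite LE// -Ex_pre//.
  by congr Rintegral; apply/funext => w; rewrite mul1r.
have [s1|s1] := eqVneq s 0.
  rewrite (lawE (fun u => u 0)).
  - by rewrite s1 mulr0 addr0 expr0n/= !mul0r oppr0 expR0 mulr1.
  - by split=> //; exists 1; split=> // f e _ fe; rewrite mul1r.
  - by move=> A mA; rewrite lawU// s1 eqxx diracE indicE; case: (_ \in _).
have sp : 0 < s by rewrite lt_neqAle eq_sym s1.
rewrite (lawE (fun u => Ex (normal_prob 0 s) u)).
- exact: normal_char_fun.
- split; first by move=> a f g hf hg; rewrite ExD ?ExZ//; exact: bm_scale.
  by exists 1; split=> // f e hf fe; rewrite mul1r; exact: Ex_bound.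
- by move=> A mA; rewrite lawU// (negbTE s1) Ex_indic.
Qed.

Let sqrU_integrable : P.-integrable setT (EFin \o (fun w => U w * U w)).
Proof.
apply/integrableP; split.
  by apply/measurable_EFinP; exact: measurable_funM.
have U2 w : 0 <= U w * U w by rewrite -expr2 sqr_ge0.
under eq_integral => w _ do rewrite /= ger0_norm//.
by move: vU; rewrite unlock => ->; rewrite ltry.
Qed.

(** Recovers [c] from the second-order behaviour of [expR (- c * r ^ 2 / 2)] at [r = 0], along
    [r = 1 / n.+1]. *)
Let scaled_variance (c : R) : 0 <= c ->
  2 * n.+1%:R ^+ 2 * (1 - expR (- (c * n.+1%:R^-1 ^+ 2 / 2))) @[n --> \oo] --> c.
Proof.
move=> c0; apply/cvgrPdist_le => /= e e0; near=> n.
set k : R := n.+1%:R ^+ 2; have k1 : 1 <= k by rewrite expr_ge1// ler1n.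
have k0 : 0 < k by rewrite (lt_le_trans _ k1).
have -> : c * n.+1%:R^-1 ^+ 2 / 2 = c / 2 / k by rewrite exprVn -/k; ring.
set x := c / 2 / k.
have x0 : 0 <= x by rewrite !divr_ge0// ltW.
have /andP[l1 l2] := expRN_taylor x0.
have cE : c = 2 * k * x by rewrite /x; field; rewrite gt_eqF.
have k2 : 0 <= 2 * k by rewrite mulr_ge0// ltW.
rewrite ger0_norm; last by rewrite {1}cE -mulrBr mulr_ge0//; lra.
rewrite {1}cE -mulrBr (@le_trans _ _ (2 * k * x ^+ 2))//.
  by rewrite ler_wpM2l//; lra.
have -> : 2 * k * x ^+ 2 = c ^+ 2 / 2 / k by rewrite /x; field; rewrite gt_eqF.
rewrite ler_pdivrMr// -ler_pdivrMl// (@le_trans _ _ n.+1%:R)//; last first.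
  by rewrite /k expr2 ler_peMl// ler1n.
rewrite (@le_trans _ _ n%:R)// ?ler_nat//.
by near: n; exact: nbhs_infty_ger.
Unshelve. all: by end_near. Qed.

(** [centered_gaussian_rv] hides its scale [s], which has to be matched with the variance [v]. Both
    are limits of the expectation of [2 * k ^ 2 * (1 - cos (U / k))]: the characteristic function
    gives [s ^ 2], dominated convergence under [U ^ 2] gives [v]. *)
Lemma centered_gaussian_char_fun (th : R) :
  Ex P (fun w => cos (th + U w)) = cos th * expR (- (v / 2)).
Proof.
have [s hs] := char_fun_std.
pose f n w := 2 * n.+1%:R ^+ 2 * (1 - cos (0 + n.+1%:R^-1 * U w)).
have mlin n : measurable_fun setT (fun w => 0 + n.+1%:R^-1 * U w).
  by apply: measurable_funD => //; exact: measurable_funM.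
have bf n : bm (f n).
  by apply: bm_scale; apply: bm_sub => //; exact: bm_cos.
have fs : (fun n => Ex P (f n)) @ \oo --> s ^+ 2.
  rewrite [X in X @ _](_ : _ = fun n => 2 * n.+1%:R ^+ 2 *
    (1 - expR (- (s ^+ 2 * n.+1%:R^-1 ^+ 2 / 2)))).
    exact: scaled_variance (sqr_ge0 s).
  apply/funext => n; rewrite ExZ; last by apply: bm_sub => //; exact: bm_cos.
  by rewrite ExB ?Ex_cst ?hs ?cos0 ?mul1r//; exact: bm_cos.
have fv : (fun n => Ex P (f n)) @ \oo --> v.
  apply: fine_cvg.
  rewrite (_ : v%:E = (\int[P]_w (U w * U w)%:E)%E); last by rewrite -vU unlock.
  apply: (@dominated_cvg _ _ _ P setT measurableT _ _ (EFin \o (fun w => U w * U w))) => //.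
  - by move=> n; apply/measurable_EFinP; exact: bm_meas.
  - move=> w _; apply: cvg_EFin; first exact: nearW.
    apply/cvgrPdist_le => /= e e0; near=> n.
    set k : R := n.+1%:R; have k0 : 0 < k by rewrite ltr0n.
    have := cos_taylor (k^-1 * U w); rewrite /f add0r -/k.
    set c := cos _ => h.
    have -> : U w * U w - 2 * k ^+ 2 * (1 - c) =
        2 * k ^+ 2 * (c - 1 + (k^-1 * U w) ^+ 2 / 2).
      by field; rewrite gt_eqF.
    rewrite normrM ger0_norm ?mulr_ge0 ?exprn_ge0 ?(ltW k0)//.
    have k20 : 0 <= 2 * k ^+ 2 by rewrite mulr_ge0 ?exprn_ge0 ?(ltW k0).
    rewrite (le_trans (ler_wpM2l k20 h))//.
    rewrite normrM ger0_norm ?invr_ge0 ?(ltW k0)//.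
    have -> : 2 * k ^+ 2 * ((k^-1 * `|U w|) ^+ 4 / 8) = `|U w| ^+ 4 / 4 / k ^+ 2.
      by field; rewrite gt_eqF.
    rewrite ler_pdivrMr ?exprn_gt0// -ler_pdivrMl//.
    rewrite (@le_trans _ _ k)//; last by rewrite expr2 ler_peMl// ?(ltW k0)// ler1n.
    rewrite (@le_trans _ _ n%:R)// ?ler_nat//.
    by near: n; exact: nbhs_infty_ger.
  - move=> n w _; rewrite lee_fin /f add0r.
    set k : R := n.+1%:R; have k0 : 0 < k by rewrite ltr0n.
    have k20 : 0 <= 2 * k ^+ 2 by rewrite mulr_ge0 ?exprn_ge0 ?(ltW k0).
    rewrite normrM ger0_norm// distrC.
    rewrite (le_trans (ler_wpM2l k20 (cos_dist_1 _)))//.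
    rewrite real_normK ?num_real// le_eqVlt; apply/orP; left; apply/eqP.
    by field; rewrite gt_eqF.
have vs : v = s ^+ 2 by apply: (cvg_unique _ fv fs).
have := hs th 1; rewrite vs expr1n mulr1 => <-.
by congr Rintegral; apply/funext => w; rewrite mul1r.
Unshelve. all: by end_near. Qed.

End gaussian_random_variable.

Lemma prod_EFin {R : realType} I (r : seq I) (p : pred I) (F : I -> R) :
  (\prod_(i <- r | p i) (F i)%:E)%E = (\prod_(i <- r | p i) F i)%:E.
Proof. by rewrite (big_morph EFin (id1 := 1%E) (op1 := *%E)). Qed.

(** * Sums of independent Gaussian variables *)

Section independent_gaussians.
Context {R : realType} {d} {S : measurableType d} (P : probability S R).
Variables (n : nat) (Sg : nat -> set (set S)) (U : nat -> S -> R) (v : nat -> R).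
Hypothesis Sg_measurable : forall p, (0 < p <= n)%N -> Sg p `<=` measurable.
Hypothesis Sg_setT : forall p, (0 < p <= n)%N -> Sg p setT.
Hypothesis Sg_indep : forall B : nat -> set S,
  (forall p, (0 < p <= n)%N -> Sg p (B p)) ->
  P (\bigcap_(p in [set p | (0 < p <= n)%N]) B p) =
    (\prod_(1 <= p < n.+1) P (B p))%E.
Hypothesis U_Sg : forall p, (0 < p <= n)%N -> forall A, measurable A ->
  Sg p (U p @^-1` A).
Hypothesis U_char : forall p, (0 < p <= n)%N -> forall th : R,
  Ex P (fun w => cos (th + U p w)) = cos th * expR (- (v p / 2)).

Let mU p : (0 < p <= n)%N -> measurable_fun setT (U p).
Proof.
by move=> pn _ A mA; rewrite setTI; apply: (Sg_measurable pn); exact: U_Sg.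
Qed.

(** [Psi] factors out of products of events of the fields after time [k]. The whole tail up to [n]
    is kept so that the next field can be absorbed. *)
Let indep_from k (Psi : S -> R) := bm Psi /\
  forall B : nat -> set S, (forall p, (0 < p <= n)%N -> Sg p (B p)) ->
  Ex P (fun w => Psi w * \prod_(k.+1 <= p < n.+1) \1_(B p) w) =
  Ex P Psi * \prod_(k.+1 <= p < n.+1) fine (P (B p)).

Let bm_ind_prod k (B : nat -> set S) : (forall p, (0 < p <= n)%N -> Sg p (B p)) ->
  bm (fun w => \prod_(k.+1 <= p < n.+1) \1_(B p) w : R).
Proof.
move=> hB; under eq_fun do rewrite big_nat_cond.
apply: bm_prod => p /andP[/andP[kp pn] _]; apply: bm_indic.
have p0n : (0 < p <= n)%N by rewrite (leq_trans _ kp).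
by apply: (Sg_measurable p0n); exact: hB.
Qed.

Let indep_from0 (c : R) : indep_from 0 (fun=> c).
Proof.
split=> // B hB; rewrite Ex_cst ExZ; last exact: bm_ind_prod.
congr (c * _).
have mB : measurable (\bigcap_(p in [set p | (0 < p <= n)%N]) B p).
  rewrite bigcap_mkcond; apply: bigcapT_measurable => p.
  by case: ifPn => // /set_mem /= pn; apply: (Sg_measurable pn); exact: hB.
transitivity (Ex P (\1_(\bigcap_(p in [set p | (0 < p <= n)%N]) B p))).
  congr Rintegral; apply/funext => w; rewrite indicE.
  have [/set_mem wB|/negP wB] := boolP (w \in _).
    rewrite big_nat_cond big1// => p /andP[pn _].
    by rewrite indicE mem_set//; apply: wB.
  apply/eqP; rewrite prodf_seq_eq0; apply/hasP => /=.
  have : exists2 p, (0 < p <= n)%N & ~ B p w.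
    apply: contrapT => h; apply: wB; apply/mem_set => p pn.
    by apply: contrapT => Bpw; apply: h; exists p.
  move=> [p pn Bpw]; exists p; first by rewrite mem_index_iota ltnS.
  by rewrite indicE memNset.
rewrite Ex_indic// Sg_indep//.
have -> : (\prod_(1 <= p < n.+1) P (B p) =
    \prod_(1 <= p < n.+1) (fine (P (B p)))%:E)%E.
  apply: eq_big_nat => p pn; rewrite fineK// fin_num_measure//.
  by apply: (Sg_measurable pn); exact: hB.
by rewrite prod_EFin.
Qed.

(** The event of field [k.+1] is first a preimage under [U k.+1], where the product rule applies;
    [bounded_functional_eq] then replaces its indicator by [u]. *)
Let indep_fromS k (Psi : S -> R) (u : R -> R) : (k < n)%N -> indep_from k Psi ->
  bm u ->
  indep_from k.+1 (fun w => Psi w * u (U k.+1 w)) /\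
  Ex P (fun w => Psi w * u (U k.+1 w)) = Ex P Psi * Ex P (fun w => u (U k.+1 w)).
Proof.
move=> kn [hPsi iPsi] hu.
have k1n : (0 < k.+1 <= n)%N by [].
have hv : bm (fun w => u (U k.+1 w)) by apply: bm_pre => //; exact: mU.
have main (B : nat -> set S) : (forall p, (0 < p <= n)%N -> Sg p (B p)) ->
    Ex P (fun w => Psi w * u (U k.+1 w) * \prod_(k.+2 <= p < n.+1) \1_(B p) w) =
    Ex P Psi * Ex P (fun w => u (U k.+1 w)) *
      \prod_(k.+2 <= p < n.+1) fine (P (B p)).
  move=> hB.
  have hprod := bm_ind_prod k.+1 hB.
  have f1 := bounded_functional_Ex P (bm_mul hPsi hprod) (mU k1n).
  have f2 := bounded_functional_Ex P
    (bm_cst (Ex P Psi * \prod_(k.+2 <= p < n.+1) fine (P (B p)))) (mU k1n).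
  have := bounded_functional_eq f1 f2 _ hu.
  rewrite (_ : (fun w => _) = (fun w => Psi w * u (U k.+1 w) *
    \prod_(k.+2 <= p < n.+1) \1_(B p) w)); last first.
    by apply/funext => w; rewrite mulrAC.
  rewrite ExZ// => ->; first by rewrite mulrAC.
  move=> A mA; rewrite ExZ; last by apply: bm_pre; [exact: mU|exact: bm_indic].
  rewrite Ex_pre//; last exact: mU.
  pose B' p := if p == k.+1 then U k.+1 @^-1` A else B p.
  have hB' p : (0 < p <= n)%N -> Sg p (B' p).
    by move=> pn; rewrite /B'; case: eqP => [->|_]; [exact: U_Sg|exact: hB].
  have := iPsi B' hB'; rewrite big_ltn// {2}/B' eqxx.
  rewrite (eq_big_nat _ _ (F2 := fun p => fine (P (B p)))); last first.
    move=> p /andP[kp _]; rewrite /B'; case: eqP => // pk.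
    by rewrite pk ltnn in kp.
  move=> h; rewrite -mulrA [X in _ * X]mulrC -h.
  congr Rintegral; apply/funext => w; rewrite [in RHS]big_ltn// {1}/B' eqxx -mulrA.
  congr (_ * _); rewrite mulrC; congr (_ * _).
  apply: eq_big_nat => p /andP[kp _]; rewrite /B'; case: eqP => // pk.
  by rewrite pk ltnn in kp.
have E : Ex P (fun w => Psi w * u (U k.+1 w)) = Ex P Psi * Ex P (fun w => u (U k.+1 w)).
  have := main (fun=> setT) Sg_setT.
  rewrite big1 ?mulr1; last by move=> p _; rewrite probability_setT.
  move=> <-; congr Rintegral; apply/funext => w.
  by rewrite big1 ?mulr1// => p _; rewrite indicE in_setT.
split=> //; split; first exact: bm_mul.
by move=> B hB; rewrite E; exact: main.
Qed.

(** Induction on the number of fields with the addition formula for the cosine. The sine of the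
    partial sum is the cosine with phase [th - pi / 2], which is why the induction runs over all
    phases. *)
Lemma independent_gaussian_sum (th : R) :
  Ex P (fun w => cos (th + \sum_(1 <= p < n.+1) U p w)) =
  cos th * expR (- (\sum_(1 <= p < n.+1) v p / 2)).
Proof.
suff main k : (k <= n)%N -> forall th : R,
    indep_from k (fun w => cos (th + \sum_(1 <= p < k.+1) U p w)) /\
    Ex P (fun w => cos (th + \sum_(1 <= p < k.+1) U p w)) =
    cos th * expR (- (\sum_(1 <= p < k.+1) v p / 2)).
  by apply main.
elim: k => [_|k IH kn] {}th.
  have -> : (fun w => cos (th + \sum_(1 <= p < 1) U p w)) = (fun=> cos th).
    by apply/funext => w; rewrite big_geq// addr0.
  by rewrite Ex_cst big_geq// oppr0 expR0 mulr1.
have {}IH := IH (ltnW kn).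
have k1n : (0 < k.+1 <= n)%N by [].
have mcos : bm (@cos R) by exact: (bm_cos (@measurable_id _ _ setT)).
have msin : bm (@sin R) by exact: (bm_sin (@measurable_id _ _ setT)).
have [ic Ec] := IH th; have [iS Es] := IH (th - pi / 2).
have [ic' Ec'] := indep_fromS kn ic mcos; have [iS' Es'] := indep_fromS kn iS msin.
have -> : (fun w => cos (th + \sum_(1 <= p < k.+2) U p w)) =
    (fun w => cos (th + \sum_(1 <= p < k.+1) U p w) * cos (U k.+1 w) -
      cos (th - pi / 2 + \sum_(1 <= p < k.+1) U p w) * sin (U k.+1 w)).
  apply/funext => w; rewrite big_nat_recr//= addrA.
  by rewrite (addrAC th (- (pi / 2))) cosBpihalf -cosD.
(* Phase [- (pi / 2)] turns the cosine into a sine and makes the factor [cos th] vanish. *)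
have Esin : Ex P (fun w => sin (U k.+1 w)) = 0.
  have := U_char k1n (- (pi / 2)).
  rewrite cosN cos_pihalf mul0r => <-.
  by congr Rintegral; apply/funext => w; rewrite addrC cosBpihalf.
have Ecos : Ex P (fun w => cos (U k.+1 w)) = expR (- (v k.+1 / 2)).
  have := U_char k1n 0; rewrite cos0 mul1r => <-.
  by congr Rintegral; apply/funext => w; rewrite add0r.
have [b1 h1] := ic'; have [b2 h2] := iS'.
split.
  split; first exact: bm_sub.
  move=> B hB; rewrite ExB// mulrBl -h1// -h2// -ExB; last 2 first.
  - by apply: bm_mul => //; exact: bm_ind_prod.
  - by apply: bm_mul => //; exact: bm_ind_prod.
  by congr Rintegral; apply/funext => w; rewrite mulrBl.
rewrite ExB// Ec' Es' Esin mulr0 subr0 Ec Ecos -mulrA -expRD.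
by rewrite [in RHS]big_nat_recr//= opprD.
Qed.

End independent_gaussians.

Section quadratic_expectation.
Context {R : realType} {d} {S : measurableType d} (P : probability S R).

Lemma integrable_Rintegral_sum I (r : seq I) (F : I -> S -> R) :
  (forall i, P.-integrable setT (EFin \o F i)) ->
  P.-integrable setT (EFin \o (fun w => \sum_(i <- r) F i w)) /\
  Ex P (fun w => \sum_(i <- r) F i w) = \sum_(i <- r) Ex P (F i).
Proof.
move=> hF; elim: r => [|i r [IH1 IH2]].
  have -> : (fun w => \sum_(i <- [::]) F i w) = (fun=> 0).
    by apply/funext => w; rewrite big_nil.
  by rewrite Ex_cst big_nil; split => //; exact: bm_integrable.
have -> : (fun w => \sum_(j <- i :: r) F j w) =
    (fun w => F i w + \sum_(j <- r) F j w).
  by apply/funext => w; rewrite big_cons.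
split; last by rewrite RintegralD// IH2 big_cons.
have := integrableD measurableT (hF i) IH1.
by congr (_.-integrable _ _); apply/funext.
Qed.

(** The hypothesis is an equality of extended expectations; its finite diagonal gives square
    integrability, hence integrability of the cross terms, before the sum is expanded. *)
Lemma expectation_quadratic m (w : 'I_m -> S -> R) (c : 'I_m -> 'I_m -> R)
    (t : 'I_m -> R) :
  (forall i, measurable_fun setT (w i)) ->
  (forall i j, ('E_P[fun x => (w i x * w j x)%R] = (c i j)%:E)%E) ->
  ('E_P[fun x => ((\sum_i t i * w i x) * (\sum_i t i * w i x))%R] =
    (\sum_i \sum_j t i * t j * c i j)%:E)%E.
Proof.
move=> mw wc.
have i1 i : P.-integrable setT (EFin \o (fun x => w i x * w i x)).
  apply/integrableP; split.
    by apply/measurable_EFinP; exact: measurable_funM.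
  have U2 x : 0 <= w i x * w i x by rewrite -expr2 sqr_ge0.
  under eq_integral => x _ do rewrite /= ger0_norm//.
  by have := wc i i; rewrite unlock => ->; rewrite ltry.
have i2 i j : P.-integrable setT (EFin \o (fun x => w i x * w j x)).
  have := integrableD measurableT (i1 i) (i1 j).
  apply: le_integrable => //.
    by apply/measurable_EFinP; exact: measurable_funM.
  move=> x _ /=; rewrite lee_fin [leRHS]ger0_norm; last first.
    by rewrite addr_ge0// -expr2 sqr_ge0.
  rewrite normrM -2!expr2 -[w i x ^+ 2]real_normK ?num_real//.
  rewrite -[w j x ^+ 2]real_normK ?num_real//.
  move: (normr_ge0 (w i x)) (normr_ge0 (w j x)).
  set a := `|w i x|; set b := `|w j x| => a0 b0.
  by have := sqr_ge0 (a - b); nra.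
have i3 i j : P.-integrable setT (EFin \o (fun x => t i * t j * (w i x * w j x))).
  have := integrableZl measurableT (t i * t j) (i2 i j).
  by congr (_.-integrable _ _); apply/funext.
have s1 i := integrable_Rintegral_sum (index_enum 'I_m) (i3 i).
have [s2 s3] := integrable_Rintegral_sum (index_enum 'I_m) (fun i => (s1 i).1).
have -> : (fun x => (\sum_i t i * w i x) * (\sum_i t i * w i x)) =
    (fun x => \sum_i \sum_j t i * t j * (w i x * w j x)).
  apply/funext => x; rewrite big_distrlr/=; apply: eq_bigr => i _.
  by apply: eq_bigr => j _; ring.
rewrite unlock -[LHS]fineK; last exact: (integrable_fin_num measurableT s2).
congr EFin; rewrite [LHS]s3; apply: eq_bigr => i _.
rewrite (s1 i).2; apply: eq_bigr => j _; rewrite RintegralZl//; congr (_ * _).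
apply: EFin_inj; rewrite -wc unlock /Rintegral fineK//.
exact: (integrable_fin_num measurableT (i2 i j)).
Qed.

End quadratic_expectation.

(** * Feynman-Kac measures on path space *)

Section kernel_pullback.
Context {d d' d'' : measure_display} {X' : measurableType d}
  {X : measurableType d'} {Y : measurableType d''} {R : realType}.
Variables (k : R.-pker X ~> Y) (g : X' -> X) (mg : measurable_fun setT g).

(** The measurability proof is an argument so that the kernel instance can be inferred from the
    term. *)
Definition kernel_pullback (_ : measurable_fun setT g) (x : X') :
  {measure set Y -> \bar R} := k (g x).

Let kernel_pullback_measurable U : measurable U ->
  measurable_fun setT (kernel_pullback mg ^~ U).
Proof.
move=> mU; apply: (@measurableT_comp _ _ _ _ _ _ (k ^~ U) _ g) => //.
exact: measurable_kernel.
Qed.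

HB.instance Definition _ := isKernel.Build _ _ X' Y R (kernel_pullback mg)
  kernel_pullback_measurable.

Let kernel_pullbackT x : kernel_pullback mg x setT = 1%E.
Proof. exact: prob_kernel. Qed.

HB.instance Definition _ := Kernel_isProbability.Build _ _ X' Y R
  (kernel_pullback mg) kernel_pullbackT.

End kernel_pullback.

Section transition_operator.
Context {d d' : measure_display} {X : measurableType d} {Y : measurableType d'}
  {R : realType} (k : R.-pker X ~> Y).

(** A copy of [k x] carrying the structure of a probability measure, so that the calculus of [Ex]
    applies. *)
Definition kernel_probability (x : X) : set Y -> \bar R := k x.

HB.instance Definition _ x := Measure.copy (kernel_probability x) (k x).

Let kernel_probabilityT x : kernel_probability x setT = 1%E.
Proof. exact: prob_kernel. Qed.

HB.instance Definition _ x := Measure_isProbability.Build _ _ _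
  (kernel_probability x) (kernel_probabilityT x).

(** [f] reads the starting point as well as the new one, so that on [F n.+1], the product of [F n]
    and [E n.+1], this is the transition operator of the historical process. *)
Definition transition (f : X * Y -> R) (x : X) : R :=
  Ex (kernel_probability x) (fun y => f (x, y)).

Let bm_section (f : X * Y -> R) x : bm f ->
  bm (fun y => f (x, y)).
Proof. move=> hf; apply: (bm_pre (h := fun y => (x, y))) => //.
exact: measurable_fun_pair. Qed.

Lemma transition_lin (a : R) f g x : bm f ->
  bm g ->
  transition (fun z => a * f z + g z) x = a * transition f x + transition g x.
Proof.
move=> hf hg; rewrite /transition ExD ?ExZ//; try exact: bm_section.
by apply: bm_scale; exact: bm_section.
Qed.

Lemma transition_cst (c : R) x : transition (fun=> c) x = c.
Proof. by rewrite /transition Ex_cst. Qed.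

Lemma transition_ge0 f x : (forall z, 0 <= f z) -> 0 <= transition f x.
Proof. by move=> f0; exact: Ex_ge0. Qed.

Lemma transition_bound f x M : bm f ->
  (forall z, `|f z| <= M) -> `|transition f x| <= M.
Proof. by move=> hf fM; apply: Ex_bound => //; exact: bm_section. Qed.

Lemma transitionZ (psi : X -> R) f x : bm f ->
  transition (fun z => psi z.1 * f z) x = psi x * transition f x.
Proof. by move=> hf; rewrite /transition/= ExZ//; exact: bm_section. Qed.

Lemma transition_EFin (f : X * Y -> R) x : bm f ->
  (transition f x)%:E = (\int[k x]_y (f (x, y))%:E)%E.
Proof.
move=> hf; rewrite /transition.
by rewrite -(Ex_EFin (kernel_probability x) (bm_section x hf)).
Qed.

Lemma measurable_section (C : set (X * Y)) x : measurable C ->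
  measurable [set y | C (x, y)].
Proof.
move=> mC; rewrite -[X in measurable X]setTI.
have : measurable_fun setT (fun y : Y => (x, y)) by exact: measurable_fun_pair.
exact.
Qed.

Lemma transition_indic (C : set (X * Y)) x : measurable C ->
  (transition \1_C x)%:E = k x [set y | C (x, y)].
Proof.
move=> mC; rewrite transition_EFin; last exact: bm_indic.
have := integral_indic (k x) measurableT (measurable_section x mC).
by rewrite setIT => <-.
Qed.

Lemma bm_transition f : bm f -> bm (transition f).
Proof.
move=> hf; have [M [M0 fM]] := bm_bound hf.
apply: (@bm_intro _ _ _ _ M); last by move=> x; exact: transition_bound.
have hfM : bm (fun z => f z + M) by exact: bm_add.
(* Measurability of kernel integrals is applied to a nonnegative integrand, hence the shift by
   [M]. *)
rewrite (_ : transition f = fun x => transition (fun z => f z + M) x - M).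
  apply: measurable_funB => //; apply/measurable_EFinP.
  rewrite (_ : _ \o _ = fun x => (\int[k x]_y (f (x, y) + M)%:E)%E).
    apply: (@measurable_fun_integral_finite_kernel _ _ _ _ _
      (fun z => (f z + M)%:E) k).
      by move=> z; rewrite lee_fin -lerBlDr sub0r; have := fM z; rewrite ler_norml => /andP[].
    by apply/measurable_EFinP; exact: bm_meas.
  by apply/funext => x /=; rewrite transition_EFin.
apply/funext => x.
have := transition_lin 1 x hf (bm_cst M).
rewrite mul1r transition_cst => h; rewrite -[LHS](addrK M) -h.
by congr (_ - _); congr transition; apply/funext => z; rewrite mul1r.
Qed.

End transition_operator.

(** The Markov property is assumed on rectangles. They form a generating class stable under
    intersection, and the sets satisfying the identity form a Dynkin system; functions follow from
    indicators. *)
Lemma rectangle_disintegration {R : realType} {d d' dO}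
    {X : measurableType d} {Y : measurableType d'} {Omega : measurableType dO}
    (k : R.-pker X ~> Y) (P : probability Omega R)
    (U : Omega -> X) (V : Omega -> Y) :
  measurable_fun setT U -> measurable_fun setT V ->
  (forall A B, measurable A -> measurable B ->
    P (U @^-1` A `&` V @^-1` B) = (\int[P]_(w in U @^-1` A) k (U w) B)%E) ->
  forall f : X * Y -> R, bm f ->
  Ex P (fun w => f (U w, V w)) = Ex P (fun w => transition k f (U w)).
Proof.
move=> mU mV hUV.
have mUV : measurable_fun setT (fun w => (U w, V w)) by exact: measurable_fun_pair.
have f1 := bounded_functional_Ex P (bm_cst (1 : R)) mUV.
suff H C : measurable C -> Ex P (fun w => \1_C (U w, V w)) =
    Ex P (fun w => transition k \1_C (U w)).
  move=> f hf.
  have := bounded_functional_eq f1 (L2 := fun f => Ex P (fun w => transition k f (U w))) _ _ hf.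
  rewrite (_ : (fun w => 1 * f (U w, V w)) = (fun w => f (U w, V w))); last first.
    by apply/funext => w; rewrite mul1r.
  apply.
  - split.
      move=> a u v hu hv.
      rewrite -ExZ; last by apply: bm_pre => //; exact: bm_transition.
      rewrite -ExD; last 2 first.
      + by apply: bm_scale; apply: bm_pre => //; exact: bm_transition.
      + by apply: bm_pre => //; exact: bm_transition.
      by congr Rintegral; apply/funext => w; rewrite transition_lin.
    exists 1; split=> // u e hu ue; rewrite mul1r; apply: Ex_bound.
      by apply: bm_pre => //; exact: bm_transition.
    by move=> w; exact: transition_bound.
  - move=> C mC; rewrite -H//.
    by congr Rintegral; apply/funext => w; rewrite mul1r.
move=> mC; have : (d, d').-prod.-measurable C by [].
rewrite measurable_prod_measurableType.
have b1 D : measurable D -> bm (fun w => \1_D (U w, V w) : R).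
  by move=> mD; apply: bm_pre => //; exact: bm_indic.
have b2 D : measurable D -> bm (fun w => transition k \1_D (U w)).
  by move=> mD; apply: bm_pre => //; apply: bm_transition; exact: bm_indic.
move: C mC.
suff : forall C : set (X * Y), <<s [set A `*` B | A in measurable & B in measurable] >> C ->
    Ex P (fun w => \1_C (U w, V w)) = Ex P (fun w => transition k \1_C (U w)).
  by move=> h C _; exact: h.
apply: dynkin_induction.
- exact: measurable_prod_measurableType.
- move=> _ _ [A mA [B mB <-]] [A' mA' [B' mB' <-]].
  rewrite -setXI; exists (A `&` A'); first exact: measurableI.
  by exists (B `&` B'); first exact: measurableI.
- transitivity (1 : R).
    rewrite -(Ex_cst P 1); congr Rintegral.
    by apply/funext => w; rewrite indicE in_setT.
  rewrite -[LHS](Ex_cst P 1); congr Rintegral; apply/funext => w.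
  rewrite -[LHS](transition_cst k 1 (U w)); congr transition.
  by apply/funext => z; rewrite indicE in_setT.
- move=> _ [A mA [B mB <-]].
  have mAB : measurable (A `*` B) by exact: measurableX.
  rewrite Ex_pre//; congr fine.
  rewrite [LHS](hUV _ _ mA mB) [LHS]integral_mkcond.
  apply: eq_integral => w _; rewrite transition_indic//.
  rewrite /patch; case: ifPn => [/set_mem UA|/negP UA].
    by congr (k _ _); apply/seteqP; split => [y By//|y []].
  rewrite (_ : [set y | _] = set0) ?measure0//.
  by apply/seteqP; split => // y [/= UA' _]; apply: UA; exact: mem_set.
- move=> D mD IH.
  have E (z : X * Y) : \1_(~` D) z = -1 * \1_D z + 1 :> R.
    by rewrite !indicE in_setC; case: (z \in D) => /=; ring.
  transitivity (-1 * Ex P (fun w => \1_D (U w, V w)) + 1).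
    rewrite -(ExZ P _ (b1 _ mD)) -[X in _ + X](Ex_cst P 1).
    rewrite -(ExD P (bm_scale (-1) (b1 _ mD)) (bm_cst 1)).
    by congr Rintegral; apply/funext => w; rewrite E.
  rewrite IH -(ExZ P _ (b2 _ mD)) -[X in _ + X](Ex_cst P 1).
  rewrite -(ExD P (bm_scale (-1) (b2 _ mD)) (bm_cst 1)).
  congr Rintegral; apply/funext => w.
  rewrite -[X in _ + X](transition_cst k 1 (U w)) -transition_lin//.
    by congr transition; apply/funext => z; rewrite E.
  exact: bm_indic.
(* Countable disjoint unions: both sides become series of nonnegative extended reals, and the series
   is exchanged with the integral. *)
- move=> F mF tF IH.
  have tF' i j z : i != j -> F i z -> F j z -> False.
    move=> ij Fi Fj; have /trivIsetP/(_ i j I I ij)/seteqP[/(_ z) h _] := tF.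
    exact: h.
  have mUF : measurable (\bigcup_i F i) by exact: bigcupT_measurable.
  apply: EFin_inj; rewrite Ex_pre// fineK; last first.
    by rewrite fin_num_measure// -[X in measurable X]setTI; exact: mUV.
  rewrite preimage_bigcup measure_semi_bigcup//; last 3 first.
  - by move=> i; rewrite -[X in measurable X]setTI; exact: mUV.
  - apply/trivIsetP => i j _ _ ij; apply/seteqP; split=> // w [Fi Fj].
    exact: (tF' i j (U w, V w)).
  - by apply: bigcupT_measurable => i; rewrite -[X in measurable X]setTI; exact: mUV.
  rewrite -(Ex_EFin P (b2 _ mUF)).
  transitivity (\int[P]_w \sum_(0 <= i <oo) (transition k \1_(F i) (U w))%:E)%E.
    rewrite integral_nneseries//; last 2 first.
    - by move=> i; apply/measurable_EFinP; apply: bm_meas; exact: b2.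
    - by move=> i w _; rewrite lee_fin; apply: transition_ge0.
    apply: eq_eseriesr => i _; rewrite (Ex_EFin P (b2 _ (mF i))) -IH Ex_pre//.
    by rewrite fineK// fin_num_measure// -[X in measurable X]setTI; exact: mUV.
  apply: eq_integral => w _; rewrite transition_indic//.
  rewrite (_ : [set y | _] = \bigcup_i [set y | F i (U w, y)]); last first.
    by apply/seteqP; split=> y [i _ Fi]; exists i.
  rewrite measure_semi_bigcup//; last 3 first.
  - by move=> i; exact: measurable_section.
  - apply/trivIsetP => i j _ _ ij; apply/seteqP; split=> // y [Fi Fj].
    exact: (tF' i j (U w, y)).
  - by apply: bigcupT_measurable => i; exact: measurable_section.
  by apply: eq_eseriesr => i _; rewrite transition_indic.
Qed.

(** * The historical process and the evolution of the measures *)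

Section path_space_chain.
Context {R : realType} {dE : nat -> measure_display}
  {E : forall n, measurableType (dE n)}.
Local Notation F := (path_space E).
Variables (K : forall n, R.-pker E n ~> E n.+1) (x0 : E 0%N).
Context {dO : measure_display} {Omega : measurableType dO}
  {P : probability Omega R} (X : forall n, {RV P >-> E n}).
Hypothesis hX : is_markov_chain K x0 X.
Variables (G : forall n, F n -> R).
Hypothesis hG : is_potential G.

Lemma measurable_last_coord n : measurable_fun setT (@last_coord dE E n).
Proof. by case: n => [|n]; [exact: measurable_id|exact: measurable_snd]. Qed.

Lemma measurable_hist n : measurable_fun setT (hist X n).
Proof.
elim: n => [|n IH] /=; first exact: measurable_funPT.
by apply: measurable_fun_pair => //; exact: measurable_funPT.
Qed.

Lemma last_coord_hist n w : last_coord n (hist X n w) = X n w.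
Proof. by case: n. Qed.

Definition path_kernel n : R.-pker F n ~> E n.+1 :=
  kernel_pullback (K n) (@measurable_last_coord n).

Definition path_transition n (f : F n.+1 -> R) : F n -> R :=
  transition (path_kernel n) f.

Lemma hist_transitionE n y (A : set (F n.+1)) : measurable A ->
  hist_transition K n y A = (path_transition (\1_A) y)%:E.
Proof. by move=> mA; rewrite /path_transition transition_indic. Qed.

Lemma bm_path_transition n (f : F n.+1 -> R) : bm f ->
  bm (path_transition f).
Proof. exact: bm_transition. Qed.

Lemma markov_path n (f : F n.+1 -> R) : bm f ->
  Ex P (fun w => f (hist X n.+1 w)) = Ex P (fun w => path_transition f (hist X n w)).
Proof.
move=> hf; apply: (rectangle_disintegration (@measurable_hist n) _ _ hf).
  exact: measurable_funPT.
move=> A B mA mB; rewrite (hX.2 n A B mA mB).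
by apply: eq_integral => w _; rewrite /= /kernel_pullback last_coord_hist.
Qed.

Lemma path_space_inhabited n : exists y : F n, True.
Proof.
have [w _] : [set: Omega] !=set0.
  apply/set0P/negP => /eqP O0.
  have := @probability_setT _ _ _ P; rewrite O0 measure0 => /eqP.
  by rewrite eq_sym onee_eq0.
by exists (hist X n w).
Qed.

(** A bound on all ratios of values of [G] becomes a two-sided bound on [G] once one path [y] is
    fixed. *)
Lemma potential_bounds n : (0 < n)%N ->
  exists a b : R, [/\ 0 < a, 0 < b & forall y : F n, a <= G y <= b].
Proof.
move=> n0; have [mG G0 [c hc]] := hG n0.
have [y _] := path_space_inhabited n.
have Gy := G0 y.
have c1 : 1 <= c by rewrite -(divff (lt0r_neq0 Gy)).
have c0 : 0 < c by rewrite (lt_le_trans _ c1).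
exists (G y / c), (c * G y); split; rewrite ?divr_gt0 ?mulr_gt0// => z.
rewrite ler_pdivrMr// [G z * c]mulrC -ler_pdivrMr ?G0// hc/=.
by rewrite -ler_pdivrMr// hc.
Qed.

Lemma bm_potential n : (0 < n)%N -> bm (@G n).
Proof.
move=> n0; have [a [b [a0 b0 ab]]] := potential_bounds n0.
apply: (@bm_intro _ _ _ _ b); first by have [] := hG n0.
move=> y; have /andP[h1 h2] := ab y.
by rewrite ger0_norm// (le_trans _ h1)// ltW.
Qed.

(** The product of the potentials at times [1] to [n - 1] as a function of the path alone, the
    factor at time [0] being set to [1]. It turns [gamma] into the expectation of a function of the
    current path. *)
Fixpoint path_weight n : F n -> R :=
  if n is m.+1 then
    fun y => path_weight y.1 * (if m is 0%N then 1 else G y.1)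
  else fun=> 1.

Lemma path_weightS n (y : F n.+2) :
  path_weight y = path_weight (y.1 : F n.+1) * G (y.1 : F n.+1).
Proof. by []. Qed.

Lemma path_weight_hist n w :
  path_weight (hist X n w) = \prod_(1 <= k < n) G (hist X k w).
Proof.
case: n => [|n]; first by rewrite big_geq.
elim: n => [|n IH]; first by rewrite big_geq//= mulr1.
by rewrite big_nat_recr//= -IH.
Qed.

Lemma bm_path_weight n : bm (@path_weight n).
Proof.
elim: n => [|n IH]; first exact: bm_cst.
rewrite /=; apply: bm_mul.
  by apply: (bm_pre (h := fst)) => //; exact: measurable_fst.
case: n {IH} => [|n]; first exact: bm_cst.
by apply: (bm_pre (h := fst)); [exact: measurable_fst|exact: bm_potential].
Qed.

Lemma path_weight_gt0 n y : 0 < @path_weight n y.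
Proof.
elim: n y => [|n IH] y //=; rewrite mulr_gt0//.
by case: n {IH} y => [|n] y//; have [] := hG (ltn0Sn n).
Qed.

Lemma bm_hist n (f : F n -> R) : bm f ->
  bm (fun w => f (hist X n w)).
Proof. by apply: bm_pre; exact: measurable_hist. Qed.

Lemma bm_hist_weight n (f : F n -> R) : bm f ->
  bm (fun w => f (hist X n w) * path_weight (hist X n w)).
Proof.
by move=> hf; apply: (bm_mul (bm_hist hf)); apply: bm_hist; exact: bm_path_weight.
Qed.

Lemma gammaE n (f : F n -> R) :
  gamma X G n f = Ex P (fun w => f (hist X n w) * path_weight (hist X n w)).
Proof.
rewrite /gamma unlock; congr fine; apply: eq_integral => w _.
by rewrite path_weight_hist.
Qed.

(** The weight of a path at time [n.+1] depends on its past [y.1] only, and so passes through the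
    transition. *)
Lemma gammaS n (f : F n.+1 -> R) : (0 < n)%N -> bm f ->
  gamma X G n.+1 f = gamma X G n (fun y => G y * path_transition f y).
Proof.
case: n f => // n f _ hf; rewrite !gammaE.
have hG1 := bm_potential (ltn0Sn n).
rewrite (markov_path (f := fun y => f y * path_weight y)); last first.
  by apply: bm_mul => //; exact: bm_path_weight.
congr Rintegral; apply/funext => w.
have E1 := transitionZ (path_kernel n.+1)
  (fun y : F n.+1 => path_weight y * G y) (hist X n.+1 w) hf.
transitivity (path_weight (hist X n.+1 w) * G (hist X n.+1 w) *
  path_transition f (hist X n.+1 w)); last by ring.
rewrite -[RHS]E1.
by congr transition; apply/funext => y; rewrite mulrC.
Qed.

Lemma gamma_lin n (a : R) (f g : F n -> R) : bm f ->
  bm g ->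
  gamma X G n (fun y => a * f y + g y) = a * gamma X G n f + gamma X G n g.
Proof.
move=> hf hg; rewrite !gammaE.
rewrite -(ExZ P a (bm_hist_weight hf)).
rewrite -(ExD P (bm_scale a (bm_hist_weight hf)) (bm_hist_weight hg)).
by congr Rintegral; apply/funext => w; rewrite mulrDl mulrA.
Qed.

Lemma gamma_ge0 n (f : F n -> R) : (forall y, 0 <= f y) -> 0 <= gamma X G n f.
Proof.
move=> f0; rewrite gammaE; apply: Ex_ge0 => w; rewrite mulr_ge0//.
exact/ltW/path_weight_gt0.
Qed.

(** The path weight is bounded below by a positive constant, a product of lower bounds of the
    potentials. *)
Lemma gamma1_gt0 n : 0 < gamma X G n (cst 1).
Proof.
have [c c0 hc] : exists2 c, 0 < c & forall y : F n, c <= path_weight y.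
  elim: n => [|n [c c0 hc]]; first by exists 1.
  case: n hc => [|n] hc; first by exists c => // y; have := hc y.1; rewrite /= mulr1.
  have [a [b [a0 b0 ab]]] := potential_bounds (ltn0Sn n).
  exists (c * a); first exact: mulr_gt0.
  move=> y; rewrite path_weightS ler_pM ?(ltW c0) ?(ltW a0)//.
  by have /andP[] := ab y.1.
rewrite (lt_le_trans c0)// gammaE -[leLHS](Ex_cst P c); apply: Ex_le => //.
  exact: (bm_hist_weight (bm_cst 1)).
by move=> w; rewrite mul1r.
Qed.

Lemma gamma1_1 : gamma X G 1 (cst 1) = 1.
Proof.
rewrite gammaE -[RHS](Ex_cst P 1); congr Rintegral.
by apply/funext => w /=; rewrite !mulr1.
Qed.

Lemma eta_lin n (a : R) (f g : F n -> R) : bm f ->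
  bm g ->
  Defs.eta X G n (fun y => a * f y + g y) = a * Defs.eta X G n f + Defs.eta X G n g.
Proof. by move=> hf hg; rewrite /Defs.eta gamma_lin// mulrDl mulrA. Qed.

Lemma eta_cst n (c : R) : Defs.eta X G n (fun=> c) = c.
Proof.
rewrite /Defs.eta.
suff -> : gamma X G n (fun=> c) = c * gamma X G n (cst 1).
  by rewrite mulfK// gt_eqF// gamma1_gt0.
rewrite !gammaE -(ExZ P c (bm_hist_weight (bm_cst 1))).
by congr Rintegral; apply/funext => w; rewrite mul1r.
Qed.

Lemma eta_ge0 n (f : F n -> R) : (forall y, 0 <= f y) -> 0 <= Defs.eta X G n f.
Proof.
by move=> f0; rewrite divr_ge0// ?gamma_ge0// ltW// gamma1_gt0.
Qed.

Lemma etaS n (f : F n.+1 -> R) : (0 < n)%N -> bm f ->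
  Defs.eta X G n.+1 f =
  Defs.eta X G n (fun y => G y * path_transition f y) / Defs.eta X G n (@G n).
Proof.
move=> n0 hf; rewrite /Defs.eta gammaS// (gammaS n0 (bm_cst 1)).
have -> : (fun y : F n => G y * path_transition (cst 1) y) = @G n.
  by apply/funext => y; rewrite /path_transition (transition_cst _ 1) mulr1.
by rewrite invf_div mulrA divfK// gt_eqF// gamma1_gt0.
Qed.

(** The semigroup computed backwards with the kernels. The recursion is an equality of functions,
    valid at every path, as the pointwise decomposition of the particle error requires. *)
Lemma feynman_kac_family n (f : F n -> R) : (0 < n)%N -> bm f ->
  exists g : forall p, F p -> R, [/\ g n = f,
    forall p, (0 < p <= n)%N -> bm (g p) &
    forall p, (0 < p < n)%N -> g p = fun y => G y * path_transition (g p.+1) y].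
Proof.
case: n f => // n f _; elim: n f => [|n IH] f hf.
  (* Values outside the range [1 .. n] are defaults. *)
  exists (@eqtype.dfwith _ (fun p => F p -> R) (fun p _ => 0) 1%N f); split.
  - exact: eqtype.dfwith_in.
    by move=> p; case: p => [|[|p]]//; rewrite eqtype.dfwith_in.
  by move=> p; case: p => [|[|p]].
have [|g [gn hg gS]] := IH (fun y => G y * path_transition f y).
  by apply: bm_mul; [exact: bm_potential|exact: bm_path_transition].
exists (@eqtype.dfwith _ (fun p => F p -> R) g n.+2 f).
split; first exact: eqtype.dfwith_in.
- move=> p /andP[p0]; rewrite leq_eqVlt => /predU1P[->|pn].
    by rewrite eqtype.dfwith_in.
  by rewrite eqtype.dfwith_out ?gtn_eqF//; apply: hg; rewrite p0.
- move=> p /andP[p0]; rewrite ltnS leq_eqVlt => /predU1P[->|pn].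
    by rewrite eqtype.dfwith_in eqtype.dfwith_out ?gtn_eqF// gn.
  rewrite !eqtype.dfwith_out ?gtn_eqF//; last exact: ltnW.
  by rewrite gS// p0.
Qed.

End path_space_chain.

(** * Versions of the semigroup agree under the measures *)

Section feynman_kac_semigroup.
Context {R : realType} {dE : nat -> measure_display}
  {E : forall n, measurableType (dE n)}.
Local Notation F := (path_space E).
Variables (K : forall n, R.-pker E n ~> E n.+1) (x0 : E 0%N).
Context {dO : measure_display} {Omega : measurableType dO}
  {P : probability Omega R} (X : forall n, {RV P >-> E n}).
Hypothesis hX : is_markov_chain K x0 X.
Variables (G : forall n, F n -> R).
Hypothesis hG : is_potential G.
Variables (n : nat) (f : F n -> R) (g : forall p, F p -> R).
Arguments g : clear implicits.
Hypothesis hf : bm f.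
Hypothesis gn : g n = f.
Hypothesis hg : forall p, (0 < p <= n)%N -> bm (g p).
Hypothesis gS : forall p, (0 < p < n)%N ->
  g p = fun y => G y * path_transition K (g p.+1) y.

Let bmG p : (0 < p)%N -> bm (@G p).
Proof. exact: bm_potential. Qed.

(** Induction on [n - p]: the potential at time [p] is absorbed in the test function, and the Markov
    property acts on [g p.+1]. *)
Lemma family_expectation p (psi : F p -> R) : (0 < p <= n)%N ->
  bm psi ->
  Ex P (fun w => psi (hist X p w) * (f (hist X n w) *
    \prod_(p <= k < n) G (hist X k w))) =
  Ex P (fun w => psi (hist X p w) * g p (hist X p w)).
Proof.
move=> /andP[]; have [m] := ubnP (n - p)%N.
elim: m p psi => // m IH p psi pm p0; rewrite leq_eqVlt => /predU1P[pn|pn] hpsi.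
  subst p; congr Rintegral; apply/funext => w.
  by rewrite big_geq// mulr1 gn.
pose psi' (y : F p.+1) := psi (y.1 : F p) * G (y.1 : F p).
have hpsi' : bm psi'.
  have h1 : bm (fun y : F p => psi y * G y).
    by apply: bm_mul => //; exact: bmG.
  by apply: (bm_pre (h := fst : F p.+1 -> F p) _ h1); exact: measurable_fst.
have hg1 : bm (g p.+1) by apply: hg.
have pm1 : (n - p.+1 < m)%N by move: pm pn; lia.
have IHp := IH p.+1 psi' pm1 isT pn hpsi'.
transitivity (Ex P (fun w => psi' (hist X p.+1 w) * (f (hist X n w) *
      \prod_(p.+1 <= k < n) G (hist X k w)))).
  congr Rintegral; apply/funext => w; rewrite (big_ltn pn)/=; rewrite /psi'/=.
    by ring.
  rewrite IHp (markov_path hX (f := fun y => psi' y * g p.+1 y)); last exact: bm_mul.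
  congr Rintegral; apply/funext => w.
have E1 := transitionZ (path_kernel K p)
  (fun y : F p => psi y * G y) (hist X p w) hg1.
have -> : g p (hist X p w) = G (hist X p w) * path_transition K (g p.+1) (hist X p w).
  by rewrite gS// p0.
by rewrite mulrA; exact: E1.
Qed.

Variable Q : forall p n, (F n -> R) -> F p -> R.
Arguments Q : clear implicits.
Hypothesis hQ : is_fk_semigroup X G Q.

Lemma semigroup_bm p : (0 < p <= n)%N -> bm (Q p n f).
Proof.
move=> /andP[p0]; rewrite leq_eqVlt => /predU1P[->|pn].
  by have [->] := hQ hf.
by have [_ /(_ p)] := hQ hf; rewrite p0 pn => /(_ isT)[].
Qed.

(** [Q p n f] and [g p] have equal integrals over every event of the path at time [p]; indicators
    are then replaced by [psi]. *)
Let expectation_semigroup p (psi : F p -> R) : (0 < p <= n)%N ->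
  bm psi ->
  Ex P (fun w => psi (hist X p w) * Q p n f (hist X p w)) =
  Ex P (fun w => psi (hist X p w) * g p (hist X p w)).
Proof.
move=> /andP[p0]; rewrite leq_eqVlt => /predU1P[pn|pn] hpsi.
  by subst p; have [->] := hQ hf; rewrite gn.
have pn' : (0 < p <= n)%N by rewrite p0 ltnW.
have hQp := semigroup_bm pn'; have hgp := hg pn'.
have mh : measurable_fun setT (hist X p) by exact: measurable_hist.
have f1 := bounded_functional_Ex P (bm_hist X hQp) mh.
have f2 := bounded_functional_Ex P (bm_hist X hgp) mh.
under [in LHS]eq_fun do rewrite mulrC.
under [in RHS]eq_fun do rewrite mulrC.
apply: (bounded_functional_eq f1 f2) => // A mA.
have bA : bm (\1_A : F p -> R) by exact: bm_indic.
transitivity (Ex P (fun w => \1_A (hist X p w) * (f (hist X n w) *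
    \prod_(p <= k < n) G (hist X k w)))); last first.
  rewrite family_expectation//.
  by congr Rintegral; apply/funext => w; rewrite mulrC.
have [_ /(_ p)] := hQ hf; rewrite p0 pn => /(_ isT)[_ /(_ A mA) hA].
rewrite /Rintegral; congr fine.
transitivity (\int[P]_(w in hist X p @^-1` A) (Q p n f (hist X p w))%:E)%E.
  rewrite [RHS]integral_mkcond; apply: eq_integral => w _.
  rewrite /patch indicE -[w \in _]/(hist X p w \in A).
  by case: (_ \in A); rewrite ?mulr1 ?mulr0.
rewrite hA [LHS]integral_mkcond; apply: eq_integral => w _.
rewrite /patch indicE -[w \in _]/(hist X p w \in A).
by case: (_ \in A); rewrite ?mul1r ?mul0r.
Qed.

(** The path weight is absorbed in the test function. Covariances under [eta p] therefore do not
    distinguish [Q] from [g]. *)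
Lemma eta_semigroup p (psi : F p -> R) : (0 < p <= n)%N ->
  bm psi ->
  Defs.eta X G p (fun y => psi y * Q p n f y) =
  Defs.eta X G p (fun y => psi y * g p y).
Proof.
move=> pn hpsi; rewrite /Defs.eta !gammaE; congr (_ / _).
have h : bm (fun y : F p => psi y * path_weight G y).
  by apply: bm_mul => //; exact: bm_path_weight.
transitivity (Ex P (fun w => psi (hist X p w) * path_weight G (hist X p w) *
    Q p n f (hist X p w))).
  by congr Rintegral; apply/funext => w; rewrite mulrAC.
rewrite (expectation_semigroup pn h).
by congr Rintegral; apply/funext => w; rewrite mulrAC.
Qed.

End feynman_kac_semigroup.

(** * Conditionally independent particles *)

Section exponential_inequalities.
Context {R : realType}.
Implicit Types x : R.

(** [le_MVT] applied twice, the first-order bound on [expR] serving as bound on the derivative of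
    [expR z - z]. *)
Lemma expR_le_quadratic x : expR x <= 1 + x + x ^+ 2 * expR `|x|.
Proof.
have e1 (z : R) : `|expR z - 1| <= `|z| * expR `|z|.
  have := @le_MVT _ expR expR expR z.
  rewrite expR0 mulrC; apply=> // [y yz|a b _]; last by rewrite ler_expR.
  by rewrite ger0_norm ?expR_ge0// ler_expR ler_norm.
have := @le_MVT _ (fun z => expR z - z) (fun z => expR z - 1)
  (fun z => z * expR z) x _ _ _.
rewrite expR0 subr0 => h.
have : `|expR x - x - 1| <= `|x| * expR `|x| * `|x|.
  apply: h => [z _|a b a0 ab]; first exact: e1.
  by rewrite ler_pM ?expR_ge0// ler_expR.
rewrite mulrAC -expr2 real_normK ?num_real//.
by move=> /ler_normlP[_]; lra.
Qed.

(** A single term of the exponential series bounds an even power, at [x] or at [- x] according to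
    the sign. *)
Lemma expr_le_exp (k : nat) x : x ^+ k.*2 <= (k.*2)`!%:R * (expR x + expR (- x)).
Proof.
have e0 := expR_ge0 x; have e0' := expR_ge0 (- x).
case: k => [|k].
  by rewrite expr0 fact0 mul1r; have := expR_ge1Dx x; have := expR_ge1Dx (- x); lra.
have f0 : 0 < (k.+1.*2)`!%:R :> R by rewrite ltr0n fact_gt0.
rewrite -ler_pdivrMl//.
have h (y : R) : 0 <= y -> (k.+1.*2)`!%:R^-1 * y ^+ k.+1.*2 <= expR y.
  by move=> y0; have := expR_ge1Dxn (k.*2.+1) y0; rewrite doubleS mulrC; lra.
have [x0|x0] := leP 0 x; first by have := h _ x0; lra.
have x0' : 0 <= - x by lra.
have := h _ x0'; rewrite -[X in _ * X <= _](_ : x ^+ k.+1.*2 = _); first by lra.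
by rewrite -mul2n !exprM sqrrN.
Qed.

End exponential_inequalities.

(** * Positive normalised functionals and their variance *)

Section mean_functional.
Context {R : realType} {d} {Y : measurableType d}.

(** The algebraic content of an expectation. It is shared by [eta], by the empirical mean and by the
    conditional law of a particle, which are thus estimated together. *)
Definition mean_functional (L : (Y -> R) -> R) :=
  [/\ forall (a : R) f g, bm f -> bm g ->
        L (fun y => a * f y + g y) = a * L f + L g,
      forall c, L (fun=> c) = c &
      forall f, bm f -> (forall y, 0 <= f y) -> 0 <= L f].

Variables (L : (Y -> R) -> R) (hL : mean_functional L).

Lemma mean_scale (a : R) f : bm f -> L (fun y => a * f y) = a * L f.
Proof.
move=> hf; have [lin cst _] := hL.
have := lin a f (fun=> 0) hf (bm_cst 0); rewrite cst addr0 => <-.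
by congr L; apply/funext => y; rewrite addr0.
Qed.

Lemma mean_add f g : bm f -> bm g ->
  L (fun y => f y + g y) = L f + L g.
Proof.
move=> hf hg; have [lin _ _] := hL.
have := lin 1 f g hf hg; rewrite mul1r => <-.
by congr L; apply/funext => y; rewrite mul1r.
Qed.

Lemma mean_le f g : bm f -> bm g ->
  (forall y, f y <= g y) -> L f <= L g.
Proof.
move=> hf hg fg; have [lin _ pos] := hL.
have := pos (fun y => -1 * f y + g y) (bm_add (bm_scale (-1) hf) hg).
rewrite lin// mulN1r addrC subr_ge0; apply => y.
by rewrite mulN1r addrC subr_ge0.
Qed.

Lemma mean_bound f M : bm f -> (forall y, `|f y| <= M) ->
  `|L f| <= M.
Proof.
move=> hf fM; have [_ cst _] := hL; rewrite ler_norml; apply/andP; split.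
  rewrite -(cst (- M)); apply: mean_le => // y.
  by have := fM y; rewrite ler_norml => /andP[].
rewrite -(cst M); apply: mean_le => // y.
by have := fM y; rewrite ler_norml => /andP[].
Qed.

Definition variance_of f := L (fun y => f y ^+ 2) - L f ^+ 2.

Lemma variance_of_center f : bm f ->
  L (fun y => (f y - L f) ^+ 2) = variance_of f.
Proof.
move=> hf; have [lin cst _] := hL.
have -> : (fun y => (f y - L f) ^+ 2) =
    (fun y => f y ^+ 2 + (- (2 * L f) * f y + L f ^+ 2)).
  by apply/funext => y; ring.
have h2 : bm (fun y => - (2 * L f) * f y) by exact: bm_scale.
rewrite mean_add; [|exact: bm_exp|exact: bm_add].
by rewrite lin// cst /variance_of; ring.
Qed.

Lemma variance_of_ge0 f : bm f -> 0 <= variance_of f.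
Proof.
move=> hf; rewrite -variance_of_center//; have [_ _ pos] := hL.
apply: pos => [|y]; last exact: sqr_ge0.
by apply: bm_exp; exact: bm_sub.
Qed.

Lemma variance_of_le f c : bm f -> (forall y, `|f y| <= c) ->
  variance_of f <= c ^+ 2.
Proof.
move=> hf fc; have [_ cst _] := hL.
have h : L (fun y => f y ^+ 2) <= c ^+ 2.
  rewrite -[leRHS]cst; apply: mean_le => //; first exact: bm_exp.
  move=> y; rewrite -real_normK ?num_real// lerXn2r ?nnegrE//.
  by rewrite (le_trans _ (fc y)).
by rewrite /variance_of lerBlDr (le_trans h)// lerDl sqr_ge0.
Qed.

End mean_functional.

(** * Central limit estimate and moments given the past *)

Section conditionally_iid.
Context {R : realType} {d d' dY} {T : measurableType d} {T' : measurableType d'}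
  {Y : measurableType dY}.
Variables (P : probability T R) (pr : T -> T') (N : nat) (xi : 'I_N -> T -> Y)
  (m : (Y -> R) -> T' -> R).
Hypotheses (N0 : (0 < N)%N) (mpr : measurable_fun setT pr)
  (mxi : forall i, measurable_fun setT (xi i))
  (bm_m : forall u, bm u -> bm (m u))
  (mean_m : forall z, mean_functional (m ^~ z)).
Hypothesis rule : forall (psi : T' -> R) (u : 'I_N -> Y -> R),
  bm psi -> (forall i, bm (u i)) ->
  Ex P (fun w => psi (pr w) * \prod_i u i (xi i w)) =
  Ex P (fun w => psi (pr w) * \prod_i m (u i) (pr w)).

Let s : R := (Num.sqrt N%:R)^-1.

Let N0' : 0 < N%:R :> R. Proof. by rewrite ltr0n. Qed.

Let s_gt0 : 0 < s. Proof. by rewrite invr_gt0 sqrtr_gt0. Qed.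

Let s2 : N%:R * s ^+ 2 = 1.
Proof. by rewrite exprVn sqr_sqrtr ?(ltW N0')// divff// gt_eqF. Qed.

Let s_le1 : s <= 1.
Proof.
by rewrite /s invf_le1 ?sqrtr_gt0// -[leLHS]sqrtr1 ler_wsqrtr// ler1n.
Qed.

Definition fluctuation (g : Y -> R) w := s * \sum_i (g (xi i w) - m g (pr w)).

Let bm_xi (u : Y -> R) i : bm u ->
  bm (fun w => u (xi i w)).
Proof. exact: bm_pre. Qed.

Let bm_pr (psi : T' -> R) : bm psi ->
  bm (fun w => psi (pr w)).
Proof. exact: bm_pre. Qed.

Lemma bm_fluctuation g : bm g -> bm (fluctuation g).
Proof.
move=> hg; apply: bm_scale; apply: bm_sum => i _; apply: bm_sub; first exact: bm_xi.
by apply: bm_pr; exact: bm_m.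
Qed.

(* [Psi] depends on the past and on the particles of index below [j] only, as
   far as expectations of products are concerned. *)
Let adapted (j : nat) (Psi : T -> R) := bm Psi /\
  forall (phi : T' -> R) (u : 'I_N -> Y -> R),
  bm phi -> (forall i, bm (u i)) ->
  Ex P (fun w => phi (pr w) * Psi w * \prod_(i < N | (j <= i)%N) u i (xi i w)) =
  Ex P (fun w => phi (pr w) * Psi w * \prod_(i < N | (j <= i)%N) m (u i) (pr w)).

Let adapted0 psi : bm psi -> adapted 0 (fun w => psi (pr w)).
Proof.
move=> hpsi; split; first exact: bm_pr.
move=> phi u hphi hu.
have -> := rule (psi := fun z => phi z * psi z) (u := u) (bm_mul hphi hpsi) hu.
by [].
Qed.

Let bm_adapted_prod j (Psi : T -> R) (phi : T' -> R) (u : 'I_N -> Y -> R) :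
  bm Psi ->
  bm phi -> (forall i, bm (u i)) ->
  bm (fun w => phi (pr w) * Psi w *
     \prod_(i < N | (j <= i)%N) u i (xi i w)) /\
  bm (fun w => phi (pr w) * Psi w *
     \prod_(i < N | (j <= i)%N) m (u i) (pr w)).
Proof.
move=> hPsi hphi hu; have h : bm (fun w => phi (pr w) * Psi w).
  by apply: bm_mul => //; exact: bm_pr.
split; apply: (bm_mul h); apply: bm_prod => i _; first exact: bm_xi.
by apply: bm_pr; exact: bm_m.
Qed.

Let adapted_sub j Psi1 Psi2 : adapted j Psi1 -> adapted j Psi2 ->
  adapted j (fun w => Psi1 w - Psi2 w).
Proof.
move=> [b1 h1] [b2 h2]; split; first exact: bm_sub.
move=> phi u hphi hu.
have [c1 e1] := bm_adapted_prod j b1 hphi hu.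
have [c2 e2] := bm_adapted_prod j b2 hphi hu.
have := h1 phi u hphi hu; have := h2 phi u hphi hu.
move=> E2 E1; have : _ - _ = _ - _ := congr2 (fun x y => x - y) E1 E2.
rewrite -(ExB P c1 c2) -(ExB P e1 e2) => E.
transitivity (Ex P (fun w => phi (pr w) * Psi1 w * \prod_(i < N | (j <= i)%N) u i (xi i w) -
  phi (pr w) * Psi2 w * \prod_(i < N | (j <= i)%N) u i (xi i w))).
  by congr Rintegral; apply/funext => w; rewrite mulrBr mulrBl.
by rewrite E; congr Rintegral; apply/funext => w; rewrite mulrBr mulrBl.
Qed.

Let splitP (j : 'I_N) (a : 'I_N -> R) : \prod_(i < N | (j <= i)%N) a i =
  a j * \prod_(i < N | (j.+1 <= i)%N) a i.
Proof.
rewrite (bigD1 j)//=; congr (_ * _); apply: eq_bigl => i.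
by rewrite ltn_neqAle andbC eq_sym.
Qed.

(** The other particles get the constant function [1], whose conditional mean is [1]. In effect
    [m v] is the conditional expectation of [v] at particle [j], even after weighting by [Psi]. *)
Lemma adapted_step (j : 'I_N) Psi (v : Y -> R) (phi : T' -> R) : adapted j Psi ->
  bm v -> bm phi ->
  Ex P (fun w => phi (pr w) * Psi w * v (xi j w)) =
  Ex P (fun w => phi (pr w) * Psi w * m v (pr w)).
Proof.
move=> [bPsi hPsi] hv hphi.
pose u i : Y -> R := if i == j then v else fun=> 1.
have hu i : bm (u i) by rewrite /u; case: eqP.
have := hPsi phi u hphi hu.
have -> : (fun w => phi (pr w) * Psi w * \prod_(i < N | (j <= i)%N) u i (xi i w)) =
    (fun w => phi (pr w) * Psi w * v (xi j w)).
  apply/funext => w; congr (_ * _); rewrite splitP /u eqxx big1 ?mulr1// => i ji.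
  by rewrite ifF//; apply/negbTE; rewrite -val_eqE neq_ltn ji orbT.
move=> ->; congr Rintegral; apply/funext => w; congr (_ * _).
rewrite splitP /u eqxx big1 ?mulr1// => i ji.
rewrite ifF; last by apply/negbTE; rewrite -val_eqE neq_ltn ji orbT.
by have [_ ->] := mean_m (pr w).
Qed.

(** Particle [j] receives [v], and the conditional means of the later particles join [phi], so that
    [adapted_step] applies. *)
Let adaptedS (j : 'I_N) Psi (v : Y -> R) : adapted j Psi -> bm v ->
  adapted j.+1 (fun w => Psi w * v (xi j w)).
Proof.
move=> aPsi hv; have [bPsi hPsi] := aPsi; split.
  by apply: bm_mul => //; exact: bm_xi.
move=> phi u hphi hu.
pose u' i : Y -> R := if i == j then v else u i.
have hu' i : bm (u' i) by rewrite /u'; case: eqP.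
have ji (i : 'I_N) : (j < i)%N -> (i == j) = false.
  by move=> ji; apply/negbTE; rewrite -val_eqE neq_ltn ji orbT.
have hphi' : bm
    (fun z => phi z * \prod_(i < N | (j < i)%N) m (u i) z).
  by apply: bm_mul => //; apply: bm_prod => i _; exact: bm_m.
transitivity (Ex P (fun w => phi (pr w) * Psi w *
    \prod_(i < N | (j <= i)%N) u' i (xi i w))).
  congr Rintegral; apply/funext => w; rewrite splitP /u' eqxx !mulrA; congr (_ * _).
  by apply: eq_bigr => i /ji ->.
rewrite (hPsi phi u' hphi hu').
transitivity (Ex P (fun w => phi (pr w) * \prod_(i < N | (j < i)%N) m (u i) (pr w) *
    Psi w * m v (pr w))).
  congr Rintegral; apply/funext => w; rewrite splitP /u' eqxx.
  rewrite (eq_bigr (fun i => m (u i) (pr w))); last by move=> i /ji ->.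
  by ring.
rewrite -(adapted_step aPsi hv hphi').
by congr Rintegral; apply/funext => w; ring.
Qed.

Let below (g : Y -> R) j w := s * \sum_(i < N | (i < j)%N) g (xi i w).

Let belowS g (j : 'I_N) w : below g j.+1 w = below g j w + s * g (xi j w).
Proof.
rewrite /below (bigD1 j)//= mulrDr addrC; congr (s * _ + _); apply: eq_bigl => i.
by rewrite ltnS [RHS]ltn_neqAle andbC.
Qed.

Let measurable_below g j : bm g -> measurable_fun setT (below g j).
Proof.
move=> hg; apply: bm_meas; apply: bm_scale; apply: bm_sum => i _; exact: bm_xi.
Qed.

(** The addition formula separates the next particle from the previous ones; the sine that appears
    is a cosine with [a] shifted by [pi / 2], so the induction is over all phases [a]. *)
Lemma adapted_cos g j (a : T' -> R) : (j <= N)%N -> bm g ->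
  measurable_fun setT a -> adapted j (fun w => cos (a (pr w) + below g j w)).
Proof.
move=> jN hg; elim: j jN a => [_|j IH jN] a ma.
  have -> : (fun w => cos (a (pr w) + below g 0 w)) = (fun w => cos (a (pr w))).
    by apply/funext => w; rewrite /below big1 ?mulr0 ?addr0.
  by apply: (adapted0 (psi := fun z => cos (a z))); exact: bm_cos.
have mg : measurable_fun setT (fun y => s * g y) by apply: bm_meas; exact: bm_scale.
have h1 := adaptedS (j := Ordinal jN) (IH (ltnW jN) a ma) (bm_cos mg).
have ma' : measurable_fun setT (fun z => a z - pi / 2) by exact: measurable_funB.
have h2 := adaptedS (j := Ordinal jN) (IH (ltnW jN) _ ma') (bm_sin mg).
have := adapted_sub h1 h2; congr adapted; apply/funext => w.
rewrite (belowS g (Ordinal jN)) addrA [RHS]cosD/=.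
by rewrite (addrAC (a (pr w)) (- _)) cosBpihalf.
Qed.

Let variance (g : Y -> R) z := variance_of (m ^~ z) g.

Let bm_variance g : bm g -> bm (variance g).
Proof.
move=> hg; apply: bm_sub; first by apply: bm_m; exact: bm_exp.
by apply: bm_exp; exact: bm_m.
Qed.

Let fluctuationE g w : fluctuation g w = below g N w - s * N%:R * m g (pr w).
Proof.
rewrite /fluctuation /below sumrB sumr_const card_ord mulrBr.
rewrite -[m g (pr w) *+ N]mulr_natl mulrA.
by congr (s * _ - _); apply: eq_bigl => i; rewrite ltn_ord.
Qed.

(* Replacing one particle at a time: conditionally on the previous ones, the
   first two moments of the increment are those of its Gaussian counterpart. *)
Let lindeberg_step g c (psi a : T' -> R) M (j : 'I_N) :
  bm g -> (forall y, `|g y| <= c) ->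
  bm psi -> (forall z, `|psi z| <= M) -> measurable_fun setT a ->
  `|Ex P (fun w => psi (pr w) * (cos (a (pr w) + below g j w +
       s * (g (xi j w) - m g (pr w))))) -
    Ex P (fun w => psi (pr w) * (expR (- (variance g (pr w) / 2 / N%:R)) *
       cos (a (pr w) + below g j w)))| <= M * (4 * c ^+ 3 + 3 * c ^+ 4) * s ^+ 3.
Proof.
move=> hg gc hpsi psiM ma.
have jN : (j <= N)%N by rewrite ltnW.
have [w0 _] : [set: T] !=set0.
  apply/set0P/negP => /eqP O0.
  have := @probability_setT _ _ _ P; rewrite O0 measure0 => /eqP.
  by rewrite eq_sym onee_eq0.
have M0 : 0 <= M by exact: le_trans (psiM (pr w0)).
have c0 : 0 <= c by exact: le_trans (gc (xi j w0)).
pose b w := a (pr w) + below g j w.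
have mb : measurable_fun setT b.
  by apply: measurable_funD; [exact: measurableT_comp|exact: measurable_below].
have ac : adapted j (fun w => cos (b w)) by exact: adapted_cos.
have as' : adapted j (fun w => sin (b w)).
  have ma' : measurable_fun setT (fun z => a z - pi / 2) by exact: measurable_funB.
  have := adapted_cos jN hg ma'; congr adapted; apply/funext => w.
  by rewrite (addrAC (a (pr w)) (- _)) cosBpihalf.
have bcos : bm (fun w => cos (b w)) by exact: bm_cos.
have bsin : bm (fun w => sin (b w)) by exact: bm_sin.
have hmg : bm (m g) by exact: bm_m.
have hg2 : bm (fun y => g y ^+ 2) by exact: bm_exp.
pose y w := g (xi j w) - m g (pr w).
have by' : bm y by apply: bm_sub; [exact: bm_xi|exact: bm_pr].
have bpsi : bm (fun w => psi (pr w)) by exact: bm_pr.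
have bvar : bm (fun w => variance g (pr w)).
  by apply: bm_pr; exact: bm_variance.
(* First-order term: the increment is conditionally centered. *)
have E1 : Ex P (fun w => psi (pr w) * sin (b w) * y w) = 0.
  transitivity (Ex P (fun w => psi (pr w) * sin (b w) * g (xi j w)) -
      Ex P (fun w => psi (pr w) * sin (b w) * m g (pr w))).
    rewrite -ExB; last 2 first.
    - by apply: bm_mul; [exact: bm_mul|exact: bm_xi].
    - by apply: bm_mul; [exact: bm_mul|exact: bm_pr].
    by congr Rintegral; apply/funext => w; rewrite mulrBr.
  by rewrite (adapted_step as' hg hpsi) subrr.
(* Second-order term: the conditional variance of the increment matches [variance g]. *)
have E2 : Ex P (fun w => psi (pr w) * cos (b w) * (y w ^+ 2 - variance g (pr w))) = 0.
  transitivity (Ex P (fun w => psi (pr w) * cos (b w) * g (xi j w) ^+ 2) -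
      Ex P (fun w => psi (pr w) * cos (b w) * m (fun y => g y ^+ 2) (pr w)) -
      2 * (Ex P (fun w => psi (pr w) * m g (pr w) * cos (b w) * g (xi j w)) -
       Ex P (fun w => psi (pr w) * m g (pr w) * cos (b w) * m g (pr w)))).
    have k1 : bm (fun w => psi (pr w) * cos (b w) * g (xi j w) ^+ 2).
      by apply: bm_mul; [exact: bm_mul|exact: (bm_xi j hg2)].
    have k2 : bm (fun w => psi (pr w) * cos (b w) * m (fun y => g y ^+ 2) (pr w)).
      by apply: bm_mul; [exact: bm_mul|apply: bm_pr; exact: bm_m].
    have k3 : bm (fun w => psi (pr w) * m g (pr w) * cos (b w) * g (xi j w)).
      by apply: bm_mul; [apply: bm_mul => //; apply: bm_mul => //; exact: bm_pr|exact: bm_xi].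
    have k4 : bm (fun w => psi (pr w) * m g (pr w) * cos (b w) * m g (pr w)).
      by apply: bm_mul; [apply: bm_mul => //; apply: bm_mul => //; exact: bm_pr|exact: bm_pr].
    rewrite -(ExB P k1 k2) -(ExB P k3 k4) -(ExZ P 2 (bm_sub k3 k4)).
    rewrite -(ExB P (bm_sub k1 k2) (bm_scale 2 (bm_sub k3 k4))).
    by congr Rintegral; apply/funext => w; rewrite /y /variance /variance_of; ring.
  rewrite (adapted_step ac hg2 hpsi) subrr sub0r.
  have hpm : bm (fun z => psi z * m g z) by exact: bm_mul.
  by rewrite (adapted_step ac hg hpm) subrr mulr0 oppr0.
(* What remains of the difference once the two vanishing terms are removed: Taylor remainders of
   [cos], [sin] and [expR], of order [s ^ 3] or smaller. *)
pose r w := cos (b w) * (cos (s * y w) - 1 + (s * y w) ^+ 2 / 2)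
  - sin (b w) * (sin (s * y w) - s * y w)
  - cos (b w) * (expR (- (variance g (pr w) / 2 / N%:R)) - 1 +
      variance g (pr w) / 2 / N%:R).
have sN : s ^+ 2 = N%:R^-1 by rewrite -[LHS](mulKf (lt0r_neq0 N0')) s2 mulr1.
have expE w : psi (pr w) * cos (a (pr w) + below g j w + s * (g (xi j w) - m g (pr w))) -
    psi (pr w) * (expR (- (variance g (pr w) / 2 / N%:R)) * cos (a (pr w) + below g j w)) =
    psi (pr w) * r w - s ^+ 2 / 2 * (psi (pr w) * cos (b w) * (y w ^+ 2 - variance g (pr w)))
     - s * (psi (pr w) * sin (b w) * y w).
  rewrite -/(b w) -/(y w) cosD /r -sN; ring.
have mexp : bm (fun w => expR (- (variance g (pr w) / 2 / N%:R))).
  apply: bm_expR; apply: bm_opp; under eq_fun do rewrite -mulrA mulrC.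
  exact: bm_scale.
have msy : measurable_fun setT (fun w => s * y w) by apply: bm_meas; exact: bm_scale.
have br : bm r.
  apply: bm_sub; [apply: bm_sub|]; apply: bm_mul => //.
  - apply: bm_add; first by apply: bm_sub => //; exact: bm_cos.
    under eq_fun do rewrite mulrC.
    by apply: bm_scale; apply: bm_exp; exact: bm_scale.
  - by apply: bm_sub; [exact: bm_sin|exact: bm_scale].
  - apply: bm_add; first exact: bm_sub.
    under eq_fun do rewrite -mulrA mulrC.
    exact: bm_scale.
have bpr : bm (fun w => psi (pr w) * r w) by exact: bm_mul.
have bE1 : bm (fun w => psi (pr w) * sin (b w) * y w).
  by apply: bm_mul => //; exact: bm_mul.
have bE2 : bm
    (fun w => psi (pr w) * cos (b w) * (y w ^+ 2 - variance g (pr w))).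
  by apply: bm_mul; [exact: bm_mul|apply: bm_sub => //; exact: bm_exp].
rewrite -ExB; last 2 first.
- apply: bm_mul => //; apply: bm_cos; apply: measurable_funD => //.
- by apply: bm_mul => //; exact: bm_mul.
have -> : Ex P (fun w => psi (pr w) * cos (a (pr w) + below g j w + s * (g (xi j w) - m g (pr w))) -
    psi (pr w) * (expR (- (variance g (pr w) / 2 / N%:R)) * cos (a (pr w) + below g j w))) =
    Ex P (fun w => psi (pr w) * r w).
  under [in LHS]eq_fun do rewrite expE.
  rewrite ExB; [|by apply: bm_sub => //; exact: bm_scale|exact: bm_scale].
  by rewrite ExB ?ExZ ?E1 ?E2 ?mulr0 ?subr0//; exact: bm_scale.
apply: Ex_bound => // w; rewrite normrM -mulrA ler_pM//.
have yc : `|y w| <= 2 * c.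
  rewrite (le_trans (ler_normB _ _))// mulr2n mulrDl mul1r lerD//.
  exact: (mean_bound (mean_m (pr w)) hg gc).
have v0 : 0 <= variance g (pr w) by exact: variance_of_ge0.
have vc : variance g (pr w) <= c ^+ 2 by exact: (variance_of_le (mean_m (pr w)) hg gc).
have syc : `|s * y w| <= 2 * c * s.
  by rewrite normrM gtr0_norm// mulrC ler_wpM2r// ltW.
have cs0 : 0 <= 2 * c * s by rewrite mulr_ge0 ?mulr_ge0// ltW.
have t1 : `|cos (s * y w) - 1 + (s * y w) ^+ 2 / 2| <= (2 * c * s) ^+ 4 / 8.
  rewrite (le_trans (cos_taylor _))// ler_wpM2r// lerXn2r ?nnegrE//.
have t2 : `|sin (s * y w) - s * y w| <= (2 * c * s) ^+ 3 / 2.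
  rewrite (le_trans (sin_taylor _))// ler_wpM2r// lerXn2r ?nnegrE//.
set x := variance g (pr w) / 2 / N%:R in v0 *.
have xE : x = variance g (pr w) * s ^+ 2 / 2 by rewrite /x -sN; ring.
have x0 : 0 <= x by rewrite xE mulr_ge0// mulr_ge0// sqr_ge0.
have xc : x <= c ^+ 2 * s ^+ 2 / 2 by rewrite xE ler_wpM2r// ler_wpM2r ?sqr_ge0.
have t3 : `|expR (- x) - 1 + x| <= (c ^+ 2 * s ^+ 2 / 2) ^+ 2.
  have /andP[h1 h2] := expRN_taylor x0.
  rewrite ger0_norm; last by lra.
  apply: (@le_trans _ _ (x ^+ 2)); first by lra.
  by rewrite lerXn2r ?nnegrE// (le_trans x0).
have cb := norm_cos_le1 (b w); have sb := norm_sin_le1 (b w).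
have r1 := ler_pM (normr_ge0 _) (normr_ge0 _) cb t1.
have r2 := ler_pM (normr_ge0 _) (normr_ge0 _) sb t2.
have r3 := ler_pM (normr_ge0 _) (normr_ge0 _) cb t3.
rewrite -normrM in r1; rewrite -normrM in r2; rewrite -normrM in r3.
rewrite /r (le_trans (ler_normB _ _))// (le_trans (lerD (ler_normB _ _) r3))//.
rewrite (le_trans (lerD (lerD r1 r2) (lexx _)))// !mul1r.
have s43 : s ^+ 4 <= s ^+ 3 by rewrite (exprS s 3) ler_piMl ?exprn_ge0 ?(ltW s_gt0).
have c4 : 0 <= c ^+ 4 by rewrite exprn_ge0.
have := ler_wpM2l c4 s43.
(* The fourth-order terms have total coefficient [9 / 4], rounded up to [3]; [s <= 1] bounds [s ^ 4]
   by [s ^ 3]. *)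
rewrite (_ : (2 * c * s) ^+ 4 / 8 + (2 * c * s) ^+ 3 / 2 + (c ^+ 2 * s ^+ 2 / 2) ^+ 2 =
  9 / 4 * (c ^+ 4 * s ^+ 4) + 4 * (c ^+ 3 * s ^+ 3)); last by field.
rewrite (_ : (4 * c ^+ 3 + 3 * c ^+ 4) * s ^+ 3 =
  3 * (c ^+ 4 * s ^+ 3) + 4 * (c ^+ 3 * s ^+ 3)); last by ring.
have : 0 <= c ^+ 4 * s ^+ 3 by rewrite mulr_ge0// exprn_ge0// ltW.
by lra.
Qed.

(** [N] replacements, each with an error of order [s ^ 3 = N ^ (-3/2)], leave an error of order
    [N ^ (-1/2)]. The Gaussian variance is conditional, hence still a function of the past. *)
Lemma conditional_lindeberg g c (psi a : T' -> R) M :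
  bm g -> (forall y, `|g y| <= c) ->
  bm psi -> (forall z, `|psi z| <= M) -> measurable_fun setT a ->
  `|Ex P (fun w => psi (pr w) * cos (a (pr w) + fluctuation g w)) -
    Ex P (fun w => psi (pr w) * (cos (a (pr w)) *
      expR (- (variance_of (m ^~ (pr w)) g / 2))))| <=
  M * (4 * c ^+ 3 + 3 * c ^+ 4) / Num.sqrt N%:R.
Proof.
move=> hg gc hpsi psiM ma.
have hmg : bm (m g) by exact: bm_m.
pose x z := variance g z / 2 / N%:R.
have bx : bm x.
  by rewrite /x; under eq_fun do rewrite -mulrA mulrC; apply: bm_scale; exact: bm_variance.
have x0 z : 0 <= x z by rewrite divr_ge0 ?divr_ge0 ?(ltW N0')// variance_of_ge0.
(* The centering of the first [j] particles depends on the past only and is carried by the phase. *)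
pose al (j : nat) z := a z - s * j%:R * m g z.
have mal j : measurable_fun setT (al j).
  by apply: measurable_funB => //; apply: bm_meas; exact: bm_scale.
(* Interpolation: the first [j] particles are present, the other [N - j] are replaced by their
   Gaussian damping factors. *)
pose D j := Ex P (fun w => psi (pr w) * expR (- x (pr w)) ^+ (N - j) *
  cos (al j (pr w) + below g j w)).
have step j : (j < N)%N -> `|D j.+1 - D j| <= M * (4 * c ^+ 3 + 3 * c ^+ 4) * s ^+ 3.
  (* The damping factors of the particles not yet introduced are functions of the past bounded by
     [1], so they join [psi]. *)
  move=> jN; pose psi' z := psi z * expR (- x z) ^+ (N - j.+1).
  have bpsi' : bm psi'.
    by apply: bm_mul => //; apply: bm_exp; apply: bm_expR; exact: bm_opp.
  have psiM' z : `|psi' z| <= M.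
    rewrite normrM (le_trans _ (psiM z))// ler_piMr// ger0_norm ?exprn_ge0 ?expR_ge0//.
    by rewrite exprn_ile1 ?expR_ge0// -expR0 ler_expR oppr_le0.
  have := lindeberg_step (Ordinal jN) hg gc bpsi' psiM' (mal j).
  congr (`|_ - _| <= _); congr Rintegral; apply/funext => w.
    rewrite /psi' (belowS g (Ordinal jN))/=; congr (_ * cos _).
    by rewrite /al -natr1; ring.
  by rewrite /psi' /= -(subnSK jN) exprS /x; ring.
have main j : (j <= N)%N -> `|D j - D 0%N| <= M * (4 * c ^+ 3 + 3 * c ^+ 4) * s ^+ 3 * j%:R.
  elim: j => [|j IH] jN; first by rewrite subrr normr0 mulr0.
  rewrite (_ : D j.+1 - D 0%N = (D j.+1 - D j) + (D j - D 0%N)); last by ring.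
  rewrite (le_trans (ler_normD _ _))//.
  set C := M * _ * _; rewrite (_ : C * j.+1%:R = C + C * j%:R); last first.
    by rewrite -natr1; ring.
  by rewrite lerD ?step//; exact: IH (ltnW jN).
have := main N (leqnn N).
have -> : M * (4 * c ^+ 3 + 3 * c ^+ 4) * s ^+ 3 * N%:R =
    M * (4 * c ^+ 3 + 3 * c ^+ 4) / Num.sqrt N%:R.
  by rewrite -/s -[RHS]mulr1 -[X in _ = _ * X]s2; ring.
congr (`|_ - _| <= _); congr Rintegral; apply/funext => w.
  rewrite subnn expr0 mulr1 /al fluctuationE; congr (_ * cos _); ring.
rewrite subn0 -expRM_natl /al /below mulr0 mul0r subr0 big1 ?mulr0 ?addr0// -mulrA.
congr (_ * _); rewrite mulrC; congr (_ * expR _).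
by rewrite mulrN /x /variance; congr (- _); field; rewrite gt_eqF.
Qed.

(** Conditional independence turns the exponential moment into an [N]-th power. Each centered factor
    is at most [1 + K / N <= expR (K / N)] by [expR_le_quadratic], the linear term having mean
    zero. *)
Lemma conditional_exp_moment g c : bm g -> (forall y, `|g y| <= c) ->
  Ex P (fun w => expR (fluctuation g w)) <= expR ((2 * c) ^+ 2 * expR (2 * c)).
Proof.
move=> hg gc.
have hmg : bm (m g) by exact: bm_m.
pose psi z := expR (- (s * N%:R) * m g z).
have bpsi : bm psi by apply: bm_expR; exact: bm_scale.
pose u (y : Y) := expR (s * g y).
have bu : bm u by apply: bm_expR; exact: bm_scale.
have E w : expR (fluctuation g w) = psi (pr w) * \prod_i u (xi i w).
  rewrite fluctuationE -expR_sum -expRD; congr expR.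
  rewrite /below mulr_sumr addrC mulNr; congr (_ + _).
  by apply: eq_bigl => i; rewrite ltn_ord.
under eq_fun do rewrite E.
rewrite (rule (u := fun=> u) bpsi (fun=> bu)); set K := (2 * c) ^+ 2 * expR (2 * c).
rewrite -[leRHS](Ex_cst P); apply: Ex_le => //.
  apply: bm_mul; first exact: bm_pr.
  by apply: bm_prod => i _; apply: bm_pr; exact: bm_m.
move=> w; rewrite prodr_const card_ord; set mu := m g (pr w).
have -> : psi (pr w) = expR (- s * mu) ^+ N.
  by rewrite -expRM_natl; congr expR; rewrite -/mu; ring.
rewrite -exprMn.
have -> : expR K = expR (K / N%:R) ^+ N.
  by rewrite -expRM_natl mulrCA divff ?mulr1// gt_eqF.
have c0 : 0 <= c by exact: le_trans (gc (xi (Ordinal N0) w)).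
have L0 := mean_m (pr w).
have mu0 : 0 <= m u (pr w).
  by have [_ _ pos] := L0; apply: pos => // y; exact: expR_ge0.
rewrite lerXn2r ?nnegrE ?expR_ge0 ?mulr_ge0 ?expR_ge0//.
rewrite -(mean_scale L0 _ bu).
have bx : bm (fun y => s * (g y - mu)).
  by apply: bm_scale; exact: bm_sub.
apply: (@le_trans _ _ (1 + K / N%:R)); last exact: expR_ge1Dx.
have <- : m (fun y => (1 + s * (g y - mu)) + K / N%:R) (pr w) = 1 + K / N%:R.
  rewrite (mean_add L0) ?(mean_add L0)//; last exact: bm_add.
  rewrite (mean_scale L0); last exact: bm_sub.
  have [_ cst _] := L0; rewrite !cst.
  have := mean_add L0 hg (bm_cst (- mu)); rewrite cst => ->.
  by rewrite subrr mulr0 addr0.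
apply: (mean_le L0).
- by apply: bm_scale.
- by apply: bm_add => //; exact: bm_add.
move=> y; rewrite /u -expRD.
have -> : - s * mu + s * g y = s * (g y - mu) by ring.
rewrite (le_trans (expR_le_quadratic _))// lerD2l.
have yc : `|g y - mu| <= 2 * c.
  rewrite (le_trans (ler_normB _ _))// mulr2n mulrDl mul1r lerD//.
  exact: (mean_bound L0 hg gc).
have sN : s ^+ 2 = N%:R^-1 by rewrite -[LHS](mulKf (lt0r_neq0 N0')) s2 mulr1.
have xc : `|s * (g y - mu)| <= 2 * c.
  rewrite normrM gtr0_norm// (le_trans _ yc)// ler_piMl//.
rewrite exprMn sN mulrC (mulrC K) mulrCA ler_wpM2l ?invr_ge0 ?(ltW N0')//.
rewrite mulrC ler_pM ?sqr_ge0 ?expR_ge0//; last by rewrite ler_expR.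
by rewrite -real_normK ?num_real// lerXn2r ?nnegrE// mulr_ge0.
Qed.

(** Even powers are dominated by the exponentials of the fluctuations of [g] and of [- g], whose
    bounds do not depend on [N]. *)
Lemma conditional_moment g c k : bm g -> (forall y, `|g y| <= c) ->
  Ex P (fun w => fluctuation g w ^+ k.*2) <=
  (k.*2)`!%:R * (2 * expR ((2 * c) ^+ 2 * expR (2 * c))).
Proof.
move=> hg gc.
have hNg : bm (fun y => -1 * g y) by exact: bm_scale.
have Ngc y : `|-1 * g y| <= c by rewrite mulN1r normrN.
have FN w : fluctuation (fun y => -1 * g y) w = - fluctuation g w.
  rewrite /fluctuation -mulrN -sumrN; congr (_ * _); apply: eq_bigr => i _.
  by rewrite (mean_scale (mean_m (pr w)) (-1) hg); ring.
have h1 := conditional_exp_moment hg gc.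
have h2 := conditional_exp_moment hNg Ngc.
have b1 := bm_expR (bm_fluctuation hg); have b2 := bm_expR (bm_fluctuation hNg).
have f0 : 0 <= (k.*2)`!%:R :> R by [].
have h3 : Ex P (fun w => fluctuation g w ^+ k.*2) <= Ex P (fun w => (k.*2)`!%:R *
    (expR (fluctuation g w) + expR (fluctuation (fun y => -1 * g y) w))).
  apply: Ex_le; first by apply: bm_exp; exact: bm_fluctuation.
    by apply: bm_scale; exact: bm_add.
  by move=> w; rewrite FN; exact: expr_le_exp.
rewrite (le_trans h3)// (ExZ P _ (bm_add b1 b2)) (ExD P b1 b2) ler_wpM2l//.
by rewrite mulr2n mulrDl mul1r lerD.
Qed.

End conditionally_iid.

Lemma bounded_functional_finite {R : realType} {d} {T : measurableType d}
    (mu : {measure set T -> \bar R}) : (mu setT < +oo)%E ->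
  bounded_functional (fun f => Rintegral mu setT f).
Proof.
move=> muoo.
have bi f : bm f -> mu.-integrable setT (EFin \o f).
  by case=> mf bf; exact: measurable_bounded_integrable.
split.
  move=> a f g hf hg; have haf : bm (fun x => a * f x) by exact: bm_scale.
  by rewrite (RintegralD measurableT (bi _ haf) (bi _ hg)) RintegralZl//; exact: bi.
exists (fine (mu setT)); split; first exact: fine_ge0.
move=> f e hf fe; rewrite (le_trans (le_normr_Rintegral measurableT (bi _ hf)))//.
rewrite mulrC -Rintegral_cst//; apply: le_Rintegral => //; apply: bi => //.
exact: bm_normr.
Qed.

(** * The particle system and its past *)

Section particle_system.
Context {R : realType} {dE : nat -> measure_display}
  {E : forall n, measurableType (dE n)}.
Local Notation F := (path_space E).
Variables (K : forall n, R.-pker E n ~> E n.+1) (x0 : E 0%N).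
Context {dO : measure_display} {Omega : measurableType dO}
  {P : probability Omega R} (X : forall n, {RV P >-> E n}).
Hypothesis hX : is_markov_chain K x0 X.
Variables (G : forall n, F n -> R).
Hypothesis hG : is_potential G.
Context {N : nat} {dT : measure_display} {T : measurableType dT}
  {PN : probability T R} (xi : forall n, 'I_N -> {RV PN >-> F n}).
Arguments xi : clear implicits.
Hypothesis N0 : (0 < N)%N.
Hypothesis hxi : is_particle_system K X G xi.

Let N0' : 0 < N%:R :> R. Proof. by rewrite ltr0n. Qed.

Let mxi n i : measurable_fun setT (xi n i). Proof. exact: measurable_funPT. Qed.

Lemma etaNE n (f : F n -> R) w : bm f ->
  etaN xi n f w = N%:R^-1 * \sum_i f (xi n i w).
Proof.
move: f; apply: bounded_functional_eq.
- apply: bounded_functional_finite; rewrite /emp /= /empirical.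
  by rewrite sumEFin -EFinM ltry.
- split.
    move=> a f g _ _; rewrite mulrCA -mulrDr; congr (_ * _).
    by rewrite mulr_sumr -big_split.
  exists 1; split=> // f e _ fe; rewrite mul1r normrM gtr0_norm ?invr_gt0//.
  rewrite ler_pdivrMl// (le_trans (ler_norm_sum _ _ _))//.
  rewrite (le_trans (ler_sum _ (fun i _ => fe (xi n i w))))//.
  by rewrite sumr_const card_ord mulr_natl.
- move=> A mA; rewrite /etaN integral_indic//= setIT /empirical.
  by rewrite sumEFin -EFinM.
Qed.

Lemma mean_etaN n w : mean_functional (fun f => etaN xi n f w).
Proof.
split.
- move=> a f g hf hg; rewrite !etaNE//; last by apply: bm_add => //; exact: bm_scale.
  by rewrite mulrCA -mulrDr; congr (_ * _); rewrite mulr_sumr -big_split.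
- move=> c; rewrite etaNE// sumr_const card_ord -[c *+ N]mulr_natl mulrA.
  by rewrite mulVf ?mul1r// gt_eqF.
- move=> f hf f0; rewrite etaNE// mulr_ge0// ?invr_ge0 ?(ltW N0')//.
  by rewrite sumr_ge0.
Qed.

Lemma mean_eta n : mean_functional (Defs.eta X G n).
Proof.
split; [|exact: (eta_cst X hG)|by move=> f _; exact: (eta_ge0 X hG)].
by move=> a f g; exact: (eta_lin X hG).
Qed.

(* Integral of [u] against the conditional law of a particle at time [p] given
   the particles at earlier times. *)
Definition predictor p : (F p -> R) -> T -> R :=
  match p with
  | 0%N => fun _ _ => 0
  | q.+1 => match q return (F q.+1 -> R) -> T -> R with
    | 0%N => fun u _ => Defs.eta X G 1 u
    | r.+1 => fun u w => etaN xi r.+1 (fun y => G y * path_transition K u y) w /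
                etaN xi r.+1 (@G r.+1) w
    end
  end.

Let bmG n : (0 < n)%N -> bm (@G n). Proof. exact: (bm_potential X hG). Qed.

Let bmGM n (u : F n.+1 -> R) : (0 < n)%N -> bm u ->
  bm (fun y => G y * path_transition K u y).
Proof. by move=> n0 hu; apply: bm_mul; [exact: bmG|exact: bm_path_transition]. Qed.

Lemma etaN_potential_bounds n : (0 < n)%N ->
  exists a b : R, [/\ 0 < a, 0 < b & forall w, a <= etaN xi n (@G n) w <= b].
Proof.
move=> n0; have [a [b [a0 b0 ab]]] := potential_bounds X hG n0.
exists a, b; split => // w; have L := mean_etaN n w.
have [_ cst _] := L; apply/andP; split.
  rewrite -[leLHS]cst; apply: (mean_le L) => //; first exact: bmG.
  by move=> y; have /andP[] := ab y.
rewrite -[leRHS]cst; apply: (mean_le L) => //; first exact: bmG.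
by move=> y; have /andP[] := ab y.
Qed.

Lemma mean_predictor p w : (0 < p)%N -> mean_functional (fun u => @predictor p u w).
Proof.
case: p => // -[|p] _; first exact: mean_eta.
have L := mean_etaN p.+1 w; have [lin cst pos] := L.
have [a [b [a0 b0 /(_ w)/andP[ab _]]]] := etaN_potential_bounds (ltn0Sn p).
have G0 : 0 < etaN xi p.+1 (@G p.+1) w by exact: lt_le_trans ab.
split.
- move=> c f g hf hg; rewrite /predictor.
  have -> : (fun y => G y * path_transition K (fun y => c * f y + g y) y) =
      (fun y => c * (G y * path_transition K f y) + G y * path_transition K g y).
    apply/funext => y; rewrite /path_transition transition_lin//; ring.
  by rewrite lin ?mulrDl ?mulrA//; exact: bmGM.
- move=> c; rewrite /predictor.
  have -> : (fun y => G y * path_transition K (fun=> c) y) = (fun y => c * @G p.+1 y).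
    by apply/funext => y; rewrite /path_transition transition_cst mulrC.
  by rewrite (mean_scale L)// ?mulfK ?gt_eqF//; exact: bmG.
- move=> f hf f0; rewrite /predictor divr_ge0// ?(ltW G0)//.
  apply: pos; first exact: bmGM.
  move=> y; rewrite mulr_ge0//; last exact: transition_ge0.
  by apply: ltW; have [_ ] := hG (ltn0Sn p).
Qed.

Lemma PhiE n w (A : set (F n.+1)) : (0 < n)%N -> measurable A ->
  Phi K G n (emp xi n w) A = (predictor (\1_A) w)%:E.
Proof.
case: n A => // n A _ mA; rewrite /Phi /predictor.
have bA : bm (\1_A : F n.+2 -> R) by exact: bm_indic.
have h := bmGM (ltn0Sn n) bA.
have emp_oo : (emp xi n.+1 w setT < +oo)%E.
  by rewrite /emp /= /empirical sumEFin -EFinM ltry.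
rewrite -/(etaN xi n.+1 (@G n.+1) w) mulrC EFinM; congr (_ * _)%E.
under eq_integral do rewrite hist_transitionE// -EFinM.
rewrite /etaN fineK//; apply: integrable_fin_num => //.
by case: h => mf bf; exact: measurable_bounded_integrable.
Qed.

Definition past_generator p : set (set T) :=
  [set B | exists k i (A : set (F k)),
    [/\ (0 < k <= p)%N, measurable A & B = xi k i @^-1` A]].

(** [T] with the sigma-algebra of the particles up to time [p]: measurability on [past p] expresses
    dependence on the past, and the identity from [T] is the projection to it. *)
Definition past p := g_sigma_algebraType (past_generator p).

Lemma measurable_to_past p : measurable_fun [set: T] (id : T -> past p).
Proof.
move=> _ B mB; rewrite setTI preimage_id.
suff : <<s past_generator p >> `<=` measurable by apply; exact: mB.
apply: smallest_sub; first exact: sigma_algebra_measurable.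
move=> _ [k [i [A [_ mA ->]]]]; rewrite -[X in measurable X]setTI.
exact: mxi.
Qed.

Lemma measurable_past_particle p k i : (0 < k <= p)%N ->
  measurable_fun [set: past p] (xi k i : past p -> F k).
Proof.
move=> kp _ A mA; rewrite setTI; apply: sub_sigma_algebra.
by exists k, i, A.
Qed.

Lemma bm_past_etaN p k (f : F k -> R) : (0 < k <= p)%N -> bm f ->
  bm (etaN xi k f : past p -> R).
Proof.
move=> kp hf; rewrite (_ : etaN xi k f = fun w => N%:R^-1 * \sum_i f (xi k i w)).
  apply: bm_scale; apply: bm_sum => i _; apply: bm_pre => //.
  exact: measurable_past_particle.
by apply/funext => w; rewrite etaNE.
Qed.

Lemma bm_past_predictor p (u : F p.+1 -> R) : bm u ->
  bm (@predictor p.+1 u : past p -> R).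
Proof.
case: p u => [|p] u hu; first exact: bm_cst.
have [a [b [a0 b0 ab]]] := etaN_potential_bounds (ltn0Sn p).
have b1 : bm (etaN xi p.+1 (fun y => G y * path_transition K u y) : past p.+1 -> R).
  by apply: bm_past_etaN; [rewrite leqnn|exact: bmGM].
have b2 : bm (etaN xi p.+1 (@G p.+1) : past p.+1 -> R).
  by apply: bm_past_etaN; [rewrite leqnn|exact: bmG].
apply: (bm_mul b1); apply: (bm_inv b2 a0) => w.
by have /andP[] := ab w.
Qed.

Let bounded_functional_predictor p (Psi : T -> R) : bm Psi ->
  bounded_functional (fun u => Ex PN (fun w => Psi w * @predictor p.+1 u w)).
Proof.
move=> hPsi.
have bp u : bm u -> bm (fun w => Psi w * @predictor p.+1 u w).
  move=> hu; apply: (bm_mul hPsi); apply: (bm_pre (h := id : T -> past p)).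
    exact: measurable_to_past.
  exact: bm_past_predictor.
split.
  move=> a f g hf hg; rewrite -(ExZ PN a (bp _ hf)).
  rewrite -(ExD PN (bm_scale a (bp _ hf)) (bp _ hg)); congr Rintegral.
  apply/funext => w; have [lin _ _] := mean_predictor w (ltn0Sn p).
  by rewrite lin//; ring.
have [M [M0 hM]] := bm_bound hPsi; exists M; split; first exact: ltW.
move=> f e hf fe; apply: Ex_bound; first exact: bp.
by move=> w; rewrite normrM ler_pM// (mean_bound (mean_predictor w (ltn0Sn p)) hf fe).
Qed.

Let rule_indic p (B : set T) (A : 'I_N -> set (F p.+1)) :
  particle_sigma_algebra xi p B -> (forall i, measurable (A i)) ->
  Ex PN (fun w => \1_B w * \prod_i \1_(A i) (xi p.+1 i w)) =
  Ex PN (fun w => \1_B w * \prod_i predictor (\1_(A i)) w).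
Proof.
move=> sB mA.
have mB : measurable B.
  by have := @measurable_to_past p measurableT B sB; rewrite setTI.
have mI : measurable (\bigcap_i (xi p.+1 i @^-1` A i)).
  apply: fin_bigcap_measurable => [|i _]; first exact: finite_finset.
  by rewrite -[X in measurable X]setTI; exact: mxi.
have prodE w : \prod_i \1_(A i) (xi p.+1 i w) =
    \1_(\bigcap_i (xi p.+1 i @^-1` A i)) w :> R.
  rewrite [RHS]indicE; have [/set_mem wI|/negP wI] := boolP (w \in _).
    by rewrite big1// => i _; rewrite indicE mem_set//; exact: wI.
  apply/eqP; rewrite prodf_seq_eq0; apply/hasP => /=.
  have : exists i, ~ A i (xi p.+1 i w).
    apply/existsNP => h; apply: wI; apply/mem_set => i _; exact: h.
  move=> [i Ai]; exists i; first by rewrite mem_index_enum.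
  by rewrite indicE memNset.
have bpred : bm (fun w => \prod_i predictor (\1_(A i)) w).
  apply: bm_prod => i _; apply: (bm_pre (h := id : T -> past p)).
    exact: measurable_to_past.
  by apply: bm_past_predictor; exact: bm_indic.
have LE : Ex PN (fun w => \1_B w * \prod_i \1_(A i) (xi p.+1 i w)) =
    fine (PN (B `&` \bigcap_i (xi p.+1 i @^-1` A i))).
  rewrite -Ex_indic; last exact: measurableI.
  by congr Rintegral; apply/funext => w; rewrite prodE indicI.
case: p A sB mA mI prodE bpred LE => [|p] A sB mA mI prodE bpred LE.
  (* No particle precedes time [1], so the past at [p = 0] contains only the empty set and the whole
     space. *)
  have [->|->] : B = set0 \/ B = setT.
  - suff : <<s past_generator 0 >> `<=` [set C | C = set0 \/ C = setT] by apply.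
    apply: smallest_sub => [|C [k [i [D [/andP[k0 k1]]]]]]; last first.
      by have := leq_trans k0 k1.
    split; first by left.
    + by move=> C [->|->]; [right; rewrite setD0|left; rewrite setDv].
    + move=> C hC; have [[k Ck]|nC] := pselect (exists k, C k = setT).
        by right; apply/seteqP; split=> // w _; exists k => //; rewrite Ck.
      left; apply/seteqP; split=> // w [k _ Ckw]; have [Ck|Ck] := hC k.
        by rewrite Ck in Ckw.
      by case: nC; exists k.
  - have z (h : T -> R) : Ex PN (fun w => \1_(set0 : set T) w * h w) = 0.
      rewrite -[RHS](Ex_cst PN 0); congr Rintegral; apply/funext => w.
      by rewrite indicE in_set0 mul0r.
    by rewrite !z.
  - transitivity (Ex PN (fun w => \1_(\bigcap_i (xi 1%N i @^-1` A i)) w)).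
      by congr Rintegral; apply/funext => w; rewrite prodE indicE in_setT mul1r.
    rewrite Ex_indic// (hxi.1 A mA) prod_EFin/=.
    rewrite -[LHS](Ex_cst PN); congr Rintegral; apply/funext => w.
    by rewrite indicE in_setT mul1r.
rewrite LE (hxi.2 p.+1 isT B sB A mA).
rewrite /Rintegral; congr fine; rewrite [LHS]integral_mkcond.
apply: eq_integral => w _; rewrite /patch indicE.
have -> : (\prod_(i < N) Phi K G p.+1 (emp xi p.+1 w) (A i) =
    (\prod_(i < N) predictor (\1_(A i)) w)%:E)%E.
  by rewrite -prod_EFin; apply: eq_bigr => i _; rewrite PhiE.
by case: (w \in B); rewrite ?mul1r ?mul0r.
Qed.

(** From indicators to functions twice: in the particles by [multilinear_ext], then in the past
    variable by [bounded_functional_eq]. *)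
Lemma particle_rule p (psi : past p -> R) (u : 'I_N -> F p.+1 -> R) :
  bm psi -> (forall i, bm (u i)) ->
  Ex PN (fun w => psi w * \prod_i u i (xi p.+1 i w)) =
  Ex PN (fun w => psi w * \prod_i predictor (u i) w).
Proof.
move=> hpsi hu.
have bprod (v : 'I_N -> F p.+1 -> R) (r : pred 'I_N) : (forall i, bm (v i)) ->
    bm (fun w => \prod_(i | r i) v i (xi p.+1 i w)) /\
    bm (fun w => \prod_(i | r i) predictor (v i) w).
  move=> hv; split; apply: bm_prod => i _; first exact: bm_pre.
  by apply: (bm_pre (h := id : T -> past p)); [exact: measurable_to_past|exact: bm_past_predictor].
have bupd (v : 'I_N -> F p.+1 -> R) (k : 'I_N) f : (forall i, bm (v i)) ->
    bm f -> forall i, bm (upd v k f i).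
  by move=> hv hf i; rewrite /upd; case: eqP.
have step B : particle_sigma_algebra xi p B ->
    Ex PN (fun w => \1_B w * \prod_i u i (xi p.+1 i w)) =
    Ex PN (fun w => \1_B w * \prod_i predictor (u i) w).
  move=> sB.
  have mB : measurable B.
    by have := @measurable_to_past p measurableT B sB; rewrite setTI.
  have bB : bm (\1_B : T -> R) by exact: bm_indic.
  apply: (multilinear_ext
    (L1 := fun v => Ex PN (fun w => \1_B w * \prod_i v i (xi p.+1 i w)))
    (L2 := fun v => Ex PN (fun w => \1_B w * \prod_i predictor (v i) w))) hu.
  - move=> k v hv; have [bv _] := bprod v (fun i => i != k) hv.
    have := bounded_functional_Ex PN (bm_mul bB bv) (@mxi p.+1 k).
    congr bounded_functional; apply/funext => f; congr Rintegral; apply/funext => w.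
    rewrite [in RHS](bigD1 k)//= {1}/upd eqxx.
    rewrite (_ : \prod_(i | i != k) upd v k f i (xi p.+1 i w) =
      \prod_(i | i != k) v i (xi p.+1 i w)); first by ring.
    by apply: eq_bigr => i /negbTE ik; rewrite /upd ik.
  - move=> k v hv; have [_ bv] := bprod v (fun i => i != k) hv.
    have := bounded_functional_predictor p (bm_mul bB bv).
    congr bounded_functional; apply/funext => f; congr Rintegral; apply/funext => w.
    rewrite [in RHS](bigD1 k)//= {1}/upd eqxx.
    rewrite (_ : \prod_(i | i != k) predictor (upd v k f i) w =
      \prod_(i | i != k) predictor (v i) w); first by ring.
    by apply: eq_bigr => i /negbTE ik; rewrite /upd ik.
  - by move=> A mA; exact: rule_indic.
have [b1 b2] := bprod u predT hu.
have f1 := bounded_functional_Ex PN b1 (@measurable_to_past p).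
have f2 := bounded_functional_Ex PN b2 (@measurable_to_past p).
under [in LHS]eq_fun do rewrite mulrC.
under [in RHS]eq_fun do rewrite mulrC.
apply: (bounded_functional_eq f1 f2) => // B mB.
under [in LHS]eq_fun do rewrite mulrC.
under [in RHS]eq_fun do rewrite mulrC.
exact: step.
Qed.

End particle_system.

(** * Local sampling errors and the telescoping sum *)

Section local_fluctuations.
Context {R : realType} {dE : nat -> measure_display}
  {E : forall n, measurableType (dE n)}.
Local Notation F := (path_space E).
Variables (K : forall n, R.-pker E n ~> E n.+1) (x0 : E 0%N).
Context {dO : measure_display} {Omega : measurableType dO}
  {P : probability Omega R} (X : forall n, {RV P >-> E n}).
Hypothesis hX : is_markov_chain K x0 X.
Variables (G : forall n, F n -> R).
Hypothesis hG : is_potential G.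
Context {N : nat} {dT : measure_display} {T : measurableType dT}
  {PN : probability T R} (xi : forall n, 'I_N -> {RV PN >-> F n}).
Arguments xi : clear implicits.
Hypothesis N0 : (0 < N)%N.
Hypothesis hxi : is_particle_system K X G xi.

Let N0' : 0 < N%:R :> R. Proof. by rewrite ltr0n. Qed.

Local Notation pred q := (predictor K X G xi (p := q)).

(** The error of the sampling at time [p] alone: the empirical mean is compared with its conditional
    expectation, not with [eta p]. *)
Definition local_fluctuation p (g : F p -> R) w :=
  Num.sqrt N%:R * (etaN xi p g w - pred p g w).

Lemma local_fluctuationE p (g : F p.+1 -> R) : bm g ->
  local_fluctuation g =
  fluctuation (id : T -> past xi p) (fun i => xi p.+1 i) (pred p.+1) g.
Proof.
move=> hg; apply/funext => w; rewrite /local_fluctuation /fluctuation etaNE//.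
rewrite sumrB sumr_const card_ord.
have sN : Num.sqrt N%:R != 0 :> R by rewrite gt_eqF// sqrtr_gt0.
rewrite -[pred p.+1 g w *+ N]mulr_natl.
have : N%:R = Num.sqrt N%:R ^+ 2 :> R by rewrite sqr_sqrtr// ltW.
move: sN; set r := Num.sqrt N%:R => r0 ->.
by field.
Qed.

Let mxi n i : measurable_fun setT (xi n i). Proof. exact: measurable_funPT. Qed.

Lemma local_lindeberg p (g : F p.+1 -> R) (c : R) (psi a : past xi p -> R) (M : R) :
  bm g -> (forall y, `|g y| <= c) ->
  bm psi -> (forall z, `|psi z| <= M) -> measurable_fun setT a ->
  `|Ex PN (fun w => psi w * cos (a w + local_fluctuation g w)) -
    Ex PN (fun w => psi w * (cos (a w) *
      expR (- (variance_of (fun u => pred p.+1 u w) g / 2))))| <=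
  M * (4 * c ^+ 3 + 3 * c ^+ 4) / Num.sqrt N%:R.
Proof.
move=> hg gc hpsi psiM ma; rewrite local_fluctuationE//.
apply: (conditional_lindeberg (pr := id : T -> past xi p)
  (xi := fun i => xi p.+1 i) (m := pred p.+1 : (F p.+1 -> R) -> past xi p -> R)) => //.
- exact: measurable_to_past.
- by move=> u hu; exact: (bm_past_predictor K X hG xi N0 hu).
- by move=> z; exact: (mean_predictor K X hG xi N0 z (ltn0Sn p)).
- by move=> psi' u hpsi' hu; exact: (particle_rule hG N0 hxi hpsi' hu).
Qed.

Lemma local_moment p (g : F p.+1 -> R) (c : R) k :
  bm g -> (forall y, `|g y| <= c) ->
  Ex PN (fun w => local_fluctuation g w ^+ k.*2) <=
  (k.*2)`!%:R * (2 * expR ((2 * c) ^+ 2 * expR (2 * c))).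
Proof.
move=> hg gc; rewrite local_fluctuationE//.
apply: (conditional_moment (pr := id : T -> past xi p)
  (xi := fun i => xi p.+1 i) (m := pred p.+1 : (F p.+1 -> R) -> past xi p -> R)) => //.
- exact: measurable_to_past.
- by move=> u hu; exact: (bm_past_predictor K X hG xi N0 hu).
- by move=> z; exact: (mean_predictor K X hG xi N0 z (ltn0Sn p)).
- by move=> psi' u hpsi' hu; exact: (particle_rule hG N0 hxi hpsi' hu).
Qed.

Lemma measurable_past_local_fluctuation q p (g : F p -> R) : (0 < p <= q)%N ->
  bm g ->
  bm (local_fluctuation g : past xi q -> R).
Proof.
case: p g => // p g pq hg; apply: bm_scale; apply: bm_sub.
  exact: (bm_past_etaN xi N0 pq hg).
case: p g pq hg => [|p] g pq hg; first exact: bm_cst.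
have [a [b [a0 b0 ab]]] := etaN_potential_bounds X hG xi N0 (ltn0Sn p).
have pq' : (0 < p.+1 <= q)%N by have /andP[_ h] := pq; exact: ltnW.
have b1 : bm (etaN xi p.+1 (fun y => G y * path_transition K g y) : past xi q -> R).
  apply: (bm_past_etaN xi N0 pq'); apply: bm_mul; first exact: (bm_potential X hG).
  exact: bm_path_transition.
have b2 : bm (etaN xi p.+1 (@G p.+1) : past xi q -> R).
  by apply: (bm_past_etaN xi N0 pq'); exact: (bm_potential X hG).
apply: (bm_mul b1); apply: (bm_inv b2 a0) => w.
by have /andP[] := ab w.
Qed.

Lemma bm_past_to (q : nat) (h : past xi q -> R) : bm h ->
  bm (h : T -> R).
Proof.
by move=> hh; apply: (bm_pre (h := id : T -> past xi q)) => //; exact: measurable_to_past.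
Qed.

Lemma bm_local_fluctuation p (g : F p -> R) : (0 < p)%N -> bm g ->
  bm (local_fluctuation g).
Proof.
move=> p0 hg; apply: (@bm_past_to p).
by apply: measurable_past_local_fluctuation => //; rewrite p0 leqnn.
Qed.

(** The particle estimate of [gamma n] at [1]. It depends on the particles at times below [n]
    only. *)
Definition gammaN1 n w := \prod_(1 <= p < n) etaN xi p (@G p) w.

(** By the recursion for [g], [gammaN1 p.+1] times the predictor of [g p.+1] equals [gammaN1 p]
    times the empirical mean of [g p], so the weighted errors telescope. *)
Lemma gammaN_decomposition n (f : F n -> R) (g : forall p, F p -> R) w :
  (0 < n)%N -> g n = f ->
  (forall p, (0 < p <= n)%N -> bm (g p)) ->
  (forall p, (0 < p < n)%N -> g p = fun y => G y * path_transition K (g p.+1) y) ->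
  WgammaN X G xi n f w =
  \sum_(1 <= p < n.+1) gammaN1 p w * local_fluctuation (g p) w.
Proof.
move=> n0 gn hg gS.
(* [gamma p (g p)] does not depend on [p]; at [p = 1] it is the starting value of the telescoping
   sum. *)
have gamma1 p : (0 < p <= n)%N -> gamma X G p (g p) = Defs.eta X G 1 (g 1%N).
  case: p => // p; elim: p => [|p IH] pn.
    by rewrite /Defs.eta gamma1_1 divr1.
  rewrite (gammaS hX hG)//; last exact: hg.
  rewrite -gS; last by have /andP[_ h] := pn.
  by apply: IH; have /andP[_ h] := pn; exact: ltnW.
have main j : (0 < j <= n)%N -> gammaN1 j w * etaN xi j (g j) w - Defs.eta X G 1 (g 1%N) =
    \sum_(1 <= q < j.+1) gammaN1 q w * (etaN xi q (g q) w - pred q (g q) w).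
  case: j => // j; elim: j => [|j IH] jn.
    by rewrite big_nat1 /gammaN1 big_geq// !mul1r.
  rewrite big_nat_recr//= -IH; last by have /andP[_ h] := jn; exact: ltnW.
  have [a [b [a0 b0 /(_ w)/andP[aG _]]]] := etaN_potential_bounds X hG xi N0 (ltn0Sn j).
  have G0 : etaN xi j.+1 (@G j.+1) w != 0 by rewrite gt_eqF// (lt_le_trans a0).
  have gj : gammaN1 j.+2 w = gammaN1 j.+1 w * etaN xi j.+1 (@G j.+1) w.
    by rewrite /gammaN1 big_nat_recr.
  rewrite (gS j.+1); last by have /andP[_ h] := jn.
  rewrite gj /=; field.
  by [].
rewrite /WgammaN /gammaN -/(gammaN1 n w).
rewrite -{2}gn gamma1 ?n0 ?leqnn// mulrC -[X in X * _]opprB.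
rewrite (_ : etaN xi n f w * gammaN1 n w = gammaN1 n w * etaN xi n (g n) w); last first.
  by rewrite gn mulrC.
rewrite opprB main ?n0 ?leqnn// mulr_suml; apply: eq_bigr => q _.
by rewrite /local_fluctuation; ring.
Qed.

Lemma gammaN1_gt0 n : exists a b : R, [/\ 0 < a, 0 < b & forall w, a <= gammaN1 n w <= b].
Proof.
elim: n => [|n [a [b [a0 b0 ab]]]].
  by exists 1, 1; split=> // w; rewrite /gammaN1 big_geq// lexx.
case: n a b a0 b0 ab => [|n] a b a0 b0 ab.
  by exists 1, 1; split=> // w; rewrite /gammaN1 big_geq// lexx.
have [c [d [c0 d0 cd]]] := etaN_potential_bounds X hG xi N0 (ltn0Sn n).
exists (a * c), (b * d); split; rewrite ?mulr_gt0// => w.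
rewrite /gammaN1 big_nat_recr//= -/(gammaN1 n.+1 w).
have /andP[h1 h2] := ab w; have /andP[h3 h4] := cd w.
apply/andP; split; apply: ler_pM => //; try exact: ltW.
  exact: le_trans (ltW a0) h1.
exact: le_trans (ltW c0) h3.
Qed.

(** The function under [WgammaN] is centered, so [gamma n] annihilates it, and dividing by
    [gammaN1 n] renormalises [gammaN] to [etaN]. *)
Lemma WetaN_WgammaN n (f : F n -> R) w : (0 < n)%N -> bm f ->
  WetaN X G xi n f w = gamma X G n (cst 1) / gammaN1 n w *
    WgammaN X G xi n
      (fun y => (gamma X G n (cst 1))^-1 * (f y - Defs.eta X G n f)) w.
Proof.
move=> n0 hf; rewrite /WetaN /WgammaN /gammaN -/(gammaN1 n w).
set g1 := gamma X G n (cst 1).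
have g10 : g1 != 0 by rewrite gt_eqF// (gamma1_gt0 X hG).
have [a [b [a0 b0 /(_ w)/andP[aw _]]]] := gammaN1_gt0 n.
have gN0 : gammaN1 n w != 0 by rewrite gt_eqF// (lt_le_trans a0).
have hc : bm (fun y => f y - Defs.eta X G n f) by exact: bm_sub.
have L := mean_etaN xi N0 n w.
rewrite (mean_scale L)// (mean_add L hf (bm_cst _)).
have [_ cst _] := L; rewrite cst.
have -> : gamma X G n (fun y => g1^-1 * (f y - Defs.eta X G n f)) = 0.
  have := mean_scale (mean_eta X hG n) g1^-1 hc.
  rewrite (mean_add (mean_eta X hG n) hf (bm_cst _)) (eta_cst X hG) subrr mulr0.
  rewrite /Defs.eta -/g1 => /eqP; rewrite mulf_eq0 invr_eq0 (negbTE g10) orbF.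
  by move=> /eqP.
by rewrite subr0; field; rewrite g10 gN0.
Qed.

End local_fluctuations.

(** * Limits as the number of particles grows *)

Lemma le_cvg0 {R : realType} (u v : nat -> R) : (forall k, 0 <= u k <= v k) ->
  v @ \oo --> 0 -> u @ \oo --> 0.
Proof.
move=> uv v0; apply: (squeeze_cvgr (f := fun=> 0) (h := v)) => //.
  exact: nearW.
exact: cvg_cst.
Qed.

Lemma cvg0_lin {R : realType} (u v : nat -> R) (a b : R) : u @ \oo --> 0 -> v @ \oo --> 0 ->
  (fun k => a * u k + b * v k) @ \oo --> 0.
Proof.
move=> u0 v0; rewrite -[0](_ : a * 0 + b * 0 = 0); last by rewrite !mulr0 addr0.
by apply: cvgD; apply: cvgMr.
Qed.

Lemma cvg0_scale {R : realType} (u : nat -> R) (a : R) : u @ \oo --> 0 ->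
  (fun k => a * u k) @ \oo --> 0.
Proof. by move=> u0; rewrite -[0](mulr0 a); apply: cvgMr. Qed.

Lemma le_cvg {R : realType} (u v w : nat -> R) (a : R) : (forall k, `|u k - v k| <= w k) ->
  w k @[k --> \oo] --> 0 -> v k @[k --> \oo] --> a -> u k @[k --> \oo] --> a.
Proof.
move=> uv w0 va; rewrite (_ : u = fun k => (u k - v k) + v k); last first.
  by apply/funext => k; rewrite subrK.
rewrite -[a]add0r; apply: cvgD => //; apply/norm_cvg0P.
by apply: le_cvg0 w0 => k; rewrite normr_ge0 uv.
Qed.

(** * Convergence in L1 to constants *)

Section l1_convergence.
Context {R : realType} {dT : nat -> measure_display}.
Context {T : forall k, measurableType (dT k)}.
Variable P : forall k, probability (T k) R.
Implicit Types (V U : forall k, T k -> R) (a b c : R).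

(** The spaces vary with [k], so limits are deterministic constants. The uniform bound makes the
    class stable under products. *)
Definition l1_cvg V c :=
  [/\ forall k, bm (V k),
      exists M, forall k w, `|V k w| <= M &
      Ex (P k) (fun w => `|V k w - c|) @[k --> \oo] --> 0].

Lemma l1_cvg_le V c (u : nat -> R) : (forall k, bm (V k)) ->
  (exists M, forall k w, `|V k w| <= M) ->
  (forall k, Ex (P k) (fun w => `|V k w - c|) <= u k) ->
  u k @[k --> \oo] --> 0 -> l1_cvg V c.
Proof.
move=> bV MV le u0; split=> //; apply: le_cvg0 u0 => k.
by rewrite Ex_ge0//= le.
Qed.

Lemma l1_cvg_ext V V' c : (forall k w, V k w = V' k w) -> l1_cvg V c -> l1_cvg V' c.
Proof.
move=> VV'; rewrite (_ : V' = V)//.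
by apply/functional_extensionality_dep => k; apply/funext => w.
Qed.

Lemma l1_cvg_cst c : l1_cvg (fun k _ => c) c.
Proof.
split; first by move=> k; exact: bm_cst.
- by exists `|c|.
- rewrite (_ : (fun _ => _) = fun=> 0); first exact: cvg_cst.
  by apply/funext => k; rewrite subrr normr0 Ex_cst.
Qed.

Lemma l1_cvg_add V U a b : l1_cvg V a -> l1_cvg U b ->
  l1_cvg (fun k w => V k w + U k w) (a + b).
Proof.
move=> [bV [M VM] V0] [bU [M' UM] U0].
have bd k := bm_normr (bm_sub (bV k) (bm_cst a)).
have be k := bm_normr (bm_sub (bU k) (bm_cst b)).
have bS k := bm_add (bV k) (bU k).
split=> //.
  by exists (M + M') => k w; rewrite (le_trans (ler_normD _ _))// lerD.
apply: le_cvg0 (cvg0_lin 1 1 V0 U0) => k; rewrite !mul1r.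
rewrite Ex_ge0//= -(ExD (P k) (bd k) (be k)); apply: Ex_le.
- exact: bm_normr (bm_sub (bS k) (bm_cst _)).
- exact: bm_add.
- by move=> w; rewrite opprD addrACA ler_normD.
Qed.

Lemma l1_cvg_mul V U a b : l1_cvg V a -> l1_cvg U b ->
  l1_cvg (fun k w => V k w * U k w) (a * b).
Proof.
move=> [bV [M VM] V0] [bU [M' UM] U0].
have bd k := bm_normr (bm_sub (bV k) (bm_cst a)).
have be k := bm_normr (bm_sub (bU k) (bm_cst b)).
have bS k := bm_mul (bV k) (bU k).
split=> //.
  exists (`|M| * `|M'|) => k w; rewrite normrM ler_pM//.
    exact: le_trans (VM _ _) (ler_norm _).
  exact: le_trans (UM _ _) (ler_norm _).
apply: le_cvg0 (cvg0_lin `|M'| `|a| V0 U0) => k; rewrite Ex_ge0//=.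
rewrite -(ExZ (P k) `|M'| (bd k)) -(ExZ (P k) `|a| (be k)).
rewrite -(ExD (P k) (bm_scale _ (bd k)) (bm_scale _ (be k))); apply: Ex_le.
- exact: bm_normr (bm_sub (bS k) (bm_cst _)).
- exact: bm_add (bm_scale _ (bd k)) (bm_scale _ (be k)).
- move=> w; rewrite (_ : _ - _ = U k w * (V k w - a) + a * (U k w - b)); last by ring.
  rewrite (le_trans (ler_normD _ _))// !normrM lerD// ler_wpM2r//.
  exact: le_trans (UM _ _) (ler_norm _).
Qed.

Lemma l1_cvg_scale V a c : l1_cvg V a -> l1_cvg (fun k w => c * V k w) (c * a).
Proof. by move=> h; apply: l1_cvg_mul => //; exact: l1_cvg_cst. Qed.

Lemma l1_cvg_sub V U a b : l1_cvg V a -> l1_cvg U b ->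
  l1_cvg (fun k w => V k w - U k w) (a - b).
Proof.
move=> hV hU; rewrite -mulN1r.
apply: (l1_cvg_ext (V := fun k w => V k w + -1 * U k w)) => [k w|].
  by rewrite mulN1r.
by apply: l1_cvg_add => //; exact: l1_cvg_scale.
Qed.

Lemma l1_cvg_inv V a c : 0 < a -> 0 < c -> (forall k w, a <= V k w) ->
  l1_cvg V c -> l1_cvg (fun k w => (V k w)^-1) c^-1.
Proof.
move=> a0 c0 aV [bV [M VM] V0].
have bd k := bm_normr (bm_sub (bV k) (bm_cst c)).
have bS k := bm_inv (bV k) a0 (aV k).
have V_gt0 k w : 0 < V k w by exact: lt_le_trans (aV k w).
split=> //.
  exists a^-1 => k w; rewrite ger0_norm ?invr_ge0 ?(ltW (V_gt0 _ _))//.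
  by rewrite lef_pV2 ?posrE.
apply: le_cvg0 (cvg0_scale (a * c)^-1 V0) => k.
rewrite Ex_ge0//= -(ExZ (P k) _ (bd k)); apply: Ex_le.
- exact: bm_normr (bm_sub (bS k) (bm_cst _)).
- exact: bm_scale.
- move=> w; rewrite (_ : _ - _ = (V k w * c)^-1 * (c - V k w)); last first.
    by field; rewrite !gt_eqF.
  rewrite normrM distrC ler_wpM2r// ger0_norm ?invr_ge0; last first.
    by rewrite ltW// mulr_gt0.
  by rewrite lef_pV2 ?posrE ?mulr_gt0// ler_pM2r.
Qed.

Lemma l1_cvg_prod (m n : nat) (V : forall p k, T k -> R) (c : nat -> R) :
  (forall p, (m <= p < n)%N -> l1_cvg (V p) (c p)) ->
  l1_cvg (fun k w => \prod_(m <= p < n) V p k w) (\prod_(m <= p < n) c p).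
Proof.
elim: n => [|n IH] h.
  rewrite big_geq//; apply: l1_cvg_ext (l1_cvg_cst 1) => k w.
  by rewrite big_geq.
have [mn|nm] := leqP m n; last first.
  rewrite big_geq//; apply: l1_cvg_ext (l1_cvg_cst 1) => k w.
  by rewrite big_geq.
rewrite big_nat_recr//=.
apply: (l1_cvg_ext (V := fun k w => (\prod_(m <= p < n) V p k w) * V n k w)).
  by move=> k w; rewrite big_nat_recr.
apply: l1_cvg_mul; last by apply: h; rewrite mn ltnSn.
by apply: IH => p /andP[mp pn]; apply: h; rewrite mp ltnW.
Qed.

(* [`|x * y| <= (x ^+ 2 / e + e * y ^+ 2) / 2] with [x = V k - c] small in L1,
   hence in L2, and [y = Y k] bounded in L2. *)
Lemma l1_cvg_mul_null V c (Y : forall k, T k -> R) (C : R) : l1_cvg V c ->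
  (forall k, bm (Y k)) ->
  (forall k, Ex (P k) (fun w => Y k w ^+ 2) <= C) ->
  Ex (P k) (fun w => `|(V k w - c) * Y k w|) @[k --> \oo] --> 0.
Proof.
move=> [bV [M VM] V0] bY YC; apply/cvgrPdist_le => /= e e0.
have C0 : 0 <= C by apply: le_trans (YC 0%N); apply: Ex_ge0 => w; exact: sqr_ge0.
have bd k := bm_normr (bm_sub (bV k) (bm_cst c)).
have bs k := bm_exp 2 (bY k).
(* The weight in the inequality, chosen so that the part in [Y k w ^ 2] costs at most [e / 2]. *)
pose t := e / (C + 1).
have t0 : 0 < t by rewrite divr_gt0// ltr_wpDl.
pose B := `|M| + `|c| + 1.
have B0 : 0 < B by rewrite ltr_wpDl// addr_ge0.
have tC : t * C <= e.
  by rewrite /t mulrAC ler_pdivrMr ?ltr_wpDl// ler_pM2l// lerDl.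
(* How small the L1 distance must be for the other part to cost at most [e / 2] as well. *)
have s0 : 0 < e * t / B by rewrite divr_gt0// mulr_gt0.
move/cvgrPdist_le : V0 => /(_ _ s0); apply: filterS => k.
rewrite sub0r normrN ger0_norm ?Ex_ge0// => hk.
rewrite sub0r normrN ger0_norm ?Ex_ge0//.
have le w : `|(V k w - c) * Y k w| <=
    (B / t / 2) * `|V k w - c| + (t / 2) * Y k w ^+ 2.
  rewrite normrM -(real_normK (num_real (Y k w))).
  have : `|V k w - c| <= B.
    rewrite (le_trans (ler_normB _ _))// /B -addrA lerD ?lerDl//.
    exact: le_trans (VM _ _) (ler_norm _).
  move: (normr_ge0 (V k w - c)) (normr_ge0 (Y k w)).
  set x := `|V k w - c|; set y := `|Y k w| => x0 y0 xB.
  have h : 2 * (x * y) <= t^-1 * x ^+ 2 + t * y ^+ 2.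
    rewrite -subr_ge0 (_ : _ - _ = t^-1 * (x - t * y) ^+ 2); last first.
      by field; rewrite gt_eqF.
    by rewrite mulr_ge0 ?sqr_ge0// invr_ge0 ltW.
  have h2 : t^-1 * x ^+ 2 <= t^-1 * (B * x).
    by rewrite ler_wpM2l ?invr_ge0 ?(ltW t0)// expr2 ler_wpM2r.
  rewrite (_ : B / t / 2 * x = t^-1 * (B * x) / 2); last by field; rewrite gt_eqF.
  lra.
have := Ex_le (P k) (bm_normr (bm_mul (bm_sub (bV k) (bm_cst c)) (bY k)))
  (bm_add (bm_scale (B / t / 2) (bd k)) (bm_scale (t / 2) (bs k))) le.
rewrite (ExD (P k) (bm_scale _ (bd k)) (bm_scale _ (bs k))).
rewrite (ExZ (P k) _ (bd k)) (ExZ (P k) _ (bs k)) => h; apply: (le_trans h).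
have h1 : B / t / 2 * Ex (P k) (fun w => `|V k w - c|) <= e / 2.
  apply: (@le_trans _ _ (B / t / 2 * (e * t / B))).
    by apply: ler_wpM2l hk; apply/ltW/divr_gt0 => //; exact: divr_gt0.
  by rewrite le_eqVlt; apply/orP; left; apply/eqP; field; rewrite !gt_eqF.
have h2 : t / 2 * Ex (P k) (fun w => Y k w ^+ 2) <= e / 2.
  apply: (@le_trans _ _ (t / 2 * C)); first by apply: ler_wpM2l => //; exact/ltW/divr_gt0.
  by rewrite mulrAC ler_pM2r.
lra.
Qed.

End l1_convergence.

Lemma cvg_inv_sqrt {R : realType} :
  (fun k => (Num.sqrt (k.+1%:R : R))^-1) @ \oo --> (0 : R).
Proof.
apply/cvgrPdist_le => /= e e0; near=> k.
rewrite sub0r normrN ger0_norm ?invr_ge0//.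
rewrite -[e]invrK lef_pV2 ?posrE ?invr_gt0 ?sqrtr_gt0//.
rewrite -[e^-1]gtr0_norm ?invr_gt0// -sqrtr_sqr ler_wsqrtr//.
rewrite (@le_trans _ _ k%:R) ?ler_nat//.
by near: k; exact: nbhs_infty_ger.
Unshelve. all: by end_near. Qed.

Lemma expRN_lip {R : realType} (x y : R) : 0 <= x -> 0 <= y ->
  `|expR (- (x / 2)) - expR (- (y / 2))| <= `|x - y|.
Proof.
wlog xy : x y / x <= y.
  move=> h x0 y0; have [|/ltW] := leP x y; first by move=> xy; exact: h.
  by move=> yx; rewrite distrC [leRHS]distrC; exact: h.
move=> x0 y0; rewrite ger0_norm ?subr_ge0 ?ler_expR; last by lra.
rewrite ler0_norm ?subr_le0// opprB.
have -> : - (y / 2) = - (x / 2) + - ((y - x) / 2) by field.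
rewrite expRD -[X in X - _]mulr1 -mulrBr.
have h1 : expR (- (x / 2)) <= 1 by rewrite -[leRHS]expR0 ler_expR; lra.
have h2 := expR_ge1Dx (- ((y - x) / 2)).
have h3 : expR (- ((y - x) / 2)) <= 1 by rewrite -[leRHS]expR0 ler_expR; lra.
have h4 := expR_gt0 (- (x / 2)).
by move: h1 h2 h3 h4; set A := expR _; set B := expR _; nra.
Qed.

(* Sequences are indexed by [k], the number of particles being [k.+1]. *)
Section particle_limits.
Context {R : realType} {dE : nat -> measure_display}
  {E : forall n, measurableType (dE n)}.
Local Notation F := (path_space E).
Variables (K : forall n, R.-pker E n ~> E n.+1) (x0 : E 0%N).
Context {dO : measure_display} {Omega : measurableType dO}
  {P : probability Omega R} (X : forall n, {RV P >-> E n}).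
Hypothesis hX : is_markov_chain K x0 X.
Variables (G : forall n, F n -> R).
Hypothesis hG : is_potential G.
Context {dT : nat -> measure_display} {T : forall k, measurableType (dT k)}
  {PN : forall k, probability (T k) R}
  (xi : forall k n, 'I_k.+1 -> {RV (PN k) >-> F n}).
Arguments xi : clear implicits.
Hypothesis hxi : forall k, is_particle_system K X G (xi k).

Local Notation W k g := (local_fluctuation K X G (xi k) g).

Lemma local_fluctuation_bound2 p (g : F p -> R) : (0 < p)%N -> bm g ->
  exists C, forall k, Ex (PN k) (fun w => W k g w ^+ 2) <= C.
Proof.
case: p g => // p g _ hg; have [c [c0 gc]] := bm_bound hg.
exists ((1.*2)`!%:R * (2 * expR ((2 * c) ^+ 2 * expR (2 * c)))) => k.
exact: (local_moment hG (ltn0Sn k) (hxi k) 1 hg gc).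
Qed.

(** The difference is the local fluctuation divided by the square root of the number of particles,
    and that fluctuation is bounded in L2, hence in L1 through [|x| <= 1 + x ^ 2]. *)
Lemma l1_cvg_etaN_predictor p (f : F p -> R) : (0 < p)%N -> bm f ->
  l1_cvg PN (fun k w => etaN (xi k) p f w - predictor K X G (xi k) f w) 0.
Proof.
move=> p0 hf; have [c [c0 fc]] := bm_bound hf.
have [C WC] := local_fluctuation_bound2 p0 hf.
have N0 k : 0 < Num.sqrt k.+1%:R :> R by rewrite sqrtr_gt0.
have bW k := bm_local_fluctuation K X hG (xi k) (ltn0Sn k) p0 hf.
have WE k w : etaN (xi k) p f w - predictor K X G (xi k) f w =
    (Num.sqrt k.+1%:R)^-1 * W k f w.
  by rewrite /local_fluctuation mulrA mulVf ?mul1r ?gt_eqF.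
apply: (l1_cvg_le (u := fun k => (1 + C) * (Num.sqrt k.+1%:R)^-1)).
- move=> k; under eq_fun do rewrite WE.
  exact: bm_scale.
- exists (c + c) => k w; rewrite (le_trans (ler_normB _ _))// lerD//.
    exact: (mean_bound (mean_etaN (xi k) (ltn0Sn k) _ w) hf fc).
  exact: (mean_bound (mean_predictor K X hG (xi k) (ltn0Sn k) w p0) hf fc).
- move=> k; have bW2 := bm_exp 2 (bW k).
  rewrite (_ : (fun w => _) = (fun w => (Num.sqrt k.+1%:R)^-1 * `|W k f w|)); last first.
    by apply/funext => w; rewrite subr0 WE normrM ger0_norm// invr_ge0.
  rewrite (ExZ (PN k) _ (bm_normr (bW k))) mulrC ler_wpM2r ?invr_ge0//.
  apply: (@le_trans _ _ (Ex (PN k) (fun w => 1 + W k f w ^+ 2))); last first.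
    by rewrite (ExD (PN k) (bm_cst 1) bW2) Ex_cst lerD2l.
  apply: Ex_le => [||w]; [exact: bm_normr|exact: bm_add (bm_cst _) bW2|].
  rewrite -(real_normK (num_real (W k f w))); move: (normr_ge0 (W k f w)).
  by set a := `|_|; nra.
- by apply: cvg0_scale; exact: cvg_inv_sqrt.
Qed.

Let bound_predictor p (f : F p -> R) : (0 < p)%N -> bm f ->
  l1_cvg PN (fun k => predictor K X G (xi k) f) (Defs.eta X G p f) ->
  l1_cvg PN (fun k => etaN (xi k) p f) (Defs.eta X G p f).
Proof.
move=> p0 hf hp; rewrite -[Defs.eta _ _ _ _]addr0.
apply: l1_cvg_ext (l1_cvg_add hp (l1_cvg_etaN_predictor p0 hf)) => k w.
by rewrite addrC subrK.
Qed.

Lemma potential_mean_bound p : (0 < p)%N -> exists a b : R, [/\ 0 < a, 0 < b &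
  forall L, mean_functional L -> a <= L (@G p) <= b].
Proof.
move=> p0; have [a [b [a0 b0 ab]]] := potential_bounds X hG p0.
have hGp := bm_potential X hG p0.
exists a, b; split=> // L hL; have [_ cst _] := hL.
rewrite -[X in X <= _ <= _]cst -[X in _ <= _ <= X]cst; apply/andP; split.
  by apply: (mean_le hL (bm_cst a) hGp) => y; have /andP[] := ab y.
by apply: (mean_le hL hGp (bm_cst b)) => y; have /andP[] := ab y.
Qed.

Let predictor_step p (f : F p.+2 -> R) : bm f ->
  (forall g, bm g ->
    l1_cvg PN (fun k => etaN (xi k) p.+1 g) (Defs.eta X G p.+1 g)) ->
  l1_cvg PN (fun k => predictor K X G (xi k) f) (Defs.eta X G p.+2 f).
Proof.
move=> hf IH; have [a [b [a0 b0 ab]]] := potential_mean_bound (ltn0Sn p).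
have hGp := bm_potential X hG (ltn0Sn p).
have hh := bm_mul hGp (bm_path_transition K hf).
rewrite (etaS hX hG (ltn0Sn p) hf); apply: l1_cvg_mul; first exact: IH.
apply: (l1_cvg_inv a0).
- by have /andP[h _] := ab _ (mean_eta X hG p.+1); exact: lt_le_trans h.
- by move=> k w; have /andP[] := ab _ (mean_etaN (xi k) (ltn0Sn k) p.+1 w).
- exact: IH.
Qed.

(** Induction on time: a predictor after time [1] is a quotient of empirical means one step earlier,
    and the empirical mean follows its predictor by [l1_cvg_etaN_predictor]. *)
Lemma l1_cvg_etaN p (f : F p -> R) : (0 < p)%N -> bm f ->
  l1_cvg PN (fun k => etaN (xi k) p f) (Defs.eta X G p f).
Proof.
case: p f => // p f _; elim: p f => [|p IH] f hf.
  apply: bound_predictor => //; exact: l1_cvg_cst.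
by apply: bound_predictor => //; exact: predictor_step.
Qed.

Lemma l1_cvg_predictor p (f : F p -> R) : (0 < p)%N -> bm f ->
  l1_cvg PN (fun k => predictor K X G (xi k) f) (Defs.eta X G p f).
Proof.
case: p f => // -[|p] f _ hf; first exact: l1_cvg_cst.
by apply: predictor_step => // g hg; exact: l1_cvg_etaN.
Qed.

Lemma l1_cvg_gammaN1 n : l1_cvg PN (fun k => gammaN1 G (xi k) n) (gamma X G n (cst 1)).
Proof.
case: n => [|n]; last first.
  have -> : gamma X G n.+1 (cst 1) = \prod_(1 <= p < n.+1) Defs.eta X G p (@G p).
    elim: n => [|n IH]; first by rewrite big_geq// gamma1_1.
    rewrite (gammaS hX hG)//; last exact: bm_cst.
    rewrite (_ : (fun y => _) = @G n.+1); last first.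
      by apply/funext => y; rewrite /path_transition (transition_cst _ 1) mulr1.
    rewrite big_nat_recr//= -IH /Defs.eta mulrC divfK// gt_eqF//.
    exact: (gamma1_gt0 X hG).
  apply: (l1_cvg_prod (V := fun p k => etaN (xi k) p (@G p))) => p /andP[p0 _].
  by apply: l1_cvg_etaN => //; exact: (bm_potential X hG).
rewrite (_ : gamma X G 0 (cst 1) = 1); last first.
  by rewrite gammaE//; under eq_Rintegral do rewrite /path_weight mulr1; rewrite Ex_cst.
by apply: l1_cvg_ext (l1_cvg_cst _ 1) => k w; rewrite /gammaN1 big_geq.
Qed.

(** Induction on time: given the past, the last fluctuation becomes the factor
    [expR (- (V k w / 2))], and [V k] tends to the constant [v] in L1, so this factor leaves the
    expectation and the earlier times remain. *)
Lemma particle_clt n (g : forall p, F p -> R) (th : R) :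
  (forall p, (0 < p <= n)%N -> bm (g p)) ->
  Ex (PN k) (fun w => cos (th + \sum_(1 <= p < n.+1) W k (g p) w)) @[k --> \oo] -->
  cos th * expR (- ((\sum_(1 <= p < n.+1) variance_of (Defs.eta X G p) (g p)) / 2)).
Proof.
elim: n => [|n IH] hg.
  rewrite big_geq// mul0r oppr0 expR0 mulr1.
  rewrite (_ : (fun k => _) = fun=> cos th); first exact: cvg_cst.
  apply/funext => k; rewrite -[RHS](Ex_cst (PN k)); congr Rintegral.
  by apply/funext => w; rewrite big_geq// addr0.
have hgn : bm (g n.+1) by apply: hg; rewrite /= leqnn.
have [c [c0 gc]] := bm_bound hgn.
have {}IH : Ex (PN k) (fun w => cos (th + \sum_(1 <= p < n.+1) W k (g p) w)) @[k --> \oo] -->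
  cos th * expR (- ((\sum_(1 <= p < n.+1) variance_of (Defs.eta X G p) (g p)) / 2)).
  by apply: IH => p /andP[p0 pn]; apply: hg; rewrite p0 ltnW.
set v := variance_of (Defs.eta X G n.+1) (g n.+1).
(* The earlier fluctuations enter as a phase that depends on the past. *)
pose a k w := th + \sum_(1 <= p < n.+1) W k (g p) w.
pose V k w := variance_of (fun u => predictor K X G (xi k) u w) (g n.+1).
have ma k : measurable_fun setT (a k : past (xi k) n -> R).
  apply: measurable_funD => //.
  rewrite (_ : (fun w => _) = fun w => \sum_(p <- index_iota 1 n.+1 | (0 < p <= n)%N) W k (g p) w).
    apply: bm_meas; apply: bm_sum => p pn.
    apply: (measurable_past_local_fluctuation K X hG (xi k) (ltn0Sn k) pn).
    by apply: hg; case/andP: pn => -> /leqW.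
  by apply/funext => w; rewrite big_nat.
have mca k : bm (fun w => cos (a k w)).
  by apply: (@bm_past_to _ _ _ _ _ _ _ (xi k) n); exact: bm_cos.
have hV : l1_cvg PN V v.
  have hg2 := bm_exp 2 hgn.
  apply: l1_cvg_sub; first exact: l1_cvg_predictor.
  have h := l1_cvg_predictor (ltn0Sn n) hgn.
  by rewrite expr2; apply: l1_cvg_ext (l1_cvg_mul h h) => k w; rewrite expr2.
have V0 k w : 0 <= V k w.
  exact: (variance_of_ge0 (mean_predictor K X hG (xi k) (ltn0Sn k) w (ltn0Sn n)) hgn).
have v0 : 0 <= v by exact: (variance_of_ge0 (mean_eta X hG n.+1) hgn).
have [bV _ V_v] := hV.
rewrite big_nat_recr//= -/v mulrDl opprD expRD mulrA.
have lim : Ex (PN k) (fun w => cos (a k w)) * expR (- (v / 2)) @[k --> \oo] -->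
    cos th * expR (- ((\sum_(1 <= p < n.+1) variance_of (Defs.eta X G p) (g p)) / 2)) *
    expR (- (v / 2)).
  by apply: cvgMl.
(* Two errors: the Lindeberg one, of order the inverse square root of [k.+1], and the replacement of
   [V k] by [v]. *)
apply: (le_cvg (w := fun k => (4 * c ^+ 3 + 3 * c ^+ 4) * (Num.sqrt k.+1%:R)^-1 +
    1 * Ex (PN k) (fun w => `|V k w - v|)) _ _ lim) => [k|].
- have h1 := local_lindeberg hG (ltn0Sn k) (hxi k) hgn gc (bm_cst 1)
    (fun _ => lexx `|1|) (ma k).
  rewrite normr1 mul1r in h1.
  rewrite mul1r.
  have bE : bm (fun w => expR (- (V k w / 2))).
    rewrite (_ : (fun w => _) = fun w => expR (- 2^-1 * V k w)); last first.
      by apply/funext => w; congr expR; ring.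
    by apply: bm_expR; exact: bm_scale.
  have h2 : `|Ex (PN k) (fun w => cos (a k w) * expR (- (V k w / 2))) -
      Ex (PN k) (fun w => cos (a k w)) * expR (- (v / 2))| <=
      Ex (PN k) (fun w => `|V k w - v|).
    have b1 := bm_mul (mca k) bE.
    have b2 := bm_scale (expR (- (v / 2))) (mca k).
    rewrite [X in _ - X]mulrC -(ExZ (PN k) _ (mca k)) -(ExB (PN k) b1 b2).
    apply: Ex_norm_le => [||w]; first exact: bm_sub.
      exact: bm_normr (bm_sub (bV k) (bm_cst v)).
    rewrite mulrC -mulrBl normrM.
    apply: (@le_trans _ _ (`|V k w - v| * 1)); last by rewrite mulr1.
    by rewrite ler_pM ?normr_ge0 ?norm_cos_le1 ?expRN_lip.
  apply: le_trans (lerD h1 h2).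
  rewrite -[leLHS](_ : `|(Ex (PN k) (fun w => 1 * cos (a k w + W k (g n.+1) w)) -
      Ex (PN k) (fun w => 1 * (cos (a k w) * expR (- (V k w / 2))))) +
    (Ex (PN k) (fun w => cos (a k w) * expR (- (V k w / 2))) -
      Ex (PN k) (fun w => cos (a k w)) * expR (- (v / 2)))| = _); first exact: ler_normD.
  congr `|_|; under eq_Rintegral do rewrite mul1r.
  under [in X in _ - X + _]eq_Rintegral do rewrite mul1r.
  rewrite addrA subrK; congr (_ - _); congr Rintegral; apply/funext => w.
  by rewrite big_nat_recr//= addrA.
- by apply: cvg0_lin => //; exact: cvg_inv_sqrt.
Qed.

End particle_limits.

Lemma cvg0_sum {R : realType} I (r : seq I) (u : I -> nat -> R) :
  (forall i, u i @ \oo --> 0) -> (fun k => \sum_(i <- r) u i k) @ \oo --> 0.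
Proof.
move=> u0; elim: r => [|i r IH].
  by rewrite (_ : (fun k => _) = fun=> 0); [exact: cvg_cst|apply/funext => k; rewrite big_nil].
rewrite (_ : (fun k => _) = fun k => 1 * u i k + 1 * \sum_(i <- r) u i k).
  exact: cvg0_lin.
by apply/funext => k; rewrite big_cons !mul1r.
Qed.

(** * Uniform moment bounds *)

Section moments.
Context {R : realType} {dT : nat -> measure_display}.
Context {T : forall k, measurableType (dT k)}.
Variable P : forall k, probability (T k) R.
Implicit Types (V U : forall k, T k -> R).

(** Even moments avoid absolute values; having all of them makes the class an algebra. *)
Definition moments_bounded V := (forall k, bm (V k)) /\
  forall m, exists C : R, forall k, Ex (P k) (fun w => V k w ^+ m.*2) <= C.

Let pow2_ge0 (x : R) m : 0 <= x ^+ m.*2.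
Proof. by rewrite -mul2n exprM exprn_ge0// sqr_ge0. Qed.

Let pow2_norm (x : R) m : x ^+ m.*2 = `|x| ^+ m.*2.
Proof. by rewrite -mul2n !exprM real_normK ?num_real. Qed.

Lemma moments_bounded_bound V M : (forall k, bm (V k)) ->
  (forall k w, `|V k w| <= M) -> moments_bounded V.
Proof.
move=> bV VM; split=> // m; exists (M ^+ m.*2) => k.
rewrite -[leRHS](Ex_cst (P k)); apply: Ex_le; [exact: bm_exp|exact: bm_cst|move=> w].
by rewrite pow2_norm lerXn2r ?nnegrE// (le_trans _ (VM k w)).
Qed.

Lemma moments_bounded_add V U : moments_bounded V -> moments_bounded U ->
  moments_bounded (fun k w => V k w + U k w).
Proof.
move=> [bV mV] [bU mU]; split=> [k|m]; first exact: bm_add.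
have [C VC] := mV m; have [D UD] := mU m.
exists (2 ^+ m.*2 * (C + D)) => k.
have b1 := bm_exp m.*2 (bV k); have b2 := bm_exp m.*2 (bU k).
apply: (@le_trans _ _ (2 ^+ m.*2 * Ex (P k) (fun w => V k w ^+ m.*2 + U k w ^+ m.*2))).
  rewrite -(ExZ (P k) _ (bm_add b1 b2)); apply: Ex_le.
  - exact: bm_exp (bm_add (bV k) (bU k)).
  - exact: bm_scale _ (bm_add b1 b2).
  - move=> w; rewrite pow2_norm [V k w ^+ _]pow2_norm [U k w ^+ _]pow2_norm.
    have [VU|/ltW UV] := leP `|V k w| `|U k w|.
      apply: (@le_trans _ _ ((2 * `|U k w|) ^+ m.*2)).
        rewrite lerXn2r ?nnegrE ?mulr_ge0// (le_trans (ler_normD _ _))//.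
        by rewrite mulrDl mul1r lerD.
      by rewrite exprMn ler_wpM2l ?exprn_ge0// lerDr exprn_ge0.
    apply: (@le_trans _ _ ((2 * `|V k w|) ^+ m.*2)).
      rewrite lerXn2r ?nnegrE ?mulr_ge0// (le_trans (ler_normD _ _))//.
      by rewrite mulrDl mul1r lerD.
    by rewrite exprMn ler_wpM2l ?exprn_ge0// lerDl exprn_ge0.
by rewrite ler_wpM2l ?exprn_ge0// (ExD (P k) b1 b2) lerD.
Qed.

Lemma moments_bounded_mul V U : moments_bounded V -> moments_bounded U ->
  moments_bounded (fun k w => V k w * U k w).
Proof.
move=> [bV mV] [bU mU]; split=> [k|m]; first exact: bm_mul.
(* A product costs twice the order: [(V U) ^ (2 m) <= V ^ (4 m) + U ^ (4 m)]. *)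
have [C VC] := mV m.*2; have [D UD] := mU m.*2.
exists (C + D) => k.
have b1 := bm_exp m.*2.*2 (bV k); have b2 := bm_exp m.*2.*2 (bU k).
apply: (@le_trans _ _ (Ex (P k) (fun w => V k w ^+ m.*2.*2 + U k w ^+ m.*2.*2))).
  apply: Ex_le; [exact: bm_exp (bm_mul (bV k) (bU k))|exact: bm_add|move=> w].
  rewrite -[m.*2.*2]muln2 !exprM exprMn.
  move: (V k w ^+ _) (U k w ^+ _) => x y.
  have := sqr_ge0 (x - y); have := sqr_ge0 x; have := sqr_ge0 y; nra.
by rewrite (ExD (P k) b1 b2) lerD.
Qed.

Lemma moments_bounded_cst c : moments_bounded (fun k _ => c).
Proof. by apply: (@moments_bounded_bound _ `|c|) => // k; exact: bm_cst. Qed.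

Lemma moments_bounded_sum I (r : seq I) (V : I -> forall k, T k -> R) :
  (forall i, moments_bounded (V i)) ->
  moments_bounded (fun k w => \sum_(i <- r) V i k w).
Proof.
move=> hV; elim: r => [|i r IH].
  rewrite (_ : (fun k w => _) = fun k w => 0); first exact: moments_bounded_cst.
  by apply/functional_extensionality_dep => k; apply/funext => w; rewrite big_nil.
rewrite (_ : (fun k w => _) = fun k w => V i k w + \sum_(i <- r) V i k w).
  exact: moments_bounded_add.
by apply/functional_extensionality_dep => k; apply/funext => w; rewrite big_cons.
Qed.

Lemma moments_bounded_prod I (r : seq I) (V : I -> forall k, T k -> R) :
  (forall i, moments_bounded (V i)) ->
  moments_bounded (fun k w => \prod_(i <- r) V i k w).
Proof.
move=> hV; elim: r => [|i r IH].
  rewrite (_ : (fun k w => _) = fun k w => 1); first exact: moments_bounded_cst.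
  by apply/functional_extensionality_dep => k; apply/funext => w; rewrite big_nil.
rewrite (_ : (fun k w => _) = fun k w => V i k w * \prod_(i <- r) V i k w).
  exact: moments_bounded_mul.
by apply/functional_extensionality_dep => k; apply/funext => w; rewrite big_cons.
Qed.

End moments.

Lemma measurable_norm_gt {R : realType} (A : R) : measurable [set x : R | A < `|x|].
Proof.
rewrite (_ : [set x | _] = Num.norm @^-1` `]A, +oo[); last first.
  by apply/seteqP; split => x /=; rewrite in_itv/= andbT.
by rewrite -[X in measurable X]setTI; exact: normr_measurable.
Qed.

Lemma chebyshev_indic {R : realType} {d} {T : measurableType d} (P : probability T R)
    (V : T -> R) (C A : R) : measurable_fun setT V -> 0 < A ->
  (\int[P]_w (V w ^+ 2)%:E <= C%:E)%E ->
  Ex P (fun w => \1_[set x : R | A < `|x|] (V w)) <= C / A ^+ 2.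
Proof.
move=> mV A0 VC.
have mA := measurable_norm_gt A.
have bi : bm (fun w => \1_[set x : R | A < `|x|] (V w) : R).
  by apply: bm_pre => //; exact: bm_indic.
have A20 : 0 < A ^+ 2 by rewrite exprn_gt0.
rewrite ler_pdivlMr// mulrC -lee_fin -(ExZ P _ bi) -Ex_EFin; last exact: bm_scale.
apply: le_trans VC; apply: ge0_le_integral => //.
- by move=> w _; rewrite lee_fin mulr_ge0 ?(ltW A20)// indicE.
- apply/measurable_EFinP; exact: bm_meas (bm_scale _ bi).
- by apply/measurable_EFinP; exact: measurable_funX.
- move=> w _; rewrite lee_fin indicE; have [/set_mem/= h|_] := boolP (_ \in _).
    rewrite mulr1 -[leRHS]real_normK ?num_real// lerXn2r ?nnegrE ?(ltW A0)//.
    exact: ltW.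
  by rewrite mulr0 sqr_ge0.
Qed.

(** * Tail estimates *)

Section tails.
Context {R : realType}.

Lemma le_tail {d} {T : measurableType d} (P : probability T R) (V : T -> R) (A B : R) :
  measurable_fun setT V -> A <= B ->
  Ex P (fun w => \1_[set x : R | B < `|x|] (V w)) <=
  Ex P (fun w => \1_[set x : R | A < `|x|] (V w)).
Proof.
move=> mV AB; apply: Ex_le => [||w].
- by apply: bm_pre => //; apply: bm_indic; exact: measurable_norm_gt.
- by apply: bm_pre => //; apply: bm_indic; exact: measurable_norm_gt.
- rewrite !indicE; have [/set_mem /= Bx|//] := boolP (V w \in _).
  by rewrite mem_set//= (le_lt_trans AB).
Qed.

(** A single real random variable is tight, by continuity of [P] along decreasing events with empty
    intersection. *)
Lemma tail_small {d} {T : measurableType d} (P : probability T R) (V : T -> R) (e : R) :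
  measurable_fun setT V -> 0 < e ->
  exists A : R, Ex P (fun w => \1_[set x : R | A < `|x|] (V w)) <= e.
Proof.
move=> mV e0.
pose F (n : nat) := V @^-1` [set x : R | n%:R < `|x|].
have mF n : measurable (F n).
  by rewrite -[X in measurable X]setTI; apply: mV => //; exact: measurable_norm_gt.
have F0 : \bigcap_n F n = set0.
  apply/seteqP; split=> // w /= h.
  have [n hn] : exists n : nat, `|V w| <= n%:R.
    by exists (Num.bound `|V w|); rewrite ltW// archi_boundP.
  by have := h n I; rewrite /F /= ltNge hn.
have dF : nonincreasing_seq F.
  move=> m n mn; rewrite subsetEset => w /=; apply: le_lt_trans.
  by rewrite ler_nat.
have := @nonincreasing_cvg_mu _ _ _ P F _ mF _ dF.
rewrite F0 measure0 => h.
have {}h : P (F n) @[n --> \oo] --> 0%E.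
  by apply: h => //; rewrite -ge0_fin_numE// fin_num_measure.
have /fine_cvgP[_ /cvgrPdist_le /(_ e e0)] := h.
move=> [n _ /(_ n (leqnn _))] /=.
rewrite sub0r normrN => he; exists n%:R.
rewrite Ex_pre//; last exact: measurable_norm_gt.
exact: le_trans (ler_norm _) he.
Qed.

Lemma moments_bounded_tail {dT : nat -> measure_display}
    {T : forall k, measurableType (dT k)} (P : forall k, probability (T k) R)
    (V : forall k, T k -> R) (e : R) : moments_bounded P V -> 0 < e ->
  exists A : R, forall k, Ex (P k) (fun w => \1_[set x : R | A < `|x|] (V k w)) <= e.
Proof.
move=> [bV mV] e0; have [C VC] := mV 1%N.
have C0 : 0 <= C by apply: le_trans (VC 0%N); apply: Ex_ge0 => w; exact: sqr_ge0.
have Ce0 : 0 <= C / e by rewrite divr_ge0// ltW.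
have A0 : 0 < C / e + 1 by rewrite ltr_wpDl.
(* With [A = C / e + 1] one has [C <= e * A <= e * A ^ 2]. *)
exists (C / e + 1) => k.
have V2 : (\int[P k]_w (V k w ^+ 2)%:E <= C%:E)%E.
  by rewrite Ex_EFin ?lee_fin; [exact: VC|exact: bm_exp].
apply: (le_trans (chebyshev_indic (bm_meas (bV k)) A0 V2)).
rewrite ler_pdivrMr ?exprn_gt0//.
rewrite -[leLHS](_ : e * (C / e) = C); last by field; rewrite gt_eqF.
by rewrite ler_pM2l//; move: Ce0; set x := C / e; nra.
Qed.

End tails.

Lemma mean_sum {R : realType} {d} {Y : measurableType d} (L : (Y -> R) -> R) I (r : seq I)
    (c : I -> R) (f : I -> Y -> R) : mean_functional L ->
  (forall i, bm (f i)) ->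
  L (fun y => \sum_(i <- r) c i * f i y) = \sum_(i <- r) c i * L (f i).
Proof.
move=> hL hf; have [lin cst _] := hL; elim: r => [|i r IH].
  by rewrite big_nil -(cst 0); congr L; apply/funext => y; rewrite big_nil.
rewrite big_cons -IH -lin; first by congr L; apply/funext => y; rewrite big_cons.
  exact: hf.
by apply: bm_sum => j _; exact: bm_scale.
Qed.

Lemma mean_sub {R : realType} {d} {Y : measurableType d} (L : (Y -> R) -> R) f g :
  mean_functional L -> bm f -> bm g ->
  L (fun y => f y - g y) = L f - L g.
Proof.
move=> hL hf hg; rewrite -mulN1r -(mean_scale hL (-1) hg) -(mean_add hL hf (bm_scale _ hg)).
by congr L; apply/funext => y; rewrite mulN1r.
Qed.

Lemma mean_covariance {R : realType} {d} {Y : measurableType d} (L : (Y -> R) -> R) f g :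
  mean_functional L -> bm f -> bm g ->
  L (fun y => (f y - L f) * (g y - L g)) = L (fun y => f y * g y) - L f * L g.
Proof.
move=> hL hf hg; have [_ cst _] := hL.
have bfg := bm_mul hf hg.
have b1 := bm_scale (L g) hf; have b2 := bm_scale (L f) hg.
rewrite (_ : (fun y => _) = fun y => (f y * g y - L g * f y) - (L f * g y - L f * L g)); last first.
  by apply/funext => y; ring.
rewrite (mean_sub hL (bm_sub bfg b1) (bm_sub b2 (bm_cst _))).
rewrite (mean_sub hL bfg b1) (mean_sub hL b2 (bm_cst _)) cst.
rewrite (mean_scale hL _ hf) (mean_scale hL _ hg); ring.
Qed.

Lemma variance_of_sum {R : realType} {d} {Y : measurableType d} (L : (Y -> R) -> R) m
    (c : 'I_m -> R) (f : 'I_m -> Y -> R) : mean_functional L ->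
  (forall i, bm (f i)) ->
  variance_of L (fun y => \sum_i c i * f i y) =
  \sum_i \sum_j c i * c j * (L (fun y => f i y * f j y) - L (f i) * L (f j)).
Proof.
move=> hL hf; rewrite /variance_of.
rewrite (_ : (fun y => _ ^+ 2) =
    fun y => \sum_i c i * (\sum_j c j * (f i y * f j y))); last first.
  apply/funext => y; rewrite expr2 mulr_suml; apply: eq_bigr => i _.
  rewrite -mulrA; congr (_ * _); rewrite mulr_sumr.
  by apply: eq_bigr => j _; rewrite mulrCA.
have bff i j := bm_mul (hf i) (hf j).
rewrite (mean_sum (f := fun i y => \sum_j c j * (f i y * f j y)) _ _ hL); last first.
  by move=> i; apply: bm_sum => j _; exact: bm_scale.
rewrite (mean_sum _ _ hL hf) expr2 mulr_suml -sumrB; apply: eq_bigr => i _.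
rewrite (mean_sum (f := fun j y => f i y * f j y) _ _ hL)// !mulr_sumr -sumrB.
by apply: eq_bigr => j _; ring.
Qed.

(** * Joint limits of weighted fluctuations *)

Section joint_limits.
Context {R : realType} {dE : nat -> measure_display}
  {E : forall n, measurableType (dE n)}.
Local Notation F := (path_space E).
Variables (K : forall n, R.-pker E n ~> E n.+1) (x0 : E 0%N).
Context {dO : measure_display} {Omega : measurableType dO}
  {P : probability Omega R} (X : forall n, {RV P >-> E n}).
Hypothesis hX : is_markov_chain K x0 X.
Variables (G : forall n, F n -> R).
Hypothesis hG : is_potential G.
Context {dT : nat -> measure_display} {T : forall k, measurableType (dT k)}
  {PN : forall k, probability (T k) R}
  (xi : forall k n, 'I_k.+1 -> {RV (PN k) >-> F n}).
Arguments xi : clear implicits.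
Hypothesis hxi : forall k, is_particle_system K X G (xi k).

Local Notation W k g := (local_fluctuation K X G (xi k) g).
Local Notation N0 k := (ltn0Sn k).

Lemma moments_bounded_local_fluctuation p (g : F p -> R) : (0 < p)%N ->
  bm g -> moments_bounded PN (fun k => W k g).
Proof.
move=> p0 hg; split=> [k|m]; first exact: bm_local_fluctuation.
case: p g p0 hg => // p g _ hg; have [c [c0 gc]] := bm_bound hg.
exists ((m.*2)`!%:R * (2 * expR ((2 * c) ^+ 2 * expR (2 * c)))) => k.
exact: (local_moment hG (ltn0Sn k) (hxi k) m hg gc).
Qed.

Lemma moments_bounded_l1_cvg V c : l1_cvg PN V c -> moments_bounded PN V.
Proof. by move=> [bV [M VM] _]; exact: moments_bounded_bound VM. Qed.

Lemma local_fluctuation_sum k p I (r : seq I) (c : I -> R) (g : I -> F p -> R) w :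
  (0 < p)%N -> (forall i, bm (g i)) ->
  W k (fun y => \sum_(i <- r) c i * g i y) w = \sum_(i <- r) c i * W k (g i) w.
Proof.
move=> p0 hg; rewrite /local_fluctuation.
rewrite (mean_sum _ _ (mean_etaN (xi k) (N0 k) p w) hg).
rewrite (mean_sum _ _ (mean_predictor K X hG (xi k) (N0 k) w p0) hg).
rewrite -sumrB mulr_sumr; apply: eq_bigr => i _; ring.
Qed.

Section weighted_fluctuations.
Context {n d : nat}.
Variables (g : 'I_d -> forall p, F p -> R) (A : 'I_d -> forall k, T k -> R).
Arguments g : clear implicits.
Arguments A : clear implicits.
Hypothesis hg : forall i p, (0 < p <= n)%N -> bm (g i p).
Hypothesis A1 : forall i, l1_cvg PN (A i) 1.

(** Common form of both kinds of particle fields: [A i] is to be [1] for [gamma] and a ratio of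
    normalising constants for [eta]; either way it tends to [1]. *)
Definition weighted_fluctuation i k w :=
  A i k w * \sum_(1 <= p < n.+1) gammaN1 G (xi k) p w * W k (g i p) w.

Arguments weighted_fluctuation : clear implicits.

(** The random weights at time [p] are replaced by their limits, and the linear combination of
    fluctuations is collected into the fluctuation of one function. *)
Definition limit_function (t : 'I_d -> R) p (y : F p) :=
  \sum_i (t i * gamma X G p (cst 1)) * g i p y.

Arguments limit_function : clear implicits.

Lemma moments_bounded_weighted_fluctuation i :
  moments_bounded PN (weighted_fluctuation i).
Proof.
apply: moments_bounded_mul; first exact: moments_bounded_l1_cvg (A1 i).
rewrite (_ : (fun k w => _) = fun k w => \sum_(p < n)
    gammaN1 G (xi k) p.+1 w * W k (g i p.+1) w); last first.
  apply/functional_extensionality_dep => k; apply/funext => w.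
  by rewrite big_add1 /= big_mkord.
apply: moments_bounded_sum => p; apply: moments_bounded_mul.
  exact: moments_bounded_l1_cvg (l1_cvg_gammaN1 hX hG hxi p.+1).
by apply: moments_bounded_local_fluctuation => //; apply: hg; rewrite /= ltn_ord.
Qed.

(** A Slutsky argument: replacing the weights by their limits changes the sum by a null sequence in
    L1, the fluctuations being bounded in L2, and the cosine is 1-Lipschitz. Local fluctuations are
    linear, so [particle_clt] then applies to the combined functions. *)
Lemma cvg_weighted_fluctuations (th : R) (t : 'I_d -> R) :
  Ex (PN k) (fun w => cos (th + \sum_i t i * weighted_fluctuation i k w)) @[k --> \oo] -->
  cos th * expR (- ((\sum_(1 <= p < n.+1)
    variance_of (Defs.eta X G p) (limit_function t p)) / 2)).
Proof.
have bh p : (0 < p <= n)%N -> bm (limit_function t p).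
  by move=> pn; apply: bm_sum => i _; apply: bm_scale; exact: hg.
have bW i p k : (0 < p <= n)%N -> bm (W k (g i p)).
  by move=> pn; apply: (bm_local_fluctuation K X hG (xi k) (N0 k)); [case/andP: pn|exact: hg].
have bhW p k : (0 < p <= n)%N -> bm (W k (limit_function t p)).
  by move=> pn; apply: (bm_local_fluctuation K X hG (xi k) (N0 k)); [case/andP: pn|exact: bh].
(* The error of replacing the random weight by its limit in one term. *)
pose D i (p : 'I_n) k w :=
  (A i k w * gammaN1 G (xi k) p.+1 w - 1 * gamma X G p.+1 (cst 1)) * W k (g i p.+1) w.
have D0 i p : Ex (PN k) (fun w => `|D i p k w|) @[k --> \oo] --> 0.
  have pn : (0 < p.+1 <= n)%N by rewrite /= ltn_ord.
  have [C WC] := local_fluctuation_bound2 hG hxi (ltn0Sn p) (hg i pn).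
  apply: (l1_cvg_mul_null (l1_cvg_mul (A1 i) (l1_cvg_gammaN1 hX hG hxi p.+1)) _ WC) => k.
  exact: bW.
have bD i p k : bm (D i p k).
  have pn : (0 < p.+1 <= n)%N by rewrite /= ltn_ord.
  apply: bm_mul; last exact: bW.
  have [b _ _] := l1_cvg_mul (A1 i) (l1_cvg_gammaN1 hX hG hxi p.+1).
  exact: bm_sub (b k) (bm_cst _).
have bZ k : bm (fun w => \sum_i t i * weighted_fluctuation i k w).
  by apply: bm_sum => i _; apply: bm_scale; have [+ _] := moments_bounded_weighted_fluctuation i.
have bS k : bm (fun w => \sum_(1 <= p < n.+1) W k (limit_function t p) w).
  under eq_fun do rewrite big_add1 /= big_mkord.
  by apply: bm_sum => p _; apply: bhW; rewrite /= ltn_ord.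
have limW (p : 'I_n) k w : W k (limit_function t p.+1) w =
    \sum_i (t i * gamma X G p.+1 (cst 1)) * W k (g i p.+1) w.
  by apply: local_fluctuation_sum => // i; apply: hg; rewrite /= ltn_ord.
have ZS k w : (\sum_i t i * weighted_fluctuation i k w) -
    \sum_(1 <= p < n.+1) W k (limit_function t p) w =
    \sum_i \sum_(p < n) t i * D i p k w.
  rewrite big_add1 /= big_mkord (eq_bigr _ (fun p _ => limW p k w)) exchange_big /=.
  rewrite -sumrB; apply: eq_bigr => i _.
  rewrite /weighted_fluctuation big_add1 /= big_mkord !mulr_sumr -sumrB.
  by apply: eq_bigr => p _; rewrite /D; ring.
apply: (le_cvg (w := fun k => \sum_i \sum_(p < n) `|t i| * Ex (PN k) (fun w => `|D i p k w|))
  _ _ (particle_clt hX hG hxi bh)) => [k|]; last first.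
  by apply: cvg0_sum => i; apply: cvg0_sum => p; apply: cvg0_scale; exact: D0.
have bDn i p := bm_normr (bD i p k).
have bDs i : bm (fun w => \sum_(p < n) `|t i| * `|D i p k w|).
  by apply: bm_sum => p _; exact: bm_scale.
have bc1 : bm (fun w => cos (th + \sum_i t i * weighted_fluctuation i k w)).
  by apply: bm_cos; apply: bm_meas; exact: bm_add (bm_cst th) (bZ k).
have bc2 : bm (fun w => cos (th + \sum_(1 <= p < n.+1) W k (limit_function t p) w)).
  by apply: bm_cos; apply: bm_meas; exact: bm_add (bm_cst th) (bS k).
rewrite -(ExB (PN k) bc1 bc2).
apply: (@le_trans _ _ (Ex (PN k) (fun w => \sum_i \sum_(p < n) `|t i| * `|D i p k w|))).
  apply: Ex_norm_le => [||w]; first exact: bm_sub.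
    by apply: bm_sum => i _; exact: bDs.
  apply: (le_trans (cos_lip _ _)); rewrite opprD addrACA subrr add0r ZS.
  apply: (le_trans (ler_norm_sum _ _ _)); apply: ler_sum => i _.
  apply: (le_trans (ler_norm_sum _ _ _)); apply: ler_sum => p _.
  by rewrite normrM.
rewrite (Ex_sum (PN k) _ bDs); apply: ler_sum => i _.
rewrite (Ex_sum (PN k) _ (fun p => bm_scale `|t i| (bDn i p))); apply: ler_sum => p _.
by rewrite (ExZ (PN k) _ (bDn i p)).
Qed.

End weighted_fluctuations.
End joint_limits.

(** * The limiting Gaussian fields *)

Section gaussian_side.
Context {R : realType} {dE : nat -> measure_display}
  {E : forall n, measurableType (dE n)}.
Local Notation F := (path_space E).
Variables (K : forall n, R.-pker E n ~> E n.+1) (x0 : E 0%N).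
Context {dO : measure_display} {Omega : measurableType dO}
  {P : probability Omega R} (X : forall n, {RV P >-> E n}).
Hypothesis hX : is_markov_chain K x0 X.
Variables (G : forall n, F n -> R).
Hypothesis hG : is_potential G.
Variable Q : forall p n, (F n -> R) -> F p -> R.
Arguments Q : clear implicits.
Hypothesis hQ : is_fk_semigroup X G Q.
Context {dS : measure_display} {S : measurableType dS} (PS : probability S R).
Variable W : forall p, (F p -> R) -> S -> R.
Arguments W : clear implicits.
Variable n : nat.
Hypothesis hW : is_fk_gaussian_family X G PS W n.

Lemma measurable_field p f : (0 < p <= n)%N -> bm f ->
  measurable_fun setT (W p f).
Proof.
move=> pn hf; have [/(_ p pn)[gW _] _] := hW.
have [mW _] := gW 1%N (fun=> f) (fun=> 1) (fun=> hf).
rewrite (_ : W p f = fun w => \sum_(j < 1) 1 * W p f w)//.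
by apply/funext => w; rewrite big_ord1 mul1r.
Qed.

Lemma field_sigma_algebra_measurable p : (0 < p <= n)%N ->
  field_sigma_algebra W p `<=` measurable.
Proof.
move=> pn; apply: smallest_sub; first exact: sigma_algebra_measurable.
move=> _ [f [A [hf mA ->]]]; rewrite -[X in measurable X]setTI.
exact: measurable_field.
Qed.

(** Since [W p] need not be linear, a combination of its values is placed in its sigma-algebra
    directly, through measurability of sums. *)
Lemma field_sigma_algebra_sum p m (c : 'I_m -> R) (f : 'I_m -> F p -> R) A :
  (forall i, bm (f i)) -> measurable A ->
  field_sigma_algebra W p ((fun w => \sum_i c i * W p (f i) w) @^-1` A).
Proof.
move=> hf mA.
pose gen := [set B | exists (f : F p -> R) (A : set R),
        [/\ bm f, measurable A & B = W p f @^-1` A]].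
have mWf i : measurable_fun setT (W p (f i) : g_sigma_algebraType gen -> R).
  move=> _ B mB; rewrite setTI; apply: sub_sigma_algebra.
  by exists (f i), B.
have ms : measurable_fun setT
    ((fun w => \sum_i c i * W p (f i) w) : g_sigma_algebraType gen -> R).
  by apply: measurable_sum => i; apply: measurable_funM.
by have := ms measurableT A mA; rewrite setTI.
Qed.

Section joint.
Context {d : nat} (f : 'I_d -> F n -> R) (g : 'I_d -> forall p, F p -> R).
Arguments g : clear implicits.
Hypothesis hf : forall i, bm (f i).
Hypothesis gn : forall i, g i n = f i.
Hypothesis hg : forall i p, (0 < p <= n)%N -> bm (g i p).
Hypothesis gS : forall i p, (0 < p < n)%N ->
  g i p = fun y => G y * path_transition K (g i p.+1) y.

(** The covariance involves the functions [Q p n (f i)] in pairs. [eta_semigroup] exchanges them for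
    [g i p] one factor at a time, so the variance is the one met on the particle side. *)
Lemma semigroup_variance p (c : 'I_d -> R) : (0 < p <= n)%N ->
  ('E_PS[fun w => ((\sum_i c i * W p (Q p n (f i)) w) *
    (\sum_i c i * W p (Q p n (f i)) w))%R] =
  (variance_of (Defs.eta X G p) (fun y => \sum_i c i * g i p y))%:E)%E.
Proof.
move=> pn; have [/(_ p pn)[_ cov] _] := hW.
have bQ i : bm (Q p n (f i)) := semigroup_bm (hf i) hQ pn.
have L := mean_eta X hG p.
have covE i j : ('E_PS[fun w => (W p (Q p n (f i)) w * W p (Q p n (f j)) w)%R] =
    (Defs.eta X G p (fun y => g i p y * g j p y) -
      Defs.eta X G p (g i p) * Defs.eta X G p (g j p))%:E)%E.
  rewrite cov// (mean_covariance L (bQ i) (bQ j)).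
  have sg i' psi : bm psi ->
      Defs.eta X G p (fun y => psi y * Q p n (f i') y) =
      Defs.eta X G p (fun y => psi y * g i' p y).
    exact: (eta_semigroup hX hG (hf i') (gn i') (hg i') (gS i') hQ pn).
  have sg1 i' : Defs.eta X G p (Q p n (f i')) = Defs.eta X G p (g i' p).
    have := sg i' _ (bm_cst 1).
    by under eq_fun do rewrite mul1r; under [in RHS]eq_fun do rewrite mul1r.
  (* After commuting, the factor already equal to a [g] serves as test function for the other
     one. *)
  rewrite !sg1 sg//; under eq_fun do rewrite mulrC.
  rewrite sg; last exact: hg.
  by congr (_ - _)%:E; congr Defs.eta; apply/funext => y; rewrite mulrC.
rewrite (expectation_quadratic c _ covE); last by move=> i; exact: measurable_field.
by rewrite (variance_of_sum _ L)// => i; exact: hg.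
Qed.

(** Exchanging the sums over functions and times leaves one Gaussian variable per time; these are
    independent, with the variances of [semigroup_variance]. *)
Lemma Wgamma_char_fun (th : R) (t : 'I_d -> R) :
  Ex PS (fun w => cos (th + \sum_i t i * Wgamma X G W Q n (f i) w)) =
  cos th * expR (- ((\sum_(1 <= p < n.+1)
    variance_of (Defs.eta X G p) (limit_function X G g t (p := p))) / 2)).
Proof.
pose U p w := \sum_i (t i * gamma X G p (cst 1)) * W p (Q p n (f i)) w.
have bQ i p : (0 < p <= n)%N -> bm (Q p n (f i)).
  by move=> pn; exact: (semigroup_bm (hf i) hQ pn).
have [hW1 indep] := hW.
have := @independent_gaussian_sum _ _ _ PS n (field_sigma_algebra W) U
  (fun p => variance_of (Defs.eta X G p) (limit_function X G g t (p := p))).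
move=> main.
have -> : (fun w => cos (th + \sum_i t i * Wgamma X G W Q n (f i) w)) =
    (fun w => cos (th + \sum_(1 <= p < n.+1) U p w)).
  apply/funext => w; congr (cos (_ + _)); rewrite /U exchange_big /=.
  apply: eq_bigr => i _; rewrite /Wgamma mulr_sumr.
  by apply: eq_bigr => p _; rewrite mulrA.
rewrite mulr_suml main//.
- by move=> p pn; exact: field_sigma_algebra_measurable.
- move=> p pn; exact: (@measurableT _ (g_sigma_algebraType _)).
- by move=> p pn A mA; apply: field_sigma_algebra_sum => // i; exact: bQ.
- move=> p pn th'; apply: centered_gaussian_char_fun.
    by have [gW _] := hW1 p pn; apply: gW => i; exact: bQ.
  exact: semigroup_variance.
Qed.

Lemma measurable_Wgamma i : measurable_fun setT (Wgamma X G W Q n (f i)).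
Proof.
rewrite /Wgamma; under eq_fun do rewrite big_add1 /= big_mkord.
apply: measurable_sum => p; apply: measurable_funM => //.
have pn : (0 < p.+1 <= n)%N by rewrite /= ltn_ord.
by apply: measurable_field => //; exact: (semigroup_bm (hf i) hQ pn).
Qed.

End joint.
End gaussian_side.

(** * Limits of the products of both kinds of fields *)

Section product_limits.
Context {R : realType} {dE : nat -> measure_display}
  {E : forall n, measurableType (dE n)}.
Local Notation F := (path_space E).
Variables (K : forall n, R.-pker E n ~> E n.+1) (x0 : E 0%N).
Context {dO : measure_display} {Omega : measurableType dO}
  {P : probability Omega R} (X : forall n, {RV P >-> E n}).
Hypothesis hX : is_markov_chain K x0 X.
Variables (G : forall n, F n -> R).
Hypothesis hG : is_potential G.
Variable Q : forall p n, (F n -> R) -> F p -> R.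
Arguments Q : clear implicits.
Hypothesis hQ : is_fk_semigroup X G Q.
Context {dT : nat -> measure_display} {T : forall k, measurableType (dT k)}
  {PN : forall k, probability (T k) R}
  (xi : forall k n, 'I_k.+1 -> {RV (PN k) >-> F n}).
Arguments xi : clear implicits.
Hypothesis hxi : forall k, is_particle_system K X G (xi k).
Variable n : nat.
Hypothesis n0 : (0 < n)%N.
Context {dS : measure_display} {S : measurableType dS} (PS : probability S R).
Variable W : forall p, (F p -> R) -> S -> R.
Arguments W : clear implicits.
Hypothesis hW : is_fk_gaussian_family X G PS W n.
Context {d : nat} (f : 'I_d -> F n -> R) (nu : 'I_d -> fk_kind).
Hypothesis hf : forall i, bm (f i).

Local Notation N0 k := (ltn0Sn k).
Local Notation g1 := (gamma X G n (cst 1)).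

Definition particle_field i k w :=
  match nu i with
  | GammaKind => WgammaN X G (xi k) n (f i) w
  | EtaKind => WetaN X G (xi k) n (f i) w
  end.
Arguments particle_field : clear implicits.

Definition gaussian_field i w :=
  match nu i with
  | GammaKind => Wgamma X G W Q n (f i) w
  | EtaKind => Weta X G W Q n (f i) w
  end.

(** At this argument the [eta] fields become [gamma] fields, exactly for the limit and up to the
    factor [A] for the particles. *)
Let f' i y := match nu i with
  | GammaKind => f i y
  | EtaKind => g1^-1 * (f i y - Defs.eta X G n (f i))
  end.

Let bf' i : bm (f' i).
Proof.
rewrite /f'; case: (nu i); first exact: hf.
by apply: bm_scale; apply: bm_sub => //; exact: bm_cst.
Qed.

Let A i k w := match nu i with
  | GammaKind => 1
  | EtaKind => g1 / gammaN1 G (xi k) n w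
  end.

(** The bound is drawn from the potentials alone and is therefore uniform in [k], as the L1
    convergence of the inverse of [gammaN1] requires. *)
Let gammaN1_lower_bound m : exists a : R, 0 < a /\
  forall k w, a <= gammaN1 G (xi k) m w.
Proof.
case: m => [|m]; first by exists 1; split=> // k w; rewrite /gammaN1 big_geq.
elim: m => [|m [a [a0 ag]]].
  by exists 1; split=> // k w; rewrite /gammaN1 big_geq.
have [b [c [b0 c0 bc]]] := potential_mean_bound X hG (ltn0Sn m).
exists (a * b); split=> [|k w]; first exact: mulr_gt0.
rewrite /gammaN1 big_nat_recr//=; apply: ler_pM; [exact: ltW..|exact: ag|].
by have /andP[] := bc _ (mean_etaN (xi k) (N0 k) m.+1 w).
Qed.

Let A1 i : l1_cvg PN (A i) 1.
Proof.
rewrite /A; case: (nu i); first exact: l1_cvg_cst.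
have g10 : 0 < g1 by exact: (gamma1_gt0 X hG).
have [a [a0 ag]] := gammaN1_lower_bound n.
rewrite -[X in l1_cvg _ _ X](divff (lt0r_neq0 g10)); apply: l1_cvg_scale.
exact: (l1_cvg_inv a0 g10 ag (l1_cvg_gammaN1 hX hG hxi n)).
Qed.

(** One family [g] describes the particle fields pointwise and also gives the characteristic
    function of the Gaussian fields, which identifies the two limits. *)
Lemma fields_weighted_fluctuation : exists g : 'I_d -> forall p, F p -> R,
  [/\ forall i p, (0 < p <= n)%N -> bm (g i p),
      forall i k w, particle_field i k w = weighted_fluctuation K X G xi (n := n) g A i w &
      forall (th : R) (t : 'I_d -> R),
        Ex PS (fun w => cos (th + \sum_i t i * gaussian_field i w)) =
        cos th * expR (- ((\sum_(1 <= p < n.+1)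
          variance_of (Defs.eta X G p) (limit_function X G g t (p := p))) / 2))].
Proof.
have /choice[g hg] := fun i => feynman_kac_family K X hG n0 (bf' i).
have gn i : g i n = f' i by have [] := hg i.
have bg i : forall p, (0 < p <= n)%N -> bm (g i p) by have [] := hg i.
have gS i : forall p, (0 < p < n)%N ->
  g i p = fun y => G y * path_transition K (g i p.+1) y by have [] := hg i.
exists g; split => //.
- move=> i k w; rewrite /weighted_fluctuation.
  rewrite -(gammaN_decomposition hX hG (xi k) (N0 k) w n0 (gn i) (bg i) (gS i)).
  rewrite /particle_field /A /f'; case: (nu i); first by rewrite mul1r.
  by rewrite (WetaN_WgammaN X hG (xi k) (N0 k))//.
- move=> th t.
  rewrite -(Wgamma_char_fun hX hG hQ hW (f := f') bf' gn bg gS).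
  congr Rintegral; apply/funext => w; congr (cos (_ + _)); apply: eq_bigr => i _.
  congr (_ * _); rewrite /gaussian_field /f' /Weta.
  by case: (nu i).
Qed.

Lemma measurable_gaussian_field i : measurable_fun setT (gaussian_field i).
Proof.
have := measurable_Wgamma hQ hW bf' i.
by rewrite /gaussian_field /f' /Weta; case: (nu i).
Qed.

Lemma moments_bounded_particle_field i : moments_bounded PN (particle_field i).
Proof.
have [g [bg ZE _]] := fields_weighted_fluctuation.
rewrite (_ : particle_field i = fun k => weighted_fluctuation K X G xi (n := n) g A i (k := k)).
  exact: (moments_bounded_weighted_fluctuation hX hG hxi bg A1 i).
by apply/functional_extensionality_dep => k; apply/funext => w; exact: ZE.
Qed.

(** Tightness comes from uniform moments on the particle side, and from having finitely many fixed
    variables on the Gaussian side. *)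
Lemma cvg_law_product (h : R -> R) : continuous h -> bounded_fun h ->
  Ex (PN k) (fun w => h (\prod_i particle_field i k w)) @[k --> \oo] -->
  Ex PS (fun w => h (\prod_i gaussian_field i w)).
Proof.
have mZ i := moments_bounded_particle_field i.
have mU i := measurable_gaussian_field i.
apply: (cvg_prod_law (V := fun k i => particle_field i k)) => //.
- by move=> k i; apply: bm_meas; have [] := mZ i.
- move=> th t; have [g [bg ZE ->]] := fields_weighted_fluctuation.
  rewrite (_ : (fun k => _) = fun k => Ex (PN k) (fun w => cos (th + \sum_i t i *
      weighted_fluctuation K X G xi (n := n) g A i w))).
    exact: (cvg_weighted_fluctuations hX hG hxi bg A1).
  apply/funext => k; congr Rintegral; apply/funext => w; congr (cos (_ + _)).
  by apply: eq_bigr => i _; rewrite ZE.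
- move=> e e0.
  have /choice[a ha] := fun i => moments_bounded_tail (mZ i) e0.
  have /choice[b hb] := fun i => tail_small PS (mU i) e0.
  (* A single threshold above all the individual ones, for both sides. *)
  have ab i : a i <= \sum_j (`|a j| + `|b j|) /\ b i <= \sum_j (`|a j| + `|b j|).
    rewrite (bigD1 i)//= [`|_| + _]addrC -addrA.
    have s0 : 0 <= \sum_(j | j != i) (`|a j| + `|b j|).
      by apply: sumr_ge0 => j _; rewrite addr_ge0.
    move: (ler_norm (a i)) (ler_norm (b i)) (normr_ge0 (a i)) (normr_ge0 (b i)) s0.
    set s := \sum_(j | _) _ => *; split; lra.
  exists (\sum_j (`|a j| + `|b j|)); split => [k i|i].
    apply: le_trans (ha i k); apply: le_tail; last exact: (ab i).1.
    by apply: bm_meas; have [] := mZ i.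
  by apply: le_trans (hb i); apply: le_tail => //; exact: (ab i).2.
Qed.

Let product_moment2 : exists C : R, forall k,
  Ex (PN k) (fun w => (\prod_i particle_field i k w) ^+ 2) <= C.
Proof.
have [_ /(_ 1%N)] := moments_bounded_prod (index_enum 'I_d) moments_bounded_particle_field.
by [].
Qed.

Lemma bm_product_particle_field k : bm (fun w => \prod_i particle_field i k w).
Proof. by apply: bm_prod => i _; have [] := moments_bounded_particle_field i. Qed.

Let mprod : measurable_fun setT (fun w => \prod_i gaussian_field i w).
Proof. by apply: measurable_prod => i _; exact: measurable_gaussian_field. Qed.

Lemma integrable_product_gaussian_field :
  PS.-integrable setT (EFin \o (fun w => \prod_i gaussian_field i w)).
Proof.
have [C hC] := product_moment2.
exact: (integrable_limit bm_product_particle_field mprod cvg_law_product hC).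
Qed.

Lemma cvg_expectation_product :
  Ex (PN k) (fun w => \prod_i particle_field i k w) @[k --> \oo] -->
  Ex PS (fun w => \prod_i gaussian_field i w).
Proof.
have [C hC] := product_moment2.
exact: (cvg_moment bm_product_particle_field mprod cvg_law_product hC).
Qed.

End product_limits.

Theorem lemma2p4 (R : realType)
    (dE : nat -> measure_display) (E : forall n, measurableType (dE n))
    (K : forall n, R.-pker E n ~> E n.+1) (x0 : E 0%N)
    (dO : measure_display) (Omega : measurableType dO)
    (P : probability Omega R) (X : forall n, {RV P >-> E n})
    (hX : is_markov_chain K x0 X)
    (G : forall n, path_space E n -> R) (hG : is_potential G)
    (Q : forall p n, (path_space E n -> R) -> path_space E p -> R)
    (hQ : is_fk_semigroup X G Q)
    (dT : nat -> measure_display) (T : forall N, measurableType (dT N))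
    (PN : forall N, probability (T N) R)
    (xi : forall N n, 'I_N -> {RV (PN N) >-> path_space E n})
    (hxi : forall N, (0 < N)%N -> is_particle_system K X G (xi N))
    (n : nat) (hn : (0 < n)%N)
    (dS : measure_display) (S : measurableType dS) (PS : probability S R)
    (W : forall p, (path_space E p -> R) -> S -> R)
    (hW : is_fk_gaussian_family X G PS W n)
    (d : nat) (hd : (0 < d)%N)
    (f : 'I_d -> path_space E n -> R)
    (hf : forall i, bounded_measurable (f i))
    (nu : 'I_d -> fk_kind) :
  let ZN N (w : T N) := \prod_(i < d)
    match nu i with
    | GammaKind => WgammaN X G (xi N) n (f i) w
    | EtaKind => WetaN X G (xi N) n (f i) w
    end in
  let Z (w : S) := \prod_(i < d)
    match nu i with
    | GammaKind => Wgamma X G W Q n (f i) w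
    | EtaKind => Weta X G W Q n (f i) w
    end in
  cvg_in_law PN ZN PS Z /\
  ('E_(PN N)[ZN N] @[N --> \oo] --> 'E_PS[Z])%E.
Proof.
(* Sequences are indexed by [k] with [k.+1] particles, which removes [N = 0] and leaves the limits
   unchanged. *)
pose xi' k m (i : 'I_k.+1) := xi k.+1 m i.
have hxi' k : is_particle_system K X G (xi' k) by exact: hxi.
have bZ := bm_product_particle_field hX hG hQ (xi := xi') hxi' hn hW nu hf.
have cvgZ := cvg_law_product hX hG hQ (xi := xi') hxi' hn hW (nu := nu) hf.
have iZ := integrable_product_gaussian_field hX hG hQ (xi := xi') hxi' hn hW nu hf.
have cvgE := cvg_expectation_product hX hG hQ (xi := xi') hxi' hn hW (nu := nu) hf.
move=> ZN Z; split.
- move=> h ch bh.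
  have hh : bm h by split => //; exact: continuous_measurable_fun.
  have mZ : measurable_fun setT Z.
    by apply: measurable_prod => i _; exact: (measurable_gaussian_field hQ hW nu hf i).
  rewrite -cvg_shiftS /= (expectation_Ex PS (bm_pre mZ hh)).
  rewrite (_ : (fun N => _) = fun k => (Ex (PN k.+1) (fun w => h (ZN k.+1 w)))%:E).
    by apply: cvg_EFin; [exact: nearW|exact: cvgZ].
  apply/funext => k; apply: expectation_Ex.
  by apply: bm_pre => //; apply: bm_meas; exact: bZ.
- rewrite -cvg_shiftS /=.
  (* [Z] is in general unbounded; finiteness of its expectation comes from [iZ]. *)
  have -> : 'E_PS[Z]%E = (Ex PS Z)%:E.
    by rewrite unlock /Rintegral fineK//; exact: integrable_fin_num.
  rewrite (_ : (fun N => _) = fun k => (Ex (PN k.+1) (ZN k.+1))%:E).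
    by apply: cvg_EFin; [exact: nearW|exact: cvgE].
  by apply/funext => k; apply: expectation_Ex; exact: bZ.
Qed.
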